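(* Let $1\leq k\leq n<\omega$. Then it is relatively consistent with $\mathrm{ZFC}$ that all of the following hold simultaneously: there is a cofinal set in ${}^\omega\omega$ isomorphic to $\omega_k\times\omega_n$ with respect to $<^*$; $2^{\aleph_0}<2^{\aleph_1}$; and $w\Diamond(S^i_{i+1})$ holds for all $1\leq i<n$.
   Context: For $f,g\in{}^\omega\omega$, $f<^* g$ means $f(i)<g(i)$ for all but finitely many $i\in\omega$. The product $\omega_k\times\omega_n$ carries the coordinatewise order: $(\alpha,\beta)\leq(\alpha',\beta')$ iff $\alpha\leq\alpha'$ and $\beta\leq\beta'$, with $<$ meaning $\leq$ and $\neq$. $S^i_{i+1}=\{\alpha<\omega_{i+1}\mid\mathrm{cof}(\alpha)=\omega_i\}$. For a stationary $S\subseteq\kappa$ ($\kappa$ regular uncountable), the weak diamond $w\Diamond(S)$ says: for every $F:2^{<\kappa}\to 2$ there is $g:\kappa\to 2$ such that for every $b:\kappa\to 2$ the set $\{\lambda\in S\mid g(\lambda)=F(b\restriction\lambda)\}$ is stationary in $\kappa$. *)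

(* Defs.v *)
(* A deep embedding of first-order set theory. *)
From Stdlib Require Import List PeanoNat.
Import ListNotations.

(** * First-order logic with equality in the language {∈} *)

(* De Bruijn indices.  The language has no function symbols, so a term is a
   variable and substitution is renaming.  The other connectives are the usual
   classical abbreviations. *)
Inductive form : Type :=
| Mem : nat -> nat -> form
| Eq  : nat -> nat -> form
| Bot : form
| Imp : form -> form -> form
| All : form -> form.

Definition Not (p : form) : form := Imp p Bot.
Definition And (p q : form) : form := Not (Imp p (Not q)).
Definition Or (p q : form) : form := Imp (Not p) q.
Definition Iff (p q : form) : form := And (Imp p q) (Imp q p).
Definition Ex (p : form) : form := Not (All (Not p)).

Definition up (r : nat -> nat) (i : nat) : nat :=
  match i with 0 => 0 | S j => S (r j) end.

Fixpoint ren (r : nat -> nat) (p : form) : form :=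
  match p with
  | Mem x y => Mem (r x) (r y)
  | Eq x y => Eq (r x) (r y)
  | Bot => Bot
  | Imp q s => Imp (ren r q) (ren r s)
  | All q => All (ren (up r) q)
  end.

(* [inst p t] is p(t): index 0 is replaced by t, and the others drop by one. *)
Definition inst (p : form) (t : nat) : form :=
  ren (fun i => match i with 0 => t | S j => j end) p.

(* All free variables of p are below [bound p]. *)
Fixpoint bound (p : form) : nat :=
  match p with
  | Mem x y | Eq x y => Nat.max (S x) (S y)
  | Bot => 0
  | Imp q s => Nat.max (bound q) (bound s)
  | All q => Nat.pred (bound q)
  end.

Definition closure (p : form) : form := Nat.iter (bound p) All p.

(* Classical natural deduction. *)
Reserved Notation "G ⊢ p" (at level 70, no associativity).
Inductive prv : list form -> form -> Prop :=
| Ax   G p : In p G -> G ⊢ p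
| ImpI G p q : p :: G ⊢ q -> G ⊢ Imp p q
| ImpE G p q : G ⊢ Imp p q -> G ⊢ p -> G ⊢ q
| RAA  G p : Not p :: G ⊢ Bot -> G ⊢ p
| AllI G p : map (ren S) G ⊢ p -> G ⊢ All p
| AllE G p t : G ⊢ All p -> G ⊢ inst p t
| EqI  G x : G ⊢ Eq x x
| EqE  G p x y : G ⊢ Eq x y -> G ⊢ inst p x -> G ⊢ inst p y
where "G ⊢ p" := (prv G p).

Definition theory : Type := form -> Prop.

Definition provable (T : theory) (p : form) : Prop :=
  exists G : list form, (forall q, In q G -> T q) /\ prv G p.

Definition consistent (T : theory) : Prop := ~ provable T Bot.

Definition extend (T : theory) (p : form) : theory := fun q => T q \/ q = p.

Definition relatively_consistent (T : theory) (p : form) : Prop :=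
  consistent T -> consistent (extend T p).

(** * Writing formulas with bound variables *)

(* An [fm] is a formula whose variables are de Bruijn levels, to be placed
   under d quantifiers; level x is then the index d - 1 - x.  This lets Rocq
   binders stand for the quantified variables.  [sentence] places it under no
   quantifier. *)
Definition fm : Type := nat -> form.
Definition sentence (A : fm) : form := A 0.

Definition fMem (x y : nat) : fm := fun d => Mem (d - S x) (d - S y).
Definition fEq (x y : nat) : fm := fun d => Eq (d - S x) (d - S y).
Definition fTrue : fm := fun _ => Imp Bot Bot.
Definition fNot (A : fm) : fm := fun d => Not (A d).
Definition fImp (A B : fm) : fm := fun d => Imp (A d) (B d).
Definition fAnd (A B : fm) : fm := fun d => And (A d) (B d).
Definition fOr (A B : fm) : fm := fun d => Or (A d) (B d).
Definition fIff (A B : fm) : fm := fun d => Iff (A d) (B d).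
Definition fAll (A : nat -> fm) : fm := fun d => All (A d (S d)).
Definition fEx (A : nat -> fm) : fm := fun d => Ex (A d (S d)).

Declare Scope fm_scope.
Delimit Scope fm_scope with fm.
Bind Scope fm_scope with fm.
Notation "x ∈ y" := (fMem x y) (at level 70, no associativity) : fm_scope.
Notation "x ≐ y" := (fEq x y) (at level 70, no associativity) : fm_scope.
Notation "¬ A" := (fNot A) (at level 75, right associativity) : fm_scope.
Notation "A ∧ B" := (fAnd A B) (at level 80, right associativity) : fm_scope.
Notation "A ∨ B" := (fOr A B) (at level 85, right associativity) : fm_scope.
Notation "A ⇔ B" := (fIff A B) (at level 95, no associativity) : fm_scope.
Notation "A ⇒ B" := (fImp A B) (at level 99, right associativity) : fm_scope.
Notation "∀ x .. y , A" := (fAll (fun x => .. (fAll (fun y => A%fm)) ..))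
  (at level 200, x binder, y binder, right associativity) : fm_scope.
Notation "∃ x .. y , A" := (fEx (fun x => .. (fEx (fun y => A%fm)) ..))
  (at level 200, x binder, y binder, right associativity) : fm_scope.
Local Open Scope fm_scope.

(** * Basic set theory *)

Definition subset x y : fm := ∀ z, z ∈ x ⇒ z ∈ y.
Definition is_empty x : fm := ∀ z, ¬ z ∈ x.
Definition is_upair p x y : fm := ∀ z, z ∈ p ⇔ (z ≐ x ∨ z ≐ y).
(* p = {{x}, {x, y}} *)
Definition is_opair p x y : fm :=
  ∃ a b, is_upair a x x ∧ is_upair b x y ∧ is_upair p a b.
Definition is_succ y x : fm := ∀ z, z ∈ y ⇔ (z ∈ x ∨ z ≐ x).

(* (x, y) ∈ f, i.e. f(x) = y when f is a function. *)
Definition app f x y : fm := ∃ p, is_opair p x y ∧ p ∈ f.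
(* f : A -> B *)
Definition is_fun f A B : fm :=
  (∀ p, p ∈ f ⇒ ∃ x y, x ∈ A ∧ y ∈ B ∧ is_opair p x y) ∧
  (∀ x, x ∈ A ⇒ ∃ y, app f x y ∧ ∀ z, app f x z ⇒ z ≐ y).
Definition is_inj f A B : fm :=
  is_fun f A B ∧ (∀ x x' y, app f x y ∧ app f x' y ⇒ x ≐ x').
Definition is_bij f A B : fm :=
  is_inj f A B ∧ (∀ y, y ∈ B ⇒ ∃ x, x ∈ A ∧ app f x y).
Definition is_prod P A B : fm :=
  ∀ p, p ∈ P ⇔ (∃ x y, x ∈ A ∧ y ∈ B ∧ is_opair p x y).
(* X is the set of all functions from A to B. *)
Definition is_fun_space X A B : fm := ∀ f, f ∈ X ⇔ is_fun f A B.
(* r = f ↾ A *)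
Definition is_restr r f A : fm :=
  ∀ p, p ∈ r ⇔ (p ∈ f ∧ ∃ x y, x ∈ A ∧ is_opair p x y).

Definition card_le A B : fm := ∃ f, is_inj f A B.
Definition card_lt A B : fm := card_le A B ∧ ¬ card_le B A.

(** * The theory ZFC *)

Inductive ZFC : theory :=
| Extensionality :
    ZFC (sentence (∀ x y, (∀ z, z ∈ x ⇔ z ∈ y) ⇒ x ≐ y))
| Foundation :
    ZFC (sentence (∀ x, (∃ y, y ∈ x) ⇒ ∃ y, y ∈ x ∧ ∀ z, z ∈ y ⇒ ¬ z ∈ x))
| Pairing :
    ZFC (sentence (∀ x y, ∃ p, is_upair p x y))
| Union :
    ZFC (sentence (∀ x, ∃ u, ∀ z, z ∈ u ⇔ (∃ y, y ∈ x ∧ z ∈ y)))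
| PowerSet :
    ZFC (sentence (∀ x, ∃ p, ∀ z, z ∈ p ⇔ subset z x))
| Infinity :
    ZFC (sentence (∃ w, (∃ e, e ∈ w ∧ is_empty e) ∧
                        (∀ x, x ∈ w ⇒ ∃ y, y ∈ w ∧ is_succ y x)))
(* Every set of nonempty pairwise disjoint sets has a transversal. *)
| Choice :
    ZFC (sentence (∀ X, (∀ x, x ∈ X ⇒ ∃ u, u ∈ x) ∧
                        (∀ x y u, x ∈ X ∧ y ∈ X ∧ u ∈ x ∧ u ∈ y ⇒ x ≐ y) ⇒
                        ∃ c, ∀ x, x ∈ X ⇒ ∃ z, ∀ u, (u ∈ c ∧ u ∈ x) ⇔ u ≐ z))
(* ∀a ∃b ∀x (x ∈ b ⇔ x ∈ a ∧ p(x, a, ..)), where p has x as index 0, a as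
   index 1 and parameters above; the renaming skips b. *)
| Separation (p : form) :
    ZFC (closure (All (Ex (All (Iff (Mem 0 1)
      (And (Mem 0 2) (ren (up S) p)))))))
(* (∀x ∀y ∀z (p(x, y, ..) ∧ p(x, z, ..) ⇒ y = z)) ⇒
   ∀a ∃b ∀y (y ∈ b ⇔ ∃x (x ∈ a ∧ p(x, y, ..))), where p has y as index 0, x
   as index 1 and parameters above. *)
| Replacement (p : form) :
    ZFC (closure (Imp
      (All (All (All (Imp
         (And (ren (fun i => match i with 0 => 1 | 1 => 2 | S (S j) => S (S (S j)) end) p)
              (ren (fun i => match i with 0 => 0 | 1 => 2 | S (S j) => S (S (S j)) end) p))
         (Eq 1 0)))))
      (All (Ex (All (Iff (Mem 0 1)
         (Ex (And (Mem 0 3)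
           (ren (fun i => match i with
                          | 0 => 1 | 1 => 0 | S (S j) => S (S (S (S j)))
                          end) p))))))))).

(** * Ordinals and the alephs *)

Definition is_trans x : fm := ∀ y, y ∈ x ⇒ subset y x.
(* Adequate in the presence of Foundation. *)
Definition is_ord x : fm := is_trans x ∧ ∀ y, y ∈ x ⇒ is_trans y.
Definition ord_le a b : fm := a ∈ b ∨ a ≐ b.
Definition is_limit x : fm :=
  is_ord x ∧ (∃ y, y ∈ x) ∧ (∀ y, y ∈ x ⇒ ∃ z, z ∈ x ∧ y ∈ z).
Definition is_omega w : fm := is_limit w ∧ ∀ y, y ∈ w ⇒ ¬ is_limit y.
Definition is_two t : fm := ∃ z o, is_empty z ∧ is_succ o z ∧ is_succ t o.
Definition finite s : fm := ∃ w m, is_omega w ∧ m ∈ w ∧ card_le s m.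

(* x = ω_k, for a natural number k of the metatheory: ω_{k+1} is the least
   ordinal that does not inject into ω_k. *)
Fixpoint is_aleph (k : nat) (x : nat) : fm :=
  match k with
  | 0 => is_omega x
  | S j => ∃ y, is_aleph j y ∧ is_ord x ∧ ¬ card_le x y ∧
                ∀ z, z ∈ x ⇒ card_le z y
  end.

(** * Cofinal subsets of the Baire space *)

(* f <^* g, where w = ω *)
Definition lt_star w f g : fm :=
  ∃ s, finite s ∧ ∀ i, i ∈ w ∧ ¬ i ∈ s ⇒
    ∃ a b, app f i a ∧ app g i b ∧ a ∈ b.

(* p < q coordinatewise, for pairs of ordinals *)
Definition prod_lt p q : fm :=
  (∃ a b a' b', is_opair p a b ∧ is_opair q a' b' ∧
                ord_le a a' ∧ ord_le b b') ∧ ¬ p ≐ q.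

Definition cofinal_in_baire w D : fm :=
  (∀ f, f ∈ D ⇒ is_fun f w w) ∧
  (∀ g, is_fun g w w ⇒ ∃ f, f ∈ D ∧ lt_star w g f).

Definition cofinal_iso (k n : nat) : fm :=
  ∃ w A B P D h,
    is_omega w ∧ is_aleph k A ∧ is_aleph n B ∧ is_prod P A B ∧
    cofinal_in_baire w D ∧ is_bij h P D ∧
    ∀ p q f g, p ∈ P ∧ q ∈ P ∧ app h p f ∧ app h q g ⇒
      (prod_lt p q ⇔ lt_star w f g).

(* 2^ℵ_0 < 2^ℵ_1 *)
Definition continuum_lt : fm :=
  ∃ w w1 t X Y,
    is_aleph 0 w ∧ is_aleph 1 w1 ∧ is_two t ∧
    is_fun_space X w t ∧ is_fun_space Y w1 t ∧ card_lt X Y.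

(** * Weak diamond *)

Definition is_club C κ : fm :=
  subset C κ ∧
  (∀ a, a ∈ κ ⇒ ∃ c, c ∈ C ∧ a ∈ c) ∧
  (∀ l, l ∈ κ ∧ is_limit l ∧ (∀ a, a ∈ l ⇒ ∃ c, c ∈ C ∧ c ∈ l ∧ a ∈ c) ⇒
        l ∈ C).
Definition is_stationary T κ : fm :=
  subset T κ ∧ ∀ C, is_club C κ ⇒ ∃ x, x ∈ C ∧ x ∈ T.

(* Some function from b to a has unbounded range in a. *)
Definition cofinal_map_from b a : fm :=
  ∃ f, is_fun f b a ∧ ∀ c, c ∈ a ⇒ ∃ x y, app f x y ∧ ord_le c y.
(* b = cof(a) *)
Definition is_cof b a : fm :=
  is_ord b ∧ cofinal_map_from b a ∧ ∀ c, c ∈ b ⇒ ¬ cofinal_map_from c a.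

(* s ∈ Q iff s : α -> 2 for some α < κ *)
Definition is_bin_tree Q κ t : fm :=
  ∀ s, s ∈ Q ⇔ (∃ a, a ∈ κ ∧ is_fun s a t).

Definition weak_diamond S κ : fm :=
  ∃ t Q, is_two t ∧ is_bin_tree Q κ t ∧
    ∀ F, is_fun F Q t ⇒
      ∃ g, is_fun g κ t ∧
        ∀ b, is_fun b κ t ⇒
          ∃ T, is_stationary T κ ∧
            ∀ l, l ∈ T ⇔
              (l ∈ S ∧ ∃ r v, is_restr r b l ∧ app F r v ∧ app g l v).

(* The weak diamond for S^i_{i+1}. *)
Definition weak_diamond_cof (i : nat) : fm :=
  ∃ μ κ S, is_aleph i μ ∧ is_aleph (i + 1) κ ∧
    (∀ a, a ∈ S ⇔ (a ∈ κ ∧ is_cof μ a)) ∧ weak_diamond S κ.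

(* [seq 1 (n - 1)] lists the i with 1 <= i < n. *)
Definition weak_diamonds_below (n : nat) : fm :=
  fold_right (fun i A => weak_diamond_cof i ∧ A) fTrue (seq 1 (n - 1)).

(* Main.v *)
(* Classical Rocq with choice serves as the ground universe, and the theory is
   satisfied by a forcing extension of it: a forcing relation on names over
   Rocq's types forces ZFC and the three statements.

   Fix cardinals kappa_0 = omega < kappa_1 < ... < kappa_n, where kappa_{l+1} is
   the successor of some T_l with T_l ^ kappa_l = T_l, and very large lambda_0,
   ..., lambda_{n-1}.  The forcing is the product of Hechler's forcing along
   kappa_k x kappa_n and of the posets of partial functions of size less than
   kappa_{l+1} from lambda_l x kappa_{l+1} to T_{l+1}, for l < n.  For each m the
   factors below level m have the kappa_{m+1}-chain condition, and the others
   are kappa_{m+1}-closed; with Easton's lemma, kappa_l becomes omega_l, and all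
   reals come from Hechler's forcing, where the generic reals are cofinal since
   every small subset of kappa_k x kappa_n has a strict upper bound.

   There are more generic functions of level l than names of the factors below
   l.  If 2^omega_1 injected into 2^omega, two compatible conditions would give
   the same real to distinct generic subsets of omega_1.  If no generic function
   g_xi of level i guesses F, a fusion of length kappa_i yields, for each xi, a
   condition, a point delta of cofinality kappa_i at which g_xi is not decided,
   and a name b from below level i for the restriction to delta of the
   counterexample, such that F(b) <> g_xi(delta) is forced.  Two compatible
   conditions share delta and b, and extend so that the two generic functions
   take different values at delta: then F(b) has no value left. *)
From Stdlib Require Import List PeanoNat Compare_dec Lia Wf_nat Eqdep_dec Classical
  ClassicalEpsilon FunctionalExtensionality PropExtensionality.
From mathcomp Require wochoice boolp classical_sets.
Require Import Defs.
Import ListNotations.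
Set Implicit Arguments.


(** * Forcing over the types of the metatheory *)

(** No instance of the continuum hypothesis is available in the ground, so [Kl (S l)] need not be
    the successor of [Kl l]: it is the successor of a power set [Tl l], and the cardinals in between
    must be collapsed. Hence the partial functions take values in [Tl (S l)] and not in 2, and the
    stems of Hechler's forcing carry labels in [Tl 0]: a generic function of level l maps onto
    [Tl (S l)], and the labels at one coordinate run through [Tl 0]. One bit of the same generic
    functions supplies the new subsets and the guessing functions.

    The generic functions of a level must outnumber the names over the lower levels, so the levels
    are defined by recursion: [RT l] collects the lower parts of conditions, and [Lam l] is a power
    set built from it.

    Cardinal arithmetic is replaced by trees: a type E of trees is closed under pairs by its
    constructor, so its power set T satisfies T^E = T.

    Promises are arbitrary elements of an inductive type; nothing requires them to mention lower
    coordinates only, since the order reads them only below their coordinate. *)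

Class poset (P : Type) := {
  ple : P -> P -> Prop;
  ple_refl : forall p, ple p p;
  ple_trans : forall p q r, ple p q -> ple q r -> ple p r }.
Arguments ple : simpl never.
Infix "≼" := ple (at level 70, no associativity).
#[global] Hint Resolve ple_refl : core.

(** The condition sets [v] are arbitrary. They are read through [dcl], the closure under stronger
    conditions, so names are built without monotonicity proofs. *)
Inductive name (P : Type) : Type :=
| sup (A : Type) (f : A -> name P) (v : A -> P -> Prop).

Lemma pred_ext {X} (A B : X -> Prop) : (forall x, A x <-> B x) -> A = B.
Proof.
  intro H. apply functional_extensionality. intro x.
  apply propositional_extensionality, H.
Qed.

Section Truth.
Context {P : Type} {PP : poset P}.
Implicit Types (p q r s : P) (A B C : P -> Prop).

(** Density of [A] below [p]. On monotone predicates [dn] is the regularisation of an open set; the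
    [stable] predicates are the regular open sets, on which classical logic is sound. *)
Definition dn A p := forall q, q ≼ p -> exists r, r ≼ q /\ A r.
Definition dcl A p := exists s, p ≼ s /\ A s.
Definition mono A := forall p q, q ≼ p -> A p -> A q.
Definition stable A := mono A /\ forall p, dn A p -> A p.

Definition obot : P -> Prop := fun _ => False.
Definition oimp A B : P -> Prop := fun p => forall q, q ≼ p -> A q -> B q.
Definition onot A := oimp A obot.
Definition oall {X} (A : X -> P -> Prop) : P -> Prop := fun p => forall x, A x p.
Definition oand A B : P -> Prop := fun p => A p /\ B p.
Definition oor A B : P -> Prop := dn (fun p => A p \/ B p).
Definition oex {X} (A : X -> P -> Prop) : P -> Prop := dn (fun p => exists x, A x p).
Definition oiff A B := oand (oimp A B) (oimp B A).

Lemma dn_mono A : mono (dn A).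
Proof. intros p q Hq H r Hr. apply H. eapply ple_trans; eauto. Qed.

Lemma dn_stable A : stable (dn A).
Proof.
  split. apply dn_mono. intros p H q Hq.
  destruct (H q Hq) as (r & Hr & Hr'). destruct (Hr' r (ple_refl r)) as (s & Hs & Hs').
  exists s. split; auto. eapply ple_trans; eauto.
Qed.

Lemma dn_intro A p : mono A -> A p -> dn A p.
Proof. intros HA H q Hq. exists q. split; auto. eapply HA; eauto. Qed.

Lemma dn_bind A B p : dn A p -> (forall q, q ≼ p -> A q -> dn B q) -> dn B p.
Proof.
  intros H K q Hq. destruct (H q Hq) as (r & Hr & Ar).
  destruct (K r (ple_trans _ _ _ Hr Hq) Ar r (ple_refl r)) as (s & Hs & Bs).
  exists s. split; auto. eapply ple_trans; eauto.
Qed.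

Lemma dn_map A B p : dn A p -> (forall q, q ≼ p -> A q -> B q) -> dn B p.
Proof.
  intros H K q Hq. destruct (H q Hq) as (r & Hr & Ar).
  exists r. split; auto. apply K; auto. eapply ple_trans; eauto.
Qed.

Lemma dn_elim A B p : stable B -> dn A p -> (forall q, q ≼ p -> A q -> B q) -> B p.
Proof. intros HB H K. apply HB. eapply dn_map; eauto. Qed.

Lemma not_stable_ext B p : stable B -> ~ B p -> exists q, q ≼ p /\ forall r, r ≼ q -> ~ B r.
Proof.
  intros HB H. apply NNPP. intro K. apply H, HB. intros q Hq.
  apply NNPP. intro K'. apply K. exists q. split; auto.
  intros r Hr HBr. apply K'. exists r. auto.
Qed.

Lemma dcl_mono A : mono (dcl A).
Proof. intros p q Hq (s & Hs & As). exists s. split; auto. eapply ple_trans; eauto. Qed.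

Lemma dcl_intro A p : A p -> dcl A p.
Proof. exists p. auto. Qed.

Lemma dcl_of_mono A p : mono A -> dcl A p -> A p.
Proof. intros HA (s & Hs & As). eapply HA; eauto. Qed.

Lemma stable_obot : stable obot.
Proof. split. intros p q _ []. intros p H. destruct (H p (ple_refl p)) as (r & _ & []). Qed.


Lemma stable_oimp A B : mono A -> stable B -> stable (oimp A B).
Proof.
  intros HA [HB1 HB2]. split.
  - intros p q Hq H r Hr. apply H. eapply ple_trans; eauto.
  - intros p H q Hq Aq. apply HB2. intros r Hr.
    destruct (H r (ple_trans _ _ _ Hr Hq)) as (s & Hs & Hs').
    exists s. split; auto. apply Hs'; auto. eapply HA; [|exact Aq]. eapply ple_trans; eauto.
Qed.

Lemma stable_oall {X} (A : X -> P -> Prop) : (forall x, stable (A x)) -> stable (oall A).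
Proof.
  intros H. split.
  - intros p q Hq K x. exact (proj1 (H x) p q Hq (K x)).
  - intros p K x. apply H. eapply dn_map; [exact K|]. intros q _ L. apply L.
Qed.

Lemma stable_oand A B : stable A -> stable B -> stable (oand A B).
Proof.
  intros [HA1 HA2] [HB1 HB2]. split.
  - intros p q Hq []. split; eauto.
  - intros p K. split; [apply HA2|apply HB2]; (eapply dn_map; [exact K|]); intros q _ []; auto.
Qed.

Lemma stable_mono A : stable A -> mono A.
Proof. intros []. auto. Qed.

Lemma stable_onot A : mono A -> stable (onot A).
Proof. intro. apply stable_oimp; auto using stable_obot. Qed.

Lemma mono_onot A : mono (onot A).
Proof. intros p q Hq H r Hr. apply H. eapply ple_trans; eauto. Qed.

Lemma mono_oimp A B : mono (oimp A B).
Proof. intros p q Hq H r Hr. apply H. eapply ple_trans; eauto. Qed.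

Lemma oor_stable A B : stable (oor A B).
Proof. apply dn_stable. Qed.

Lemma oex_stable {X} (A : X -> P -> Prop) : stable (oex A).
Proof. apply dn_stable. Qed.

Lemma onot_onot A p : stable A -> onot (onot A) p -> A p.
Proof.
  intros HA H. apply NNPP. intro K. destruct (not_stable_ext p HA K) as (q & Hq & Hq').
  apply (H q Hq). intros r Hr. apply Hq'. auto.
Qed.

(** Conjunction, disjunction and existence are abbreviations through negation. As equalities of
    predicates, these lemmas rewrite them into direct forcing clauses. *)
Lemma classical_oand A B : stable A -> stable B ->
  onot (oimp A (onot B)) = oand A B.
Proof.
  intros HA HB. apply pred_ext. intro p. split.
  - intro H. split.
    + apply onot_onot; auto. intros q Hq K. apply (H q Hq). intros r Hr Ar. destruct (K r Hr Ar).
    + apply onot_onot; auto. intros q Hq K. apply (H q Hq). intros r Hr Ar s Hs Bs.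
      apply (K s); auto. eapply ple_trans; eauto.
  - intros [Ap Bp] q Hq K. apply (K q (ple_refl q)) with q; auto.
    exact (proj1 HA _ _ Hq Ap). exact (proj1 HB _ _ Hq Bp).
Qed.

Lemma classical_oor A B : stable A -> stable B -> oimp (onot A) B = oor A B.
Proof.
  intros HA HB. apply pred_ext. intro p. split.
  - intros H q Hq. destruct (classic (exists r, r ≼ q /\ A r)) as [(r & Hr & Ar)|K].
    + exists r. auto.
    + exists q. split; auto. right. apply H; auto. intros r Hr Ar. apply K. eauto.
  - intros H q Hq K. apply HB. intros r Hr.
    destruct (H r) as (s & Hs & [As|Bs]); [eapply ple_trans; eauto| |].
    + destruct (K s); auto. eapply ple_trans; eauto.
    + eauto.
Qed.

Lemma classical_oex {X} (A : X -> P -> Prop) :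
  onot (oall (fun x => onot (A x))) = oex A.
Proof.
  apply pred_ext. intro p. split.
  - intros H q Hq. apply NNPP. intro K. apply (H q Hq). intros x r Hr Ar.
    apply K. exists r. eauto.
  - intros H q Hq K. destruct (H q Hq) as (r & Hr & x & Ax). exact (K x r Hr Ax).
Qed.

(** Elements of [y] need partners too, but both clauses call [feq] at some [f a], so recursion on
    the first name suffices. *)
Fixpoint feq (x y : name P) (p : P) {struct x} : Prop :=
  match x, y with
  | @sup _ A f v, @sup _ B g w =>
    (forall a q, q ≼ p -> dcl (v a) q ->
       dn (fun r => exists b, dcl (w b) r /\ feq (f a) (g b) r) q) /\
    (forall b q, q ≼ p -> dcl (w b) q ->
       dn (fun r => exists a, dcl (v a) r /\ feq (f a) (g b) r) q)
  end.

Definition fmem (x y : name P) (p : P) : Prop :=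
  match y with
  | @sup _ B g w => dn (fun r => exists b, dcl (w b) r /\ feq x (g b) r) p
  end.

Lemma feq_stable x y : stable (feq x y).
Proof.
  destruct x as [A f v], y as [B g w]. split.
  - intros p q Hq [H1 H2]. split; intros; [apply H1|apply H2]; auto; eapply ple_trans; eauto.
  - intros p H. split; intros a q Hq Ha r Hr.
    + destruct (H r (ple_trans _ _ _ Hr Hq)) as (s & Hs & H1 & _).
      destruct (H1 a s (ple_refl s)) with s as (t & Ht & Ht'); auto.
      eapply dcl_mono; [|exact Ha]. eapply ple_trans; eauto.
      exists t. split; auto. eapply ple_trans; eauto.
    + destruct (H r (ple_trans _ _ _ Hr Hq)) as (s & Hs & _ & H1).
      destruct (H1 a s (ple_refl s)) with s as (t & Ht & Ht'); auto.
      eapply dcl_mono; [|exact Ha]. eapply ple_trans; eauto.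
      exists t. split; auto. eapply ple_trans; eauto.
Qed.

Lemma fmem_stable x y : stable (fmem x y).
Proof. destruct y. apply dn_stable. Qed.

Lemma feq_mono x y p q : q ≼ p -> feq x y p -> feq x y q.
Proof. apply feq_stable. Qed.

Lemma fmem_mono x y p q : q ≼ p -> fmem x y p -> fmem x y q.
Proof. apply fmem_stable. Qed.

Lemma feq_refl x p : feq x x p.
Proof.
  revert p. induction x as [A f IH v]. intro p. simpl.
  split; intros a q Hq Ha r Hr; exists r; split; auto; exists a; split; auto;
    eapply dcl_mono; eauto.
Qed.

Lemma feq_sym x y p : feq x y p -> feq y x p.
Proof.
  revert y p. induction x as [A f IH v]. intros [B g w] p [H1 H2].
  split; intros a q Hq Ha; [eapply dn_map; [eapply H2; eauto|]|eapply dn_map; [eapply H1; eauto|]];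
    intros r Hr (b & Hb & E); exists b; auto.
Qed.

Lemma feq_trans x y z p : feq x y p -> feq y z p -> feq x z p.
Proof.
  revert y z p. induction x as [A f IH v].
  intros [B g w] [C h u] p [H1 H2] [K1 K2]. split; intros a q Hq Ha.
  - eapply dn_bind. apply H1; eauto. intros r Hr (b & Hb & E).
    eapply dn_bind. apply (K1 b r); auto. eapply ple_trans; eauto.
    intros s Hs (c & Hc & E'). apply dn_intro.
    { intros p1 q1 L (c1 & Hc1 & Hc2). exists c1. split. eapply dcl_mono; eauto. eapply feq_mono; eauto. }
    exists c. split; auto. eapply IH; eauto. eapply feq_mono; eauto.
  - eapply dn_bind. apply K2; eauto. intros r Hr (b & Hb & E).
    eapply dn_bind. apply (H2 b r); auto. eapply ple_trans; eauto.
    intros s Hs (c & Hc & E'). apply dn_intro.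
    { intros p1 q1 L (c1 & Hc1 & Hc2). exists c1. split. eapply dcl_mono; eauto. eapply feq_mono; eauto. }
    exists c. split; auto. eapply IH; eauto. eapply feq_mono; eauto.
Qed.

Lemma fmem_cong_l x x' y p : feq x x' p -> fmem x y p -> fmem x' y p.
Proof.
  destruct y as [B g w]. intros E H. eapply dn_map. exact H.
  intros q Hq (b & Hb & E'). exists b. split; auto.
  eapply feq_trans; eauto. apply feq_sym. eapply feq_mono; eauto.
Qed.

Lemma fmem_cong_r x y y' p : feq y y' p -> fmem x y p -> fmem x y' p.
Proof.
  destruct y as [B g w], y' as [B' g' w']. intros [E _] H.
  eapply dn_bind. exact H. intros q Hq (b & Hb & E').
  eapply dn_map. apply (E b q); auto. intros r Hr (b' & Hb' & E'').
  exists b'. split; auto. eapply feq_trans; eauto. eapply feq_mono; eauto.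
Qed.

Lemma feq_ext x y p :
  (forall z q, q ≼ p -> fmem z x q <-> fmem z y q) -> feq x y p.
Proof.
  destruct x as [A f v], y as [B g w]. intro H. split; intros a q Hq Ha.
  - apply (H (f a) q Hq). apply dn_intro; [|exists a; auto using feq_refl].
    intros p1 q1 L (c1 & Hc1 & Hc2). exists c1. split. eapply dcl_mono; eauto. eapply feq_mono; eauto.
  - assert (K : fmem (g a) (sup f v) q).
    { apply (H (g a) q Hq). apply dn_intro; [|exists a; auto using feq_refl].
      intros p1 q1 L (c1 & Hc1 & Hc2). exists c1. split. eapply dcl_mono; eauto. eapply feq_mono; eauto. }
    eapply dn_map. exact K. intros r Hr (b & Hb & E). exists b. auto using feq_sym.
Qed.

Lemma fmem_intro (A : Type) (f : A -> name P) v a p : dcl (v a) p -> fmem (f a) (sup f v) p.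
Proof.
  intro H. intros q Hq. exists q. split; auto. exists a. split.
  eapply dcl_mono; eauto. apply feq_refl.
Qed.

Definition scons {X} (x : X) (e : nat -> X) : nat -> X :=
  fun i => match i with 0 => x | S j => e j end.

Fixpoint forces (phi : form) (e : nat -> name P) : P -> Prop :=
  match phi with
  | Mem x y => fmem (e x) (e y)
  | Eq x y => feq (e x) (e y)
  | Bot => obot
  | Imp a b => oimp (forces a e) (forces b e)
  | All a => oall (fun x => forces a (scons x e))
  end.

Lemma forces_stable phi : forall e, stable (forces phi e).
Proof.
  induction phi; intro e; simpl.
  - apply fmem_stable.
  - apply feq_stable.
  - apply stable_obot.
  - apply stable_oimp; auto. apply IHphi1.
  - apply stable_oall. auto.
Qed.

Lemma forces_ren phi : forall (f : nat -> nat) e, forces (ren f phi) e = forces phi (fun i => e (f i)).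
Proof.
  induction phi; intros f e; simpl; auto.
  - rewrite IHphi1, IHphi2. reflexivity.
  - f_equal. apply functional_extensionality. intro x. rewrite IHphi. f_equal.
    apply functional_extensionality. intros [|i]; reflexivity.
Qed.

Lemma forces_inst phi t e : forces (inst phi t) e = forces phi (scons (e t) e).
Proof.
  unfold inst. rewrite forces_ren. f_equal.
  apply functional_extensionality. intros [|i]; reflexivity.
Qed.

Lemma forces_cong phi : forall e e' p,
  (forall i, feq (e i) (e' i) p) -> forces phi e p -> forces phi e' p.
Proof.
  induction phi; intros e e' p E; simpl; auto.
  - intro H. eapply fmem_cong_r. apply E. eapply fmem_cong_l. apply E. auto.
  - intro H. eapply feq_trans. apply feq_sym, E. eapply feq_trans. apply H. apply E.
  - intros H q Hq K. apply IHphi2 with e. { intro i. eapply feq_mono; eauto. }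
    apply H; auto. apply IHphi1 with e'; auto. intro i. apply feq_sym. eapply feq_mono; eauto.
  - intros H x. apply IHphi with (scons x e). intros [|i]; simpl. apply feq_refl. apply E. apply H.
Qed.

Lemma prv_sound G phi : prv G phi ->
  forall e p, (forall psi, In psi G -> forces psi e p) -> forces phi e p.
Proof.
  induction 1; intros e s HG; simpl in *.
  - auto.
  - intros q' Hq Kq. apply IHprv. intros psi [<-|K]; auto.
    eapply (proj1 (forces_stable _ _)); eauto.
  - apply (IHprv1 e s HG s (ple_refl s)). auto.
  - apply onot_onot. apply forces_stable. intros q' Hq K.
    apply (IHprv e q'). intros psi [<-|L]; auto. eapply (proj1 (forces_stable _ _)); eauto.
  - intro x. apply IHprv. intros psi K. apply in_map_iff in K as (chi & <- & K).
    rewrite forces_ren. apply HG. auto.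
  - rewrite forces_inst. apply IHprv. auto.
  - apply feq_refl.
  - rewrite forces_inst in *. specialize (IHprv2 e s HG). rewrite forces_inst in IHprv2.
    eapply forces_cong; [|exact IHprv2]. intros [|i]; simpl. apply IHprv1. auto. apply feq_refl.
Qed.

(** [Bot] holds at no condition, so soundness at the single condition [p] refutes a derivation of
    it; the environment sends every variable to an empty name. *)
Lemma forced_consistent (T : theory) (p : P) :
  (forall phi, T phi -> forall e q, forces phi e q) -> consistent T.
Proof.
  intros H (G & HG & K).
  apply (prv_sound K (fun _ => sup (fun x : Empty_set => match x with end) (fun _ _ => False)) p).
  intros psi L. apply H. auto.
Qed.

Lemma forces_closure phi : (forall e p, forces phi e p) -> forall e p, forces (closure phi) e p.
Proof.
  intro H. unfold closure. induction (bound phi) as [|k IH]; simpl; auto.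
  intros e p x. apply IH.
Qed.

Lemma forces_And a b e : forces (And a b) e = oand (forces a e) (forces b e).
Proof. apply classical_oand; apply forces_stable. Qed.

Lemma forces_Or a b e : forces (Or a b) e = oor (forces a e) (forces b e).
Proof. apply classical_oor; apply forces_stable. Qed.

Lemma forces_Ex a e : forces (Ex a) e = oex (fun x => forces a (scons x e)).
Proof. apply classical_oex. Qed.

Lemma forces_Iff a b e : forces (Iff a b) e = oiff (forces a e) (forces b e).
Proof. unfold Iff. rewrite forces_And. reflexivity. Qed.

End Truth.

(** * Well-orders and Zorn's lemma *)

Record well_order {X : Type} (lt : X -> X -> Prop) : Prop := {
  wo_trans : forall x y z, lt x y -> lt y z -> lt x z;
  wo_total : forall x y, lt x y \/ x = y \/ lt y x;
  wo_wf : well_founded lt }.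

Lemma wo_irrefl {X} (lt : X -> X -> Prop) : well_order lt -> forall x, ~ lt x x.
Proof.
  intros W x. induction x as [x IH] using (well_founded_ind (wo_wf W)).
  intro H. exact (IH x H H).
Qed.

Lemma wo_least {X} (lt : X -> X -> Prop) : well_order lt -> forall A : X -> Prop,
  (exists x, A x) -> exists x, A x /\ forall y, lt y x -> ~ A y.
Proof.
  intros W A [x Ax]. apply NNPP. intro H.
  induction x as [x IH] using (well_founded_ind (wo_wf W)).
  apply H. exists x. split; [exact Ax|]. intros y Hy Ay. exact (IH y Hy Ay).
Qed.

Lemma well_ordering (X : Type) : exists lt : X -> X -> Prop, well_order lt.
Proof.
  destruct (wochoice.well_ordering_principle
    (eqtype.Equality.Pack (eqtype.Equality.Class (boolp.gen_eqMixin X)))) as [R HR].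
  (* Least elements in unbundled form. Totality, antisymmetry and transitivity then come from least
     elements of sets of two or three points. *)
  assert (M : forall A : X -> Prop, (exists x, A x) ->
    exists z, A z /\ (forall y, A y -> is_true (R z y)) /\
      forall z', A z' -> (forall y, A y -> is_true (R z' y)) -> z = z').
  { intros A [x Ax].
    pose (B := (fun y : X => boolp.asbool (A y)) : ssrbool.pred_sort (ssrbool.predPredType X)).
    assert (HB : forall y, is_true (ssrbool.in_mem y (ssrbool.mem B)) <-> A y).
    { intro y. symmetry. apply (ssrbool.rwP (boolp.asboolP (A y))). }
    destruct (HR B) as [z [[Z1 Z2] Z3]]. { exists x. apply HB, Ax. }
    exists z. split; [apply HB, Z1|]. split.
    - intros y Ay. apply (Z2 y). apply HB, Ay.
    - intros z' Az' Hz'. apply Z3. split. apply HB, Az'. intros y Hy. apply Hz', HB, Hy. }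
  assert (tot : forall x y, is_true (R x y) \/ is_true (R y x)).
  { intros x y. destruct (M (fun z => z = x \/ z = y)) as (z & [->| ->] & Hz & _); eauto. }
  assert (anti : forall x y, is_true (R x y) -> is_true (R y x) -> x = y).
  { intros x y Hxy Hyx. destruct (M (fun z => z = x \/ z = y)) as (z & Az & Hz & Uz); eauto.
    assert (rx : is_true (R x x)) by (destruct (tot x x); auto).
    assert (ry : is_true (R y y)) by (destruct (tot y y); auto).
    rewrite <- (Uz x), <- (Uz y); auto; intros w [->| ->]; auto. }
  assert (tr : forall x y z, is_true (R x y) -> is_true (R y z) -> is_true (R x z)).
  { intros x y z Hxy Hyz. destruct (M (fun w => w = x \/ w = y \/ w = z)) as (w & Aw & Hw & _); eauto.
    destruct Aw as [-> |[-> | ->]].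
    - apply Hw; auto.
    - rewrite (anti x y); auto.
    - rewrite <- (anti y z); auto. }
  exists (fun x y => is_true (R x y) /\ x <> y). split.
  - intros x y z [H1 H2] [K1 K2]. split. eapply tr; eauto.
    intros ->. apply K2. apply anti; auto.
  - intros x y. destruct (classic (x = y)); auto. destruct (tot x y); auto.
  - intro x. apply NNPP. intro Hx.
    destruct (M (fun y => ~ Acc (fun x y => is_true (R x y) /\ x <> y) y)) as (z & Az & Hz & _); eauto.
    apply Az. constructor. intros y [Hy1 Hy2]. apply NNPP. intro K.
    apply Hy2. apply anti; auto.
Qed.

Lemma zorn_family {X : Type} (Q : (X -> Prop) -> Prop) :
  (forall F : (X -> Prop) -> Prop, (forall A, F A -> Q A) ->
     (forall A B, F A -> F B -> (forall x, A x -> B x) \/ (forall x, B x -> A x)) ->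
     Q (fun x => exists A, F A /\ A x)) ->
  exists A, Q A /\ forall B, Q B -> (forall x, A x -> B x) -> forall x, B x -> A x.
Proof.
  intro H. destruct (@classical_sets.Zorn_bigcup X Q) as (A & HA & M).
  - intros F HF tot. red in HF, tot.
    replace (classical_sets.bigcup F (fun x => x))
      with (fun x => exists A, F A /\ A x).
    + apply H; [exact HF|]. intros A B FA FB. destruct (tot A B FA FB) as [K|K]; [left|right]; exact K.
    + apply functional_extensionality. intro x. apply propositional_extensionality.
      split; [intros (B & FB & Bx)|intros [B FB Bx]]; exists B; auto.
  - exists A. split; auto. intros B HB AB x Bx. apply NNPP. intro K.
    apply (M B); auto. split; auto. 
Qed.

(** * Forced set-theoretic formulas *)

Section Reflection.
Context {P : Type} {PP : poset P}.
Implicit Types (e : nat -> name P) (d v : nat) (x y z f g : name P).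

(* Under the d quantifiers interpreted by e, the de Bruijn level v denotes x. *)
Definition lk e d v x := v < d /\ e (d - S v) = x.

Lemma lk_new e d x : lk (scons x e) (S d) d x.
Proof. split; [lia|]. replace (S d - S d) with 0 by lia. reflexivity. Qed.

Lemma lk_old e d v x y : lk e d v x -> lk (scons y e) (S d) v x.
Proof. intros [H1 H2]. split; [lia|]. replace (S d - S v) with (S (d - S v)) by lia. exact H2. Qed.

Lemma rf_mem e d v w x y : lk e d v x -> lk e d w y -> forces ((v ∈ w)%fm d) e = fmem x y.
Proof. intros [_ <-] [_ <-]. reflexivity. Qed.

Lemma rf_eq e d v w x y : lk e d v x -> lk e d w y -> forces ((v ≐ w)%fm d) e = feq x y.
Proof. intros [_ <-] [_ <-]. reflexivity. Qed.

Lemma rf_not e d A B : forces (A d) e = B -> forces (fNot A d) e = onot B.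
Proof. intros <-. reflexivity. Qed.

Lemma rf_imp e d A A' B B' : forces (A d) e = B -> forces (A' d) e = B' ->
  forces (fImp A A' d) e = oimp B B'.
Proof. intros <- <-. reflexivity. Qed.

Lemma rf_and e d A A' B B' : forces (A d) e = B -> forces (A' d) e = B' ->
  forces (fAnd A A' d) e = oand B B'.
Proof. intros <- <-. apply forces_And. Qed.

Lemma rf_or e d A A' B B' : forces (A d) e = B -> forces (A' d) e = B' ->
  forces (fOr A A' d) e = oor B B'.
Proof. intros <- <-. apply forces_Or. Qed.

Lemma rf_iff e d A A' B B' : forces (A d) e = B -> forces (A' d) e = B' ->
  forces (fIff A A' d) e = oiff B B'.
Proof. intros <- <-. apply forces_Iff. Qed.

Lemma rf_all e d (A : nat -> fm) B : (forall x, forces (A d (S d)) (scons x e) = B x) ->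
  forces (fAll A d) e = oall B.
Proof.
  intro H. change (oall (fun x => forces (A d (S d)) (scons x e)) = oall B).
  f_equal. apply functional_extensionality, H.
Qed.

Lemma rf_ex e d (A : nat -> fm) B : (forall x, forces (A d (S d)) (scons x e) = B x) ->
  forces (fEx A d) e = oex B.
Proof.
  intro H. transitivity (oex (fun x => forces (A d (S d)) (scons x e))). apply forces_Ex.
  f_equal. apply functional_extensionality, H.
Qed.

End Reflection.

#[global] Hint Resolve lk_new lk_old : lk.
Create HintDb rfdb discriminated.
#[global] Hint Constants Opaque : rfdb.

Ltac rf_step := first
  [ apply rf_mem; solve [auto 20 with lk]
  | apply rf_eq; solve [auto 20 with lk]
  | apply rf_not | apply rf_imp | apply rf_and | apply rf_or | apply rf_iff
  | (apply rf_all; intro) | (apply rf_ex; intro) ]; cbv beta.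
Ltac rf := intros; repeat (first [rf_step | solve [auto 20 with rfdb lk]]).

Declare Scope oprop_scope.
Delimit Scope oprop_scope with O.
Notation "x ∈ y" := (fmem x y) : oprop_scope.
Notation "x ≐ y" := (feq x y) : oprop_scope.
Notation "¬ A" := (onot A) : oprop_scope.
Notation "A ∧ B" := (oand A B) : oprop_scope.
Notation "A ∨ B" := (oor A B) : oprop_scope.
Notation "A ⇔ B" := (oiff A B) : oprop_scope.
Notation "A ⇒ B" := (oimp A B) : oprop_scope.
Notation "∀ x .. y , A" := (oall (fun x => .. (oall (fun y => A%O)) ..)) : oprop_scope.
Notation "∃ x .. y , A" := (oex (fun x => .. (oex (fun y => A%O)) ..)) : oprop_scope.

Section Translation.
Context {P : Type} {PP : poset P}.
Local Open Scope oprop_scope.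
Implicit Types (x y z f g a b p q r s t w : name P).

Definition o_subset x y := ∀ z : name P, z ∈ x ⇒ z ∈ y.
Definition o_is_empty x := ∀ z : name P, ¬ z ∈ x.
Definition o_is_upair p x y := ∀ z : name P, z ∈ p ⇔ (z ≐ x ∨ z ≐ y).
Definition o_is_opair p x y :=
  ∃ a b : name P, o_is_upair a x x ∧ o_is_upair b x y ∧ o_is_upair p a b.
Definition o_is_succ y x := ∀ z : name P, z ∈ y ⇔ (z ∈ x ∨ z ≐ x).
Definition o_app f x y := ∃ p : name P, o_is_opair p x y ∧ p ∈ f.
Definition o_is_fun f a b :=
  (∀ p : name P, p ∈ f ⇒ ∃ x y : name P, x ∈ a ∧ y ∈ b ∧ o_is_opair p x y) ∧
  (∀ x : name P, x ∈ a ⇒ ∃ y : name P, o_app f x y ∧ ∀ z : name P, o_app f x z ⇒ z ≐ y).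
Definition o_is_inj f a b :=
  o_is_fun f a b ∧ (∀ x x' y : name P, o_app f x y ∧ o_app f x' y ⇒ x ≐ x').
Definition o_is_bij f a b :=
  o_is_inj f a b ∧ (∀ y : name P, y ∈ b ⇒ ∃ x : name P, x ∈ a ∧ o_app f x y).
Definition o_is_prod p a b :=
  ∀ z : name P, z ∈ p ⇔ (∃ x y : name P, x ∈ a ∧ y ∈ b ∧ o_is_opair z x y).
Definition o_is_fun_space x a b := ∀ f : name P, f ∈ x ⇔ o_is_fun f a b.
Definition o_is_restr r f a :=
  ∀ p : name P, p ∈ r ⇔ (p ∈ f ∧ ∃ x y : name P, x ∈ a ∧ o_is_opair p x y).
Definition o_card_le a b := ∃ f : name P, o_is_inj f a b.
Definition o_card_lt a b := o_card_le a b ∧ ¬ o_card_le b a.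

Definition o_is_trans x := ∀ y : name P, y ∈ x ⇒ o_subset y x.
Definition o_is_ord x := o_is_trans x ∧ ∀ y : name P, y ∈ x ⇒ o_is_trans y.
Definition o_ord_le a b := a ∈ b ∨ a ≐ b.
Definition o_is_limit x :=
  o_is_ord x ∧ (∃ y : name P, y ∈ x) ∧ (∀ y : name P, y ∈ x ⇒ ∃ z : name P, z ∈ x ∧ y ∈ z).
Definition o_is_omega w := o_is_limit w ∧ ∀ y : name P, y ∈ w ⇒ ¬ o_is_limit y.
Definition o_is_two t := ∃ z o : name P, o_is_empty z ∧ o_is_succ o z ∧ o_is_succ t o.
Definition o_finite s := ∃ w m : name P, o_is_omega w ∧ m ∈ w ∧ o_card_le s m.
Fixpoint o_is_aleph (k : nat) x : P -> Prop :=
  match k with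
  | 0 => o_is_omega x
  | S j => ∃ y : name P, o_is_aleph j y ∧ o_is_ord x ∧ ¬ o_card_le x y ∧
                ∀ z : name P, z ∈ x ⇒ o_card_le z y
  end.

Definition o_lt_star w f g :=
  ∃ s : name P, o_finite s ∧ ∀ i : name P, i ∈ w ∧ ¬ i ∈ s ⇒
    ∃ a b : name P, o_app f i a ∧ o_app g i b ∧ a ∈ b.
Definition o_prod_lt p q :=
  (∃ a b a' b' : name P, o_is_opair p a b ∧ o_is_opair q a' b' ∧
                o_ord_le a a' ∧ o_ord_le b b') ∧ ¬ p ≐ q.
Definition o_cofinal_in_baire w d :=
  (∀ f : name P, f ∈ d ⇒ o_is_fun f w w) ∧
  (∀ g : name P, o_is_fun g w w ⇒ ∃ f : name P, f ∈ d ∧ o_lt_star w g f).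
Definition o_cofinal_iso (k n : nat) : P -> Prop :=
  ∃ w a b p d h : name P,
    o_is_omega w ∧ o_is_aleph k a ∧ o_is_aleph n b ∧ o_is_prod p a b ∧
    o_cofinal_in_baire w d ∧ o_is_bij h p d ∧
    ∀ x y f g : name P, x ∈ p ∧ y ∈ p ∧ o_app h x f ∧ o_app h y g ⇒
      (o_prod_lt x y ⇔ o_lt_star w f g).
Definition o_continuum_lt : P -> Prop :=
  ∃ w w1 t x y : name P,
    o_is_aleph 0 w ∧ o_is_aleph 1 w1 ∧ o_is_two t ∧
    o_is_fun_space x w t ∧ o_is_fun_space y w1 t ∧ o_card_lt x y.

Definition o_is_club c k :=
  o_subset c k ∧
  (∀ a : name P, a ∈ k ⇒ ∃ x : name P, x ∈ c ∧ a ∈ x) ∧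
  (∀ l : name P, l ∈ k ∧ o_is_limit l ∧
     (∀ a : name P, a ∈ l ⇒ ∃ x : name P, x ∈ c ∧ x ∈ l ∧ a ∈ x) ⇒ l ∈ c).
Definition o_is_stationary t k :=
  o_subset t k ∧ ∀ c : name P, o_is_club c k ⇒ ∃ x : name P, x ∈ c ∧ x ∈ t.
Definition o_cofinal_map_from b a :=
  ∃ f : name P, o_is_fun f b a ∧
    ∀ c : name P, c ∈ a ⇒ ∃ x y : name P, o_app f x y ∧ o_ord_le c y.
Definition o_is_cof b a :=
  o_is_ord b ∧ o_cofinal_map_from b a ∧ ∀ c : name P, c ∈ b ⇒ ¬ o_cofinal_map_from c a.
Definition o_is_bin_tree q k t :=
  ∀ s : name P, s ∈ q ⇔ (∃ a : name P, a ∈ k ∧ o_is_fun s a t).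
Definition o_weak_diamond s k :=
  ∃ t q : name P, o_is_two t ∧ o_is_bin_tree q k t ∧
    ∀ f : name P, o_is_fun f q t ⇒
      ∃ g : name P, o_is_fun g k t ∧
        ∀ b : name P, o_is_fun b k t ⇒
          ∃ u : name P, o_is_stationary u k ∧
            ∀ l : name P, l ∈ u ⇔
              (l ∈ s ∧ ∃ r v : name P, o_is_restr r b l ∧ o_app f r v ∧ o_app g l v).
Definition o_weak_diamond_cof (i : nat) : P -> Prop :=
  ∃ m k s : name P, o_is_aleph i m ∧ o_is_aleph (i + 1) k ∧
    (∀ a : name P, a ∈ s ⇔ (a ∈ k ∧ o_is_cof m a)) ∧ o_weak_diamond s k.

Local Notation LK e d v x := (lk e d v x).

Lemma rf_subset e d v1 v2 x1 x2 : LK e d v1 x1 -> LK e d v2 x2 ->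
  forces (subset v1 v2 d) e = o_subset x1 x2.
Proof. rf. Qed.
Lemma rf_is_empty e d v1 x1 : LK e d v1 x1 -> forces (is_empty v1 d) e = o_is_empty x1.
Proof. rf. Qed.
Lemma rf_is_upair e d v1 v2 v3 x1 x2 x3 : LK e d v1 x1 -> LK e d v2 x2 -> LK e d v3 x3 ->
  forces (is_upair v1 v2 v3 d) e = o_is_upair x1 x2 x3.
Proof. rf. Qed.
#[local] Hint Resolve rf_subset rf_is_empty rf_is_upair : rfdb.
Lemma rf_is_opair e d v1 v2 v3 x1 x2 x3 : LK e d v1 x1 -> LK e d v2 x2 -> LK e d v3 x3 ->
  forces (is_opair v1 v2 v3 d) e = o_is_opair x1 x2 x3.
Proof. rf. Qed.
Lemma rf_is_succ e d v1 v2 x1 x2 : LK e d v1 x1 -> LK e d v2 x2 ->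
  forces (is_succ v1 v2 d) e = o_is_succ x1 x2.
Proof. rf. Qed.
#[local] Hint Resolve rf_is_opair rf_is_succ : rfdb.
Lemma rf_app e d v1 v2 v3 x1 x2 x3 : LK e d v1 x1 -> LK e d v2 x2 -> LK e d v3 x3 ->
  forces (app v1 v2 v3 d) e = o_app x1 x2 x3.
Proof. rf. Qed.
#[local] Hint Resolve rf_app : rfdb.
Lemma rf_is_fun e d v1 v2 v3 x1 x2 x3 : LK e d v1 x1 -> LK e d v2 x2 -> LK e d v3 x3 ->
  forces (is_fun v1 v2 v3 d) e = o_is_fun x1 x2 x3.
Proof. rf. Qed.
#[local] Hint Resolve rf_is_fun : rfdb.
Lemma rf_is_inj e d v1 v2 v3 x1 x2 x3 : LK e d v1 x1 -> LK e d v2 x2 -> LK e d v3 x3 ->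
  forces (is_inj v1 v2 v3 d) e = o_is_inj x1 x2 x3.
Proof. rf. Qed.
#[local] Hint Resolve rf_is_inj : rfdb.
Lemma rf_is_bij e d v1 v2 v3 x1 x2 x3 : LK e d v1 x1 -> LK e d v2 x2 -> LK e d v3 x3 ->
  forces (is_bij v1 v2 v3 d) e = o_is_bij x1 x2 x3.
Proof. rf. Qed.
Lemma rf_is_prod e d v1 v2 v3 x1 x2 x3 : LK e d v1 x1 -> LK e d v2 x2 -> LK e d v3 x3 ->
  forces (is_prod v1 v2 v3 d) e = o_is_prod x1 x2 x3.
Proof. rf. Qed.
Lemma rf_is_fun_space e d v1 v2 v3 x1 x2 x3 : LK e d v1 x1 -> LK e d v2 x2 -> LK e d v3 x3 ->
  forces (is_fun_space v1 v2 v3 d) e = o_is_fun_space x1 x2 x3.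
Proof. rf. Qed.
Lemma rf_is_restr e d v1 v2 v3 x1 x2 x3 : LK e d v1 x1 -> LK e d v2 x2 -> LK e d v3 x3 ->
  forces (is_restr v1 v2 v3 d) e = o_is_restr x1 x2 x3.
Proof. rf. Qed.
Lemma rf_card_le e d v1 v2 x1 x2 : LK e d v1 x1 -> LK e d v2 x2 ->
  forces (card_le v1 v2 d) e = o_card_le x1 x2.
Proof. rf. Qed.
#[local] Hint Resolve rf_is_bij rf_is_prod rf_is_fun_space rf_is_restr rf_card_le : rfdb.
Lemma rf_card_lt e d v1 v2 x1 x2 : LK e d v1 x1 -> LK e d v2 x2 ->
  forces (card_lt v1 v2 d) e = o_card_lt x1 x2.
Proof. rf. Qed.
Lemma rf_is_trans e d v1 x1 : LK e d v1 x1 -> forces (is_trans v1 d) e = o_is_trans x1.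
Proof. rf. Qed.
#[local] Hint Resolve rf_is_trans rf_card_lt : rfdb.
Lemma rf_is_ord e d v1 x1 : LK e d v1 x1 -> forces (is_ord v1 d) e = o_is_ord x1.
Proof. rf. Qed.
Lemma rf_ord_le e d v1 v2 x1 x2 : LK e d v1 x1 -> LK e d v2 x2 ->
  forces (ord_le v1 v2 d) e = o_ord_le x1 x2.
Proof. rf. Qed.
#[local] Hint Resolve rf_is_ord rf_ord_le : rfdb.
Lemma rf_is_limit e d v1 x1 : LK e d v1 x1 -> forces (is_limit v1 d) e = o_is_limit x1.
Proof. rf. Qed.
#[local] Hint Resolve rf_is_limit : rfdb.
Lemma rf_is_omega e d v1 x1 : LK e d v1 x1 -> forces (is_omega v1 d) e = o_is_omega x1.
Proof. rf. Qed.
Lemma rf_is_two e d v1 x1 : LK e d v1 x1 -> forces (is_two v1 d) e = o_is_two x1.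
Proof. rf. Qed.
#[local] Hint Resolve rf_is_omega rf_is_two : rfdb.
Lemma rf_finite e d v1 x1 : LK e d v1 x1 -> forces (finite v1 d) e = o_finite x1.
Proof. rf. Qed.
Lemma rf_is_aleph k : forall e d v1 x1,
  LK e d v1 x1 -> forces (is_aleph k v1 d) e = o_is_aleph k x1.
Proof.
  induction k as [|k IH]; intros; cbn [is_aleph o_is_aleph]; [rf|].
  apply rf_ex. intro. apply rf_and. apply IH, lk_new. rf.
Qed.
#[local] Hint Resolve rf_finite rf_is_aleph : rfdb.
Lemma rf_lt_star e d v1 v2 v3 x1 x2 x3 : LK e d v1 x1 -> LK e d v2 x2 -> LK e d v3 x3 ->
  forces (lt_star v1 v2 v3 d) e = o_lt_star x1 x2 x3.
Proof. rf. Qed.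
Lemma rf_prod_lt e d v1 v2 x1 x2 : LK e d v1 x1 -> LK e d v2 x2 ->
  forces (prod_lt v1 v2 d) e = o_prod_lt x1 x2.
Proof. rf. Qed.
#[local] Hint Resolve rf_lt_star rf_prod_lt : rfdb.
Lemma rf_cofinal_in_baire e d v1 v2 x1 x2 : LK e d v1 x1 -> LK e d v2 x2 ->
  forces (cofinal_in_baire v1 v2 d) e = o_cofinal_in_baire x1 x2.
Proof. rf. Qed.
#[local] Hint Resolve rf_cofinal_in_baire : rfdb.
Lemma rf_cofinal_iso k n e d : forces (cofinal_iso k n d) e = o_cofinal_iso k n.
Proof. rf. Qed.
Lemma rf_continuum_lt e d : forces (continuum_lt d) e = o_continuum_lt.
Proof.  unfold continuum_lt, o_continuum_lt; rf. Qed.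
Lemma rf_is_club e d v1 v2 x1 x2 : LK e d v1 x1 -> LK e d v2 x2 ->
  forces (is_club v1 v2 d) e = o_is_club x1 x2.
Proof. rf. Qed.
#[local] Hint Resolve rf_is_club : rfdb.
Lemma rf_is_stationary e d v1 v2 x1 x2 : LK e d v1 x1 -> LK e d v2 x2 ->
  forces (is_stationary v1 v2 d) e = o_is_stationary x1 x2.
Proof. rf. Qed.
Lemma rf_cofinal_map_from e d v1 v2 x1 x2 : LK e d v1 x1 -> LK e d v2 x2 ->
  forces (cofinal_map_from v1 v2 d) e = o_cofinal_map_from x1 x2.
Proof. rf. Qed.
#[local] Hint Resolve rf_is_stationary rf_cofinal_map_from : rfdb.
Lemma rf_is_cof e d v1 v2 x1 x2 : LK e d v1 x1 -> LK e d v2 x2 ->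
  forces (is_cof v1 v2 d) e = o_is_cof x1 x2.
Proof. rf. Qed.
Lemma rf_is_bin_tree e d v1 v2 v3 x1 x2 x3 : LK e d v1 x1 -> LK e d v2 x2 -> LK e d v3 x3 ->
  forces (is_bin_tree v1 v2 v3 d) e = o_is_bin_tree x1 x2 x3.
Proof. rf. Qed.
#[local] Hint Resolve rf_is_cof rf_is_bin_tree : rfdb.
Lemma rf_weak_diamond e d v1 v2 x1 x2 : LK e d v1 x1 -> LK e d v2 x2 ->
  forces (weak_diamond v1 v2 d) e = o_weak_diamond x1 x2.
Proof. rf. Qed.
#[local] Hint Resolve rf_weak_diamond : rfdb.
Lemma rf_weak_diamond_cof i e d : forces (weak_diamond_cof i d) e = o_weak_diamond_cof i.
Proof. rf. Qed.

End Translation.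

(* Forced formulas are stable and respect equality of names; so do their translations. *)
Section Congruence.
Context {P : Type} {PP : poset P}.
Implicit Types (w x y z : name P) (p : P).

Lemma rf_cong3 (A : nat -> nat -> nat -> fm) (F : name P -> name P -> name P -> P -> Prop) :
  (forall e d v1 v2 v3 x1 x2 x3, lk e d v1 x1 -> lk e d v2 x2 -> lk e d v3 x3 ->
     forces (A v1 v2 v3 d) e = F x1 x2 x3) ->
  forall x y z x' y' z' p, feq x x' p -> feq y y' p -> feq z z' p -> F x y z p -> F x' y' z' p.
Proof.
  intros H x y z x' y' z' p E1 E2 E3.
  pose (e (x y z : name P) := scons x (scons y (scons z (fun _ => x)))).
  rewrite <- (H (e x y z) 3 2 1 0 x y z), <- (H (e x' y' z') 3 2 1 0 x' y' z');
    try (split; [lia|reflexivity]).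
  apply forces_cong. intros [|[|[|i]]]; simpl; auto.
Qed.

Lemma rf_cong2 (A : nat -> nat -> fm) (F : name P -> name P -> P -> Prop) :
  (forall e d v1 v2 x1 x2, lk e d v1 x1 -> lk e d v2 x2 -> forces (A v1 v2 d) e = F x1 x2) ->
  forall x y x' y' p, feq x x' p -> feq y y' p -> F x y p -> F x' y' p.
Proof.
  intros H x y x' y' p E1 E2.
  exact (@rf_cong3 (fun v1 v2 _ => A v1 v2) (fun x y _ => F x y)
    (fun e d v1 v2 v3 x1 x2 x3 H1 H2 _ => H e d v1 v2 x1 x2 H1 H2) x y x x' y' x p E1 E2 (feq_refl x p)).
Qed.

Lemma rf_stable3 (A : nat -> nat -> nat -> fm) (F : name P -> name P -> name P -> P -> Prop) :
  (forall e d v1 v2 v3 x1 x2 x3, lk e d v1 x1 -> lk e d v2 x2 -> lk e d v3 x3 ->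
     forces (A v1 v2 v3 d) e = F x1 x2 x3) ->
  forall x y z, stable (F x y z).
Proof.
  intros H x y z.
  rewrite <- (H (scons x (scons y (scons z (fun _ => x)))) 3 2 1 0 x y z);
    try (split; [lia|reflexivity]).
  apply forces_stable.
Qed.

Lemma rf_stable2 (A : nat -> nat -> fm) (F : name P -> name P -> P -> Prop) :
  (forall e d v1 v2 x1 x2, lk e d v1 x1 -> lk e d v2 x2 -> forces (A v1 v2 d) e = F x1 x2) ->
  forall x y, stable (F x y).
Proof.
  intros H x y. exact (@rf_stable3 (fun v1 v2 _ => A v1 v2) (fun x y _ => F x y)
    (fun e d v1 v2 v3 x1 x2 x3 H1 H2 _ => H e d v1 v2 x1 x2 H1 H2) x y x).
Qed.

Lemma o_is_fun_cong x x' y y' z z' p : feq x x' p -> feq y y' p -> feq z z' p ->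
  o_is_fun x y z p -> o_is_fun x' y' z' p.
Proof. apply (rf_cong3 is_fun o_is_fun), rf_is_fun. Qed.

Lemma o_is_fun_stable x y z : stable (o_is_fun x y z).
Proof. apply (rf_stable3 is_fun o_is_fun), rf_is_fun. Qed.

Lemma o_card_le_cong x x' y y' p : feq x x' p -> feq y y' p -> o_card_le x y p -> o_card_le x' y' p.
Proof. apply (rf_cong2 card_le o_card_le), rf_card_le. Qed.

Lemma o_is_limit_cong x x' p : feq x x' p -> o_is_limit x p -> o_is_limit x' p.
Proof.
  intro E. refine (@rf_cong2 (fun v _ => is_limit v) (fun x _ => o_is_limit x) _ x x x' x' p E E).
  intros. apply rf_is_limit; auto.
Qed.

Lemma o_ord_le_cong x x' y y' p : feq x x' p -> feq y y' p -> o_ord_le x y p -> o_ord_le x' y' p.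
Proof. apply (rf_cong2 ord_le o_ord_le), rf_ord_le. Qed.

Lemma o_prod_lt_cong x x' y y' p : feq x x' p -> feq y y' p -> o_prod_lt x y p -> o_prod_lt x' y' p.
Proof. apply (rf_cong2 prod_lt o_prod_lt), rf_prod_lt. Qed.

Lemma o_prod_lt_stable x y : stable (o_prod_lt x y).
Proof. apply (rf_stable2 prod_lt o_prod_lt), rf_prod_lt. Qed.

Lemma o_lt_star_cong w x x' y y' p : feq x x' p -> feq y y' p -> o_lt_star w x y p -> o_lt_star w x' y' p.
Proof.
  intros E1 E2. apply (rf_cong3 lt_star o_lt_star); auto using feq_refl. apply rf_lt_star.
Qed.

Lemma o_is_cof_cong x x' y y' p : feq x x' p -> feq y y' p -> o_is_cof x y p -> o_is_cof x' y' p.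
Proof. apply (rf_cong2 is_cof o_is_cof), rf_is_cof. Qed.

Lemma o_is_cof_stable x y : stable (o_is_cof x y).
Proof. apply (rf_stable2 is_cof o_is_cof), rf_is_cof. Qed.

Lemma o_is_restr_cong x x' y y' z z' p : feq x x' p -> feq y y' p -> feq z z' p ->
  o_is_restr x y z p -> o_is_restr x' y' z' p.
Proof. apply (rf_cong3 is_restr o_is_restr), rf_is_restr. Qed.

Lemma o_is_restr_stable x y z : stable (o_is_restr x y z).
Proof. apply (rf_stable3 is_restr o_is_restr), rf_is_restr. Qed.

Lemma o_is_club_stable x y : stable (o_is_club x y).
Proof. apply (rf_stable2 is_club o_is_club), rf_is_club. Qed.

Lemma o_cofinal_map_from_cong x x' y y' p : feq x x' p -> feq y y' p ->
  o_cofinal_map_from x y p -> o_cofinal_map_from x' y' p.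
Proof. apply (rf_cong2 cofinal_map_from o_cofinal_map_from), rf_cofinal_map_from. Qed.
End Congruence.
Arguments o_ord_le_cong {P PP x x' y y' p} _ _ _.
Arguments o_prod_lt_cong {P PP x x' y y' p} _ _ _.
Arguments o_lt_star_cong {P PP w x x' y y' p} _ _ _.
Arguments o_is_cof_cong {P PP x x' y y' p} _ _ _.
Arguments o_is_restr_cong {P PP x x' y y' z z' p} _ _ _ _.
Arguments o_cofinal_map_from_cong {P PP x x' y y' p} _ _ _.

Lemma mono_oall {P} {PP : poset P} {X} (A : X -> P -> Prop) : (forall x, mono (A x)) -> mono (oall A).
Proof. intros H p q Hq K x. exact (H x p q Hq (K x)). Qed.

Lemma mono_oand {P} {PP : poset P} (A B : P -> Prop) : mono A -> mono B -> mono (oand A B).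
Proof. intros H1 H2 p q Hq []. split; eauto. Qed.

Lemma mono_oex {P} {PP : poset P} {X} (A : X -> P -> Prop) : mono (oex A).
Proof. apply dn_mono. Qed.

Lemma mono_oor {P} {PP : poset P} (A B : P -> Prop) : mono (oor A B).
Proof. apply dn_mono. Qed.

Lemma mono_oiff {P} {PP : poset P} (A B : P -> Prop) : mono (oiff A B).
Proof. apply mono_oand; apply mono_oimp. Qed.

Lemma mono_obot {P} {PP : poset P} : mono (@obot P).
Proof. intros p q _ []. Qed.

Create HintDb stab.
#[global] Hint Resolve feq_stable fmem_stable dn_stable oex_stable oor_stable
  stable_obot stable_oall stable_oimp stable_oand stable_onot forces_stable
  mono_oall mono_oand mono_oex mono_oor mono_oiff mono_obot mono_oimp mono_onot
  dn_mono dcl_mono o_is_fun_stable o_is_cof_stable o_is_restr_stable o_is_club_stable : stab.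
#[global] Hint Extern 5 (mono _) => apply stable_mono : stab.
#[global] Hint Extern 1 (mono (fun _ => _)) => red : stab.

Ltac stab := auto 30 with stab.

(* Transport every hypothesis at [p] to the stronger condition of [Hq : q ≼ p]. *)
Ltac lift Hq :=
  match type of Hq with
  | ?q ≼ ?p =>
    repeat match goal with
      | H : ?A p |- _ =>
        let H' := fresh in
        assert (H' : A q) by
          (refine ((_ : mono A) p q Hq H); solve [stab]);
        clear H; rename H' into H
      end
  end.

Ltac le := solve [ assumption | apply ple_refl
  | match goal with H : ?q ≼ ?r |- ?q ≼ ?p => apply (ple_trans q r p H); clear H; le end ].

(* Use a density assumption [H : dn A p] to prove a stable goal at [p]. *)
Ltac below H q Hq K :=
  refine (dn_elim _ H _); [solve [stab]|]; clear H; intros q Hq K; lift Hq.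

Lemma oex_intro {P} {PP : poset P} {X} (A : X -> P -> Prop) x p :
  mono (A x) -> A x p -> oex A p.
Proof. intros M H q Hq. exists q. split; auto. exists x. eapply M; eauto. Qed.

Lemma oor_l {P} {PP : poset P} (A B : P -> Prop) p : mono A -> A p -> oor A B p.
Proof. intros M H q Hq. exists q. split; auto. left. eapply M; eauto. Qed.

Lemma oor_r {P} {PP : poset P} (A B : P -> Prop) p : mono B -> B p -> oor A B p.
Proof. intros M H q Hq. exists q. split; auto. right. eapply M; eauto. Qed.

(** * Comprehension, pairs, successors and foundation for names *)

Section Names.
Context {P : Type} {PP : poset P}.
Implicit Types (x y z : name P) (p q r : P).

Definition ocong (A : name P -> P -> Prop) := forall x y p, feq x y p -> A x p -> A y p.

Definition idx x : Type := match x with @sup _ A _ _ => A end.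
Definition el x : idx x -> name P := match x with @sup _ _ f _ => f end.
Definition vl x : idx x -> P -> Prop := match x with @sup _ _ _ v => v end.

Lemma fmem_el x y p : fmem x y p -> dn (fun q => exists i, dcl (vl y i) q /\ feq x (el y i) q) p.
Proof. destruct y. auto. Qed.

Lemma fmem_el_intro x i p : dcl (vl x i) p -> fmem (el x i) x p.
Proof. destruct x. apply fmem_intro. Qed.

(* Comprehension over a small family of candidates: names are too many to index a name. *)
Definition comp {I : Type} (c : I -> name P) (A : name P -> P -> Prop) : name P :=
  sup c (fun i => A (c i)).

Lemma fmem_comp (I : Type) (c : I -> name P) A :
  (forall z, stable (A z)) -> ocong A ->
  (forall z p, A z p -> dn (fun q => exists i, feq z (c i) q) p) ->
  forall z p, fmem z (comp c A) p <-> A z p.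
Proof.
  intros HA CA Hc z p. split; intro H.
  - apply HA. eapply dn_map; [exact H|]. intros q Hq (i & Hi & E).
    eapply CA. apply feq_sym, E. eapply dcl_of_mono; [|exact Hi]. stab.
  - assert (L := Hc z p H). assert (MA := fun z => proj1 (HA z)).
    below L q Hq L. destruct L as (i & E).
    eapply (fmem_cong_l (c i)). apply feq_sym, E. apply fmem_intro.
    apply dcl_intro. eapply CA; eauto.
Qed.

Lemma ocong_forces phi e : ocong (fun x => forces phi (scons x e)).
Proof.
  intros x x' p E H. eapply forces_cong; [|exact H]. intros [|i]; simpl; auto using feq_refl.
Qed.

Definition upair x y : name P := sup (fun b : bool => if b then x else y) (fun _ _ => True).

Lemma fmem_upair x y z p : fmem z (upair x y) p <-> oor (feq z x) (feq z y) p.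
Proof.
  split; intro H.
  - eapply dn_map. exact H. intros q Hq ([] & _ & E); auto.
  - eapply dn_map. exact H. intros q Hq [E|E]; [exists true|exists false]; split; auto;
      exists q; auto.
Qed.

Definition nempty : name P := sup (fun i : Empty_set => match i with end) (fun _ _ => True).

Lemma fmem_nempty z p : ~ fmem z nempty p.
Proof. intro H. destruct (H p (ple_refl p)) as (_ & _ & [] & _). Qed.

Definition nsucc x : name P :=
  sup (fun o : option (idx x) => match o with None => x | Some i => el x i end)
      (fun o => match o with None => fun _ => True | Some i => vl x i end).

Lemma fmem_nsucc x z p : fmem z (nsucc x) p <-> oor (fmem z x) (feq z x) p.
Proof.
  split; intro H.
  - eapply dn_map. exact H. intros q Hq ([i|] & Hi & E); auto.
    left. eapply fmem_cong_l. apply feq_sym, E. apply fmem_el_intro, Hi.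
  - unfold nsucc. eapply dn_bind. exact H. intros q Hq [E|E].
    + apply fmem_el in E. eapply dn_map. exact E. intros r Hr (i & Hi & E').
      exists (Some i). auto.
    + intros r Hr. exists r. split; auto. exists None. split.
      exists r. auto. eapply feq_mono; eauto.
Qed.

(** If no extension of [q0] has a minimal element of [y], induction on the name [z] shows that
    nothing below [q0] puts [z] into [y]: its elements are excluded already, so [z] would be
    minimal. This contradicts [z0]. *)
Lemma fmem_wf : forall y p, (exists z, fmem z y p) ->
  oex (fun z => oand (fmem z y) (oall (fun w => oimp (fmem w z) (onot (fmem w y))))) p.
Proof.
  intros y p [z0 Hz0] q0 Hq0. apply NNPP. intro K.
  assert (M : forall z r, r ≼ q0 -> ~ fmem z y r).
  { induction z as [A f IH v]. intros r Hr Hz. apply K. exists r. split; auto.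
    exists (sup f v). split; auto. intros w s Hs Hw t Ht Hwy.
    destruct (Hw t Ht) as (u & Hu & a & Ha & E).
    apply (IH a u).
    - eapply ple_trans; eauto. eapply ple_trans; eauto. eapply ple_trans; eauto.
    - eapply fmem_cong_l; eauto. eapply fmem_mono; eauto. }
  apply (M z0 q0); auto. eapply fmem_mono; eauto.
Qed.

Lemma fmem_irrefl x p : ~ fmem x x p.
Proof.
  revert p. induction x as [A f IH v]. intros p H.
  destruct (H p (ple_refl p)) as (q & Hq & a & Ha & E).
  apply (IH a q). eapply fmem_cong_r. exact E.
  apply fmem_intro. auto.
Qed.

End Names.

(** * The axioms of ZFC *)

Section ZFC_forced.
Context {P : Type} {PP : poset P}.
Implicit Types (x y z : name P) (p q r : P).
Local Open Scope oprop_scope.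

Lemma forced_pairing p : (∀ x y : name P, ∃ u : name P, o_is_upair u x y) p.
Proof.
  intros x y. apply oex_intro with (upair x y). unfold o_is_upair; stab.
  intro z. split; intros q Hq H; apply fmem_upair; auto.
Qed.

Lemma forced_union p :
  (∀ x : name P, ∃ u : name P, ∀ z : name P, z ∈ u ⇔ ∃ y : name P, y ∈ x ∧ z ∈ y) p.
Proof.
  intro x.
  pose (c := fun i : {i : idx x & idx (el x i)} => el (el x (projT1 i)) (projT2 i)).
  pose (A := fun z => ∃ y : name P, y ∈ x ∧ z ∈ y).
  assert (M : forall z p, fmem z (comp c A) p <-> A z p).
  { apply fmem_comp.
    - unfold A. stab.
    - intros z z' q E H. eapply dn_map. exact H. intros r Hr (y & H1 & H2).
      exists y. split; auto. eapply fmem_cong_l; eauto. eapply feq_mono; eauto.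
    - intros z q H. eapply dn_bind. exact H. intros r Hr (y & H1 & H2).
      apply fmem_el in H1. eapply dn_bind. exact H1. intros s Hs (i & _ & E).
      assert (K : fmem z (el x i) s). eapply fmem_cong_r; eauto. eapply fmem_mono; eauto.
      apply fmem_el in K. eapply dn_map. exact K. intros t Ht (j & _ & E').
      exists (existT _ i j). exact E'. }
  apply oex_intro with (comp c A). stab.
  intro z. split; intros q Hq H; apply M; auto.
Qed.

(** The candidates reuse the elements of [x] with every possible assignment of condition sets; a
    subset [z] equals the candidate whose [i]-th condition set is that of the conditions forcing
    [el x i] into [z]. *)
Lemma forced_power p :
  (∀ x : name P, ∃ u : name P, ∀ z : name P, z ∈ u ⇔ o_subset z x) p.
Proof.
  intro x.
  pose (c := fun v : idx x -> P -> Prop => sup (el x) v).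
  pose (A := fun z => o_subset z x).
  assert (M : forall z p, fmem z (comp c A) p <-> A z p).
  { apply fmem_comp.
    - unfold A, o_subset. stab.
    - intros z z' q E H w r Hr K. apply H; auto. eapply fmem_cong_r; eauto.
      apply feq_sym. eapply feq_mono; eauto.
    - intros z q H r Hr. exists r. split; auto. exists (fun i => fmem (el x i) z).
      apply feq_ext. intros w s Hs. split; intro K.
      + assert (L : fmem w x s). { apply H; auto. eapply ple_trans; eauto. }
        apply fmem_el in L. below L t Ht L. destruct L as (i & _ & E).
        eapply fmem_cong_l. apply feq_sym, E. apply fmem_intro. apply dcl_intro.
        eapply fmem_cong_l; eauto.
      + below K t Ht K. destruct K as (i & Hi & E).
        eapply fmem_cong_l. apply feq_sym, E. eapply dcl_of_mono; eauto. stab. }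
  apply oex_intro with (comp c A). unfold o_subset; stab.
  intro z. split; intros q Hq H; apply M; auto.
Qed.

Lemma forced_infinity p :
  (∃ w : name P, (∃ e : name P, e ∈ w ∧ o_is_empty e) ∧
     (∀ x : name P, x ∈ w ⇒ ∃ y : name P, y ∈ w ∧ o_is_succ y x)) p.
Proof.
  pose (nn := fun k => Nat.iter k (@nsucc P) nempty).
  apply oex_intro with (sup nn (fun _ _ => True)). unfold o_is_empty, o_is_succ; stab. split.
  - apply oex_intro with nempty. unfold o_is_empty; stab. split.
    + apply (fmem_intro nn (fun _ _ => True) 0). exists p. auto.
    + intros z q Hq K. destruct (fmem_nempty K).
  - intros x q Hq H. below H r Hr H. destruct H as (k & _ & E).
    apply oex_intro with (nsucc x). unfold o_is_succ; stab. split.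
    + apply fmem_cong_l with (nn (S k)).
      * apply feq_ext. intros z s Hs. unfold nn. simpl Nat.iter. rewrite !fmem_nsucc. fold (nn k).
        split; intro K; eapply dn_map; try exact K; intros t Ht [L|L];
          assert (E' : feq x (nn k) t) by (eapply feq_mono; [|exact E]; eapply ple_trans; eauto);
          [left; eapply fmem_cong_r|right; eapply feq_trans|left; eapply fmem_cong_r|right; eapply feq_trans];
          eauto; apply feq_sym; auto.
      * apply (fmem_intro nn (fun _ _ => True) (S k)). exists r. auto.
    + intro z. split; intros s Hs K; apply fmem_nsucc; auto.
Qed.

(** The transversal takes from each [y] its least member among the well-ordered candidates [c].
    Which candidate is least depends on the condition, so one takes the least index that some
    extension puts into [y] and moves to that extension, below which no smaller index can enter. *)
Lemma forced_choice p :
  (∀ x : name P, (∀ y : name P, y ∈ x ⇒ ∃ u : name P, u ∈ y) ∧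
      (∀ y z u : name P, y ∈ x ∧ z ∈ x ∧ u ∈ y ∧ u ∈ z ⇒ y ≐ z) ⇒
    ∃ c : name P, ∀ y : name P, y ∈ x ⇒ ∃ z : name P, ∀ u : name P, (u ∈ c ∧ u ∈ y) ⇔ u ≐ z) p.
Proof.
  intros x q Hq [H1 H2].
  pose (I := {i : idx x & idx (el x i)}).
  pose (c := fun i : I => el (el x (projT1 i)) (projT2 i)).
  destruct (well_ordering I) as [lt W].
  pose (least := fun (i : I) (y : name P) =>
    y ∈ x ∧ c i ∈ y ∧ oall (fun j => oall (fun _ : lt j i => ¬ c j ∈ y))).
  assert (Ls : forall i y, stable (least i y)).
  { intros. unfold least. stab. }
  assert (Lm : forall i y, mono (least i y)) by (intros; apply Ls).
  pose (v := fun i : I => oex (least i)).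
  apply oex_intro with (sup c v). stab.
  intros y r Hr Hy. lift Hr.
  assert (Hn := H1 y r (ple_refl r) Hy). below Hn s Hs Hn. destruct Hn as (u & Hu).
  assert (E : dn (fun t => exists i, fmem (c i) y t) s).
  { eapply dn_bind. apply fmem_el, Hy. intros t Ht (i & _ & E).
    lift Ht. assert (K : fmem u (el x i) t) by (eapply fmem_cong_r; eauto).
    apply fmem_el in K. eapply dn_map. exact K. intros t' Ht' (j & _ & E').
    exists (existT _ i j). unfold c. simpl. lift Ht'. eapply fmem_cong_l; eauto. }
  refine (dn_elim _ (A := fun t => exists i, least i y t) _ _); [stab| |].
  { intros t Ht. destruct (E t Ht) as (t1 & Ht1 & Ei).
    destruct (@wo_least I lt W (fun i => exists t2, t2 ≼ t1 /\ fmem (c i) y t2)) as (i & (t2 & Ht2 & Hi) & Hmin).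
    { destruct Ei as [i Ei]. exists i, t1. auto. }
    exists t2. split. eapply ple_trans; eauto. exists i.
    repeat split; auto.
    - eapply fmem_mono; [|exact Hy]. eapply ple_trans; eauto. eapply ple_trans; eauto.
    - intros j Hj t3 Ht3 K. apply (Hmin j Hj). exists t3. split; auto. eapply ple_trans; eauto. }
  intros t Ht [i Hi]. lift Ht. clear E Hu u. apply oex_intro with (c i). stab.
  intro u. split; intros t1 Ht1 K; lift Ht1.
  - destruct K as [K1 K2]. below K1 t2 Ht2 K1. destruct K1 as (j & Hj & E).
    assert (Hj' : v j t2). { eapply dcl_of_mono; [|exact Hj]. unfold v. stab. }
    clear Hj. below Hj' t3 Ht3 Hj. destruct Hj as (y' & Hy1 & Hy2 & Hy3).
    destruct Hi as (Hz1 & Hz2 & Hz3).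
    assert (Eq : feq y y' t3).
    { apply (H2 y y' u); auto. repeat split; auto.
      eapply fmem_cong_l. apply feq_sym, E. auto. }
    destruct (wo_total W i j) as [L|[<-|L]]; auto.
    + destruct (Hy3 i L t3 (ple_refl t3)). eapply fmem_cong_r; eauto.
    + destruct (Hz3 j L t3 (ple_refl t3)). eapply fmem_cong_r. apply feq_sym, Eq. auto.
  - split.
    + eapply fmem_cong_l. apply feq_sym, K. apply fmem_intro. apply dcl_intro.
      apply oex_intro with y; auto.
    + eapply fmem_cong_l. apply feq_sym, K. apply Hi.
Qed.

Lemma forced_separation phi e p :
  forces (All (Ex (All (Iff (Mem 0 1) (And (Mem 0 2) (ren (up S) phi)))))) e p.
Proof.
  intro x. rewrite forces_Ex.
  pose (A := fun z => z ∈ x ∧ forces phi (scons z (scons x e))).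
  assert (M : forall z p, fmem z (comp (el x) A) p <-> A z p).
  { apply fmem_comp.
    - unfold A. stab.
    - intros z z' q E [K1 K2]. split. eapply fmem_cong_l; eauto. eapply ocong_forces; eauto.
    - intros z q [K1 K2]. apply fmem_el in K1. eapply dn_map. exact K1.
      intros r Hr (i & _ & E). eauto. }
  apply oex_intro with (comp (el x) A). stab. intro z.
  rewrite forces_Iff, forces_And, forces_ren.
  match goal with |- context [forces phi ?f] => replace f with (scons z (scons x e)) end.
  split; intros q Hq H; apply M; auto.
  apply functional_extensionality. intros [|[|i]]; reflexivity.
Qed.

(** The possible values are too many to index a name, so the index type is [idx x * P]: one chosen
    value for each element and each condition that forces one. If [u] forces [z] to be the value at
    the [i]-th element, functionality makes [z] equal at [u] to the value chosen for [(i, u)]. *)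
Lemma forced_replacement phi e p :
  forces (Imp
      (All (All (All (Imp
         (And (ren (fun i => match i with 0 => 1 | 1 => 2 | S (S j) => S (S (S j)) end) phi)
              (ren (fun i => match i with 0 => 0 | 1 => 2 | S (S j) => S (S (S j)) end) phi))
         (Eq 1 0)))))
      (All (Ex (All (Iff (Mem 0 1)
         (Ex (And (Mem 0 3)
           (ren (fun i => match i with
                          | 0 => 1 | 1 => 0 | S (S j) => S (S (S (S j)))
                          end) phi)))))))) e p.
Proof.
  pose (F := fun x y => forces phi (scons y (scons x e))).
  assert (CF : forall x x' y y' p, feq x x' p -> feq y y' p -> F x y p -> F x' y' p).
  { intros x x' y y' q E1 E2. apply forces_cong.
    intros [|[|i]]; simpl; auto using feq_refl. }
  intros q Hq H. 
  assert (fn : forall x y z r, r ≼ q -> F x y r -> F x z r -> feq y z r).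
  { intros x y z r Hr K1 K2. apply (H x y z r Hr).
    change (forces (And (ren (fun i => match i with 0 => 1 | 1 => 2 | S (S j) => S (S (S j)) end) phi)
              (ren (fun i => match i with 0 => 0 | 1 => 2 | S (S j) => S (S (S j)) end) phi))
       (scons z (scons y (scons x e))) r).
    rewrite forces_And, !forces_ren.
    split; [refine (eq_ind _ (fun f => forces phi f r) K1 _ _)
           |refine (eq_ind _ (fun f => forces phi f r) K2 _ _)];
      apply functional_extensionality; intros [|[|i]]; reflexivity. }
  clear H. intro x. rewrite forces_Ex.
  pose (A := fun y => ∃ z : name P, z ∈ x ∧ F z y).
  assert (Ch : forall ir : idx x * P, exists y, (exists y', F (el x (fst ir)) y' (snd ir)) -> F (el x (fst ir)) y (snd ir)).
  { intro ir. destruct (classic (exists y', F (el x (fst ir)) y' (snd ir))) as [[y' K]|K].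
    exists y'. auto. exists nempty. intro. contradiction. }
  pose (c := fun ir => proj1_sig (constructive_indefinite_description _ (Ch ir))).
  assert (Hc : forall i r y, F (el x i) y r -> F (el x i) (c (i, r)) r).
  { intros i r y K. unfold c. destruct (constructive_indefinite_description _ (Ch (i, r))) as [y' K'].
    simpl in *. eauto. }
  pose (B := fun ir : idx x * P => fun s => s ≼ snd ir /\ s ≼ q /\ A (c ir) s).
  assert (M : forall z s, s ≼ q -> fmem z (sup c B) s <-> A z s).
  { intros z s Hs. split; intro H.
    - unfold A. below H t Ht H. destruct H as (ir & (t' & Ht' & _ & _ & H1) & E).
      assert (H2 : A (c ir) t) by (unfold A in *; eapply mono_oex; eauto). clear H1.
      unfold A in H2. below H2 u Hu H2. destruct H2 as (w & K1 & K2).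
      apply oex_intro with w. unfold F; stab. split; auto. eapply CF; [apply feq_refl|apply feq_sym, E|]; auto.
    - unfold A in H. assert (KA := H). below H t Ht H. destruct H as (w & K1 & K2).
      assert (K2' : forall u, u ≼ t -> F w z u). { intros u Hu. unfold F in *. exact (proj1 (forces_stable _ _) _ _ Hu K2). }
      apply fmem_el in K1. below K1 u Hu K1. destruct K1 as (i & _ & E).
      assert (K3 : F (el x i) z u). { eapply CF; [exact E|apply feq_refl|]; auto. }
      assert (K4 := Hc _ _ _ K3).
      assert (E' : feq z (c (i, u)) u).
      { apply (fn (el x i) z (c (i,u)) u); auto. le. }
      eapply fmem_cong_l. apply feq_sym, E'. apply fmem_intro. apply dcl_intro.
      repeat split; try le; auto.
      eapply dn_map. exact KA. intros u' Hu' (w' & L1 & L2). exists w'. split; auto.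
      eapply CF; [apply feq_refl| |exact L2]. eapply feq_mono; eauto. }
  apply oex_intro with (sup c B). stab. intro z.
  rewrite forces_Iff, forces_Ex.
  match goal with |- oiff _ (oex ?G) _ => replace G with (fun z' => z' ∈ x ∧ F z' z) end.
  - split; intros r Hr H; apply M; auto.
  - apply functional_extensionality. intro w. rewrite forces_And, forces_ren.
    unfold F. f_equal. f_equal. apply functional_extensionality. intros [|[|i]]; reflexivity.
Qed.

Lemma forced_ZFC phi : ZFC phi -> forall e p, forces phi e p.
Proof.
  intros H e p. destruct H; unfold sentence.
  - replace (forces _ e) with (∀ x y : name P, (∀ z : name P, z ∈ x ⇔ z ∈ y) ⇒ x ≐ y) by (symmetry; rf).
    intros x y q Hq H. apply feq_ext. intros z r Hr. destruct (H z) as [H1 H2]. split; auto.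
  - replace (forces _ e) with (∀ x : name P, (∃ y : name P, y ∈ x) ⇒ ∃ y : name P,
      y ∈ x ∧ ∀ z : name P, z ∈ y ⇒ ¬ z ∈ x) by (symmetry; rf).
    intros x q Hq H. below H r Hr H. apply fmem_wf, H.
  - replace (forces _ e) with (∀ x y : name P, ∃ u : name P, o_is_upair u x y)
      by (symmetry; rf; apply rf_is_upair; auto with lk).
    apply forced_pairing.
  - replace (forces _ e) with (∀ x : name P, ∃ u : name P, ∀ z : name P,
      z ∈ u ⇔ ∃ y : name P, y ∈ x ∧ z ∈ y) by (symmetry; rf).
    apply forced_union.
  - replace (forces _ e) with (∀ x : name P, ∃ u : name P, ∀ z : name P, z ∈ u ⇔ o_subset z x)
      by (symmetry; rf; apply rf_subset; auto with lk).
    apply forced_power.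
  - replace (forces _ e) with (∃ w : name P, (∃ e : name P, e ∈ w ∧ o_is_empty e) ∧
     (∀ x : name P, x ∈ w ⇒ ∃ y : name P, y ∈ w ∧ o_is_succ y x))
     by (symmetry; rf; first [apply rf_is_empty|apply rf_is_succ]; auto with lk).
    apply forced_infinity.
  - match goal with |- forces ?f e p => replace (forces f e) with
     (∀ x : name P, (∀ y : name P, y ∈ x ⇒ ∃ u : name P, u ∈ y) ∧
      (∀ y z u : name P, y ∈ x ∧ z ∈ x ∧ u ∈ y ∧ u ∈ z ⇒ y ≐ z) ⇒
       ∃ c : name P, ∀ y : name P, y ∈ x ⇒ ∃ z : name P, ∀ u : name P, (u ∈ c ∧ u ∈ y) ⇔ u ≐ z)
     by (symmetry; rf) end.
    apply forced_choice.
  - apply forces_closure. apply forced_separation.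
  - apply forces_closure. apply forced_replacement.
Qed.

Theorem relatively_consistent_of_forced (phi : form) (p0 : P) :
  (forall e p, forces phi e p) -> relatively_consistent ZFC phi.
Proof.
  intros H _. apply forced_consistent; auto. intros psi [K| ->]; auto. apply forced_ZFC, K.
Qed.
End ZFC_forced.

(** * Pairs, functions and ordinals in the extension *)

Section Pairs.
Context {P : Type} {PP : poset P}.
Implicit Types (x y z f u : name P) (p q r : P).
Local Open Scope oprop_scope.

Definition npair x y := upair (upair x x) (upair x y).

Lemma o_is_upair_iff u x y p : o_is_upair u x y p <-> feq u (upair x y) p.
Proof.
  split.
  - intro H. apply feq_ext. intros z q Hq. rewrite fmem_upair. destruct (H z) as [H1 H2].
    split; auto.
  - intros E z. split; intros q Hq H; lift Hq.
    + apply fmem_upair. eapply fmem_cong_r; eauto.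
    + eapply fmem_cong_r. apply feq_sym, E. apply fmem_upair, H.
Qed.

Lemma upair_cong x x' y y' p : feq x x' p -> feq y y' p -> feq (upair x y) (upair x' y') p.
Proof.
  intros E1 E2. apply feq_ext. intros z q Hq. rewrite !fmem_upair. lift Hq.
  split; intro H; below H r Hr H; (destruct H as [H|H];
    [apply oor_l; stab; eapply feq_trans; eauto using feq_sym
    |apply oor_r; stab; eapply feq_trans; eauto using feq_sym]).
Qed.

Lemma npair_cong x x' y y' p : feq x x' p -> feq y y' p -> feq (npair x y) (npair x' y') p.
Proof. intros. apply upair_cong; apply upair_cong; auto. Qed.

Lemma upair_inj a b c d p : feq (upair a b) (upair c d) p ->
  oor (oand (feq a c) (feq b d)) (oand (feq a d) (feq b c)) p.
Proof.
  intro E.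
  assert (M : forall z q, q ≼ p -> oor (feq z a) (feq z b) q <-> oor (feq z c) (feq z d) q).
  { intros z q Hq. rewrite <- !fmem_upair. lift Hq.
    split; intro H; eapply fmem_cong_r; eauto using feq_sym. }
  assert (Ha : oor (feq a c) (feq a d) p) by (apply M; auto; apply oor_l; stab; apply feq_refl).
  assert (Hb : oor (feq b c) (feq b d) p) by (apply M; auto; apply oor_r; stab; apply feq_refl).
  assert (Hc : oor (feq c a) (feq c b) p) by (apply M; auto; apply oor_l; stab; apply feq_refl).
  assert (Hd : oor (feq d a) (feq d b) p) by (apply M; auto; apply oor_r; stab; apply feq_refl).
  clear M E.
  (* Sixteen cases, each closed by symmetry and transitivity of forced equality. *)
  below Ha q1 Hq1 Ha; destruct Ha as [Ha|Ha]; below Hb q2 Hq2 Hb; destruct Hb as [Hb|Hb];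
    below Hc q3 Hq3 Hc; destruct Hc as [Hc|Hc]; below Hd q4 Hq4 Hd; destruct Hd as [Hd|Hd];
    assert (T := fun x y z => @feq_trans P PP x y z q4);
    assert (S := fun x y => @feq_sym P PP x y q4);
    solve [apply oor_l; [stab|]; split; eauto 5 | apply oor_r; [stab|]; split; eauto 5].
Qed.

Lemma npair_inj x y x' y' p : feq (npair x y) (npair x' y') p -> feq x x' p /\ feq y y' p.
Proof.
  intro E. apply upair_inj in E.
  change (oand (feq x x') (feq y y') p).
  below E q1 Hq1 E. destruct E as [[E1 E2]|[E1 E2]]; apply upair_inj in E1, E2;
    below E1 q2 Hq2 E1; destruct E1 as [[? ?]|[? ?]];
    below E2 q3 Hq3 E2; destruct E2 as [[? ?]|[? ?]];
    assert (T := fun x y z => @feq_trans P PP x y z q3);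
    assert (S := fun x y => @feq_sym P PP x y q3);
    split; eauto 5.
Qed.

Lemma o_is_opair_iff u x y p : o_is_opair u x y p <-> feq u (npair x y) p.
Proof.
  split; intro H.
  - below H q Hq H. destruct H as (a & H). below H q1 Hq1 H. destruct H as (b & H1 & H2 & H3).
    apply o_is_upair_iff in H1, H2, H3. eapply feq_trans. exact H3.
    apply upair_cong; auto.
  - apply oex_intro with (upair x x). unfold o_is_upair; stab.
    apply oex_intro with (upair x y). unfold o_is_upair; stab.
    repeat split; apply o_is_upair_iff; auto using feq_refl.
Qed.

Lemma o_app_iff f x y p : o_app f x y p <-> fmem (npair x y) f p.
Proof.
  split; intro H.
  - below H q Hq H. destruct H as (u & H1 & H2). apply o_is_opair_iff in H1.
    eapply fmem_cong_l; eauto.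
  - apply oex_intro with (npair x y). unfold o_is_opair; stab.
    split; auto. apply o_is_opair_iff, feq_refl.
Qed.

Lemma mono_o_app f x y : mono (o_app f x y).
Proof. apply mono_oex. Qed.

Lemma mono_o_is_opair u x y : mono (o_is_opair u x y).
Proof. apply mono_oex. Qed.

Lemma mono_o_is_fun f a b : mono (o_is_fun f a b).
Proof. apply stable_mono, o_is_fun_stable. Qed.
End Pairs.
#[global] Hint Resolve mono_o_app mono_o_is_opair mono_o_is_fun : stab.

(** * Sets indexed by a ground type, and the functions between them *)

Section GroundSets.
Context {P : Type} {PP : poset P}.
Implicit Types (x y z f u : name P) (p q r : P).
Local Open Scope oprop_scope.

Definition gset {A : Type} (na : A -> name P) : name P := sup na (fun _ _ => True).

Lemma mem_gset {A} (na : A -> name P) z p :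
  fmem z (gset na) p <-> dn (fun q => exists a, feq z (na a) q) p.
Proof.
  split; intro H; eapply dn_map; try exact H; intros q Hq (a & K).
  - exists a. apply K.
  - exists a. split; auto. exists q. auto.
Qed.

Lemma mem_gset_intro {A} (na : A -> name P) a p : fmem (na a) (gset na) p.
Proof. apply (fmem_intro na (fun _ _ => True)). exists p. auto. Qed.

Definition distinct {A : Type} (na : A -> name P) :=
  forall a b p, feq (na a) (na b) p -> a = b.

Context {A B : Type} (na : A -> name P) (nb : B -> name P).

(** [val] reads a name of a function as a relation with truth values in the forcing, and [rel] turns
    such a relation into a name. By [fun_eq_rel] they are inverse on functions, so arguments about
    functions become arguments about relations [A -> B -> P -> Prop]. *)
Definition val f (a : A) (b : B) : P -> Prop := fmem (npair (na a) (nb b)) f.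

Definition rel (R : A -> B -> P -> Prop) : name P :=
  sup (fun ab => npair (na (fst ab)) (nb (snd ab))) (fun ab => R (fst ab) (snd ab)).

Definition total (R : A -> B -> P -> Prop) p := forall a, dn (fun q => exists b, R a b q) p.
Definition functional (R : A -> B -> P -> Prop) p :=
  forall a b b' q, q ≼ p -> R a b q -> R a b' q -> b = b'.
Definition one_to_one (R : A -> B -> P -> Prop) p :=
  forall a a' b q, q ≼ p -> R a b q -> R a' b q -> a = a'.

Lemma mem_rel R z p : (forall a b, mono (R a b)) -> fmem z (rel R) p <->
  dn (fun q => exists a b, R a b q /\ feq z (npair (na a) (nb b)) q) p.
Proof.
  intro M. split; intro H; eapply dn_map; try exact H; intros q Hq.
  - intros ((a & b) & K & E). exists a, b. split; auto. eapply dcl_of_mono; eauto.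
  - intros (a & b & K & E). exists (a, b). split; auto. exists q. auto.
Qed.

Lemma val_stable f a b : stable (val f a b).
Proof. apply fmem_stable. Qed.
#[local] Hint Resolve val_stable : stab.

Hypothesis Da : distinct na.
Hypothesis Db : distinct nb.

Lemma val_rel R a b p : (forall a b, mono (R a b)) -> val (rel R) a b p <-> dn (R a b) p.
Proof.
  intro M. unfold val. rewrite mem_rel; auto.
  split; intro H; eapply dn_map; try exact H; intros q Hq.
  - intros (a' & b' & K & E). apply npair_inj in E as [E1 E2].
    apply Da in E1. apply Db in E2. subst. auto.
  - intro K. exists a, b. split; auto. apply feq_refl.
Qed.

Lemma is_fun_gset f p : o_is_fun f (gset na) (gset nb) p <->
  (forall z q, q ≼ p -> fmem z f q ->
     dn (fun r => exists a b, feq z (npair (na a) (nb b)) r) q) /\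
  total (val f) p /\ functional (val f) p.
Proof.
  split.
  - intros [H1 H2].
    assert (K : forall z q, q ≼ p -> fmem z f q ->
     dn (fun r => exists a b, feq z (npair (na a) (nb b)) r) q).
    { intros z q Hq K. specialize (H1 z q Hq K). below H1 q1 Hq1 H1.
      destruct H1 as (x & H1). below H1 q2 Hq2 H1. destruct H1 as (y & X & Y & E).
      apply mem_gset in X, Y.
      below X q3 Hq3 X. destruct X as [a X]. below Y q4 Hq4 Y. destruct Y as [b Y].
      apply o_is_opair_iff in E.
      intros r Hr. exists r. split; auto. exists a, b. lift Hr.
      eapply feq_trans. exact E. apply npair_cong; auto. }
    split; [exact K|]. split.
    + intro a. assert (Ha := H2 (na a) p (ple_refl p) (mem_gset_intro na a p)).
      below Ha q Hq Ha. destruct Ha as (y & Hy & _). apply o_app_iff in Hy.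
      assert (L := K _ q Hq Hy). eapply dn_map. exact L. intros r Hr (a' & b & E).
      lift Hr. assert (E' := npair_inj E). destruct E' as [E1 E2]. apply Da in E1. subst a'.
      exists b. eapply fmem_cong_l. exact E. exact Hy.
    + intros a b b' q Hq Hb Hb'.
      assert (Ha := H2 (na a) q Hq (mem_gset_intro na a q)).
      destruct (Ha q (ple_refl q)) as (r & Hr & y & _ & U). lift Hr.
      apply (@Db b b' r). eapply feq_trans with y.
      * apply (U (nb b) r (ple_refl r)), o_app_iff, Hb.
      * apply feq_sym, (U (nb b') r (ple_refl r)), o_app_iff, Hb'.
  - intros (H1 & H2 & H3). split.
    + intros z q Hq K. specialize (H1 z q Hq K). below H1 r Hr H1. destruct H1 as (a & b & E).
      apply oex_intro with (na a). unfold o_is_opair; stab.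
      apply oex_intro with (nb b). unfold o_is_opair; stab.
      repeat split; try apply mem_gset_intro. apply o_is_opair_iff, E.
    + intros z q Hq K. apply mem_gset in K. below K r Hr K. destruct K as [a E].
      assert (Ha := H2 a). assert (Hrp : r ≼ p) by le. lift Hrp. below Ha s Hs Ha. destruct Ha as [b Hb].
      assert (L : o_app f z (nb b) s).
      { apply o_app_iff. eapply fmem_cong_l; [|exact Hb]. apply npair_cong; auto using feq_refl, feq_sym. }
      apply oex_intro with (nb b). stab. split; auto.
      intros w t Ht Hw. apply o_app_iff in Hw. lift Ht.
      assert (Hw' : fmem (npair (na a) w) f t).
      { eapply fmem_cong_l; [|exact Hw]. apply npair_cong; auto using feq_refl. }
      assert (Htp : t ≼ p) by le. assert (G := H1 _ t Htp Hw').
      below G t1 Ht1 G. destruct G as (a' & b' & E'). assert (E2 := npair_inj E').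
      destruct E2 as [E1 E2]. apply Da in E1. subst a'.
      assert (b = b').
      { apply (H3 a b b' t1). le. exact Hb. eapply fmem_cong_l; [|exact Hw']. auto. }
      subst. auto.
Qed.

Lemma is_fun_rel R p : (forall a b, mono (R a b)) -> total R p -> functional R p ->
  o_is_fun (rel R) (gset na) (gset nb) p.
Proof.
  intros M HT HF. apply is_fun_gset. split; [|split].
  - intros z q Hq H. apply mem_rel in H; auto. eapply dn_map; [exact H|].
    intros r Hr (a & b & _ & E). eauto.
  - intro a. eapply dn_map; [exact (HT a)|]. intros q Hq [b Hb]. exists b. apply val_rel; auto.
    apply dn_intro; auto.
  - intros a b b' q Hq H H'. apply val_rel in H, H'; auto.
    destruct (H q (ple_refl q)) as (r & Hr & K). destruct (H' r Hr) as (s & Hs & K').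
    apply (HF a b b' s); auto. le. eapply M; eauto.
Qed.

Lemma fun_eq_rel f p : o_is_fun f (gset na) (gset nb) p -> feq f (rel (val f)) p.
Proof.
  intro H. apply is_fun_gset in H as (H & _). apply feq_ext. intros z q Hq.
  rewrite mem_rel by (intros; apply val_stable). split; intro K.
  - eapply dn_map. apply H; eauto. intros r Hr (a & b & E). exists a, b. split; auto.
    lift Hr. eapply fmem_cong_l; eauto.
  - below K r Hr K. destruct K as (a & b & K & E). eapply fmem_cong_l. apply feq_sym, E. exact K.
Qed.

Lemma is_inj_gset f p : o_is_inj f (gset na) (gset nb) p <->
  o_is_fun f (gset na) (gset nb) p /\ one_to_one (val f) p.
Proof.
  split; intros [H1 H2]; split; auto.
  - intros a a' b q Hq K K'. apply (@Da a a' q). apply (H2 (na a) (na a') (nb b) q Hq).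
    split; apply o_app_iff; auto.
  - apply is_fun_gset in H1 as [H1 _].
    intros x x' y q Hq [K K']. apply o_app_iff in K, K'.
    assert (G := H1 _ q Hq K). assert (G' := H1 _ q Hq K').
    below G q1 Hq1 G. destruct G as (a & b & E).
    below G' q2 Hq2 G'. destruct G' as (a' & b' & E').
    destruct (npair_inj E) as [E1 E2].
    destruct (npair_inj E') as [E1' E2'].
    assert (b = b'). { apply (@Db b b' q2). eapply feq_trans; eauto using feq_sym. }
    subst b'. assert (a = a').
    { apply (H2 a a' b q2). le. eapply fmem_cong_l; eauto. eapply fmem_cong_l; eauto. }
    subst. eapply feq_trans; eauto using feq_sym.
Qed.

(** Relations suffice as candidates, since a function is forced equal to the [rel] of its [val]. *)
Definition funspace : name P :=
  sup rel (fun R => o_is_fun (rel R) (gset na) (gset nb)).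

Lemma mem_funspace f p : fmem f funspace p <-> o_is_fun f (gset na) (gset nb) p.
Proof.
  split; intro H.
  - below H q Hq H. destruct H as (R & HR & E).
    apply dcl_of_mono in HR; [|stab].
    eapply o_is_fun_cong; [apply feq_sym, E|apply feq_refl|apply feq_refl|auto].
  - eapply fmem_cong_l. apply feq_sym, fun_eq_rel, H.
    apply fmem_intro. apply dcl_intro.
    eapply o_is_fun_cong; [apply fun_eq_rel, H|apply feq_refl|apply feq_refl|auto].
Qed.
End GroundSets.
#[global] Hint Resolve val_stable : stab.

Section Cardinality.
Context {P : Type} {PP : poset P} {A B : Type} (na : A -> name P) (nb : B -> name P).
Hypothesis Da : distinct na.
Hypothesis Db : distinct nb.

Lemma one_to_one_rel (R : A -> B -> P -> Prop) p :
  (forall a b, mono (R a b)) -> one_to_one R p -> one_to_one (val na nb (rel na nb R)) p.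
Proof.
  intros M HO a a' b q Hq H H'. apply val_rel in H, H'; auto.
  destruct (H q (ple_refl q)) as (r & Hr & K). destruct (H' r Hr) as (s & Hs & K').
  apply (HO a a' b s); auto. le. eapply M; eauto.
Qed.

Lemma card_le_intro (R : A -> B -> P -> Prop) p : (forall a b, mono (R a b)) ->
  total R p -> functional R p -> one_to_one R p -> o_card_le (gset na) (gset nb) p.
Proof.
  intros M HT HF HO. apply oex_intro with (rel na nb R); [unfold o_is_inj; stab|].
  apply is_inj_gset; auto. split. apply is_fun_rel; auto. apply one_to_one_rel; auto.
Qed.

Lemma card_le_elim p : o_card_le (gset na) (gset nb) p ->
  exists q (R : A -> B -> P -> Prop), q ≼ p /\ (forall a b, stable (R a b)) /\
    total R q /\ functional R q /\ one_to_one R q.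
Proof.
  intro H. destruct (H p (ple_refl p)) as (q & Hq & f & Hf).
  apply is_inj_gset in Hf as [Hf HO]; auto. apply is_fun_gset in Hf as (_ & HT & HF); auto.
  exists q, (val na nb f). split; auto. split; auto. intros; apply val_stable.
Qed.
End Cardinality.

(** * Ground well-orders as ordinals of the extension *)

Section Ordinals.
Context {P : Type} {PP : poset P} {K : Type} {lt : K -> K -> Prop} (W : well_order lt).
Implicit Types (p q r : P) (x y z : K) (u v w : name P).

(** The check name of the von Neumann ordinal given by the order type of the segment below [x]. *)
Definition onm : K -> name P :=
  Fix (wo_wf W) (fun _ => name P) (fun x rec =>
    gset (fun y : {y | lt y x} => rec (proj1_sig y) (proj2_sig y))).
Definition seg x (y : {y | lt y x}) : name P := onm (proj1_sig y).
Definition oset : name P := gset onm.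

Lemma onm_eq x : onm x = gset (@seg x).
Proof.
  unfold onm at 1. rewrite Fix_eq. reflexivity.
  intros y f g H. replace g with f; auto.
  apply functional_extensionality_dep. intro z. apply functional_extensionality_dep. auto.
Qed.

Lemma mem_onm u x p : fmem u (onm x) p <-> dn (fun q => exists y, lt y x /\ feq u (onm y) q) p.
Proof.
  rewrite onm_eq, mem_gset. split; intro H; eapply dn_map; try exact H; intros q Hq.
  - intros [[y L] E]. eauto.
  - intros (y & L & E). exists (exist _ y L). exact E.
Qed.

Lemma mem_onm_intro x y p : lt x y -> fmem (onm x) (onm y) p.
Proof. intro L. rewrite (onm_eq y). exact (mem_gset_intro (@seg y) (exist _ x L) p). Qed.

Lemma onm_distinct : distinct onm.
Proof.
  intros x y p E. destruct (wo_total W x y) as [L|[L|L]]; auto; exfalso.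
  - apply (@fmem_irrefl P _ (onm x) p). eapply fmem_cong_r. apply feq_sym, E. apply mem_onm_intro, L.
  - apply (@fmem_irrefl P _ (onm x) p). eapply fmem_cong_l. apply feq_sym, E. apply mem_onm_intro, L.
Qed.

Lemma seg_distinct x : distinct (@seg x).
Proof.
  intros [y L] [y' L'] p E. apply onm_distinct in E. simpl in E. subst. f_equal. apply proof_irrelevance.
Qed.

Lemma mem_onm_iff x y p : fmem (onm x) (onm y) p <-> lt x y.
Proof.
  split; [|apply mem_onm_intro]. intro H. apply mem_onm in H.
  destruct (H p (ple_refl p)) as (q & _ & z & L & E). apply onm_distinct in E. subst. auto.
Qed.

Lemma ord_le_iff x y p : o_ord_le (onm x) (onm y) p <-> lt x y \/ x = y.
Proof.
  split.
  - intro H. destruct (H p (ple_refl p)) as (q & _ & [L|E]).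
    left. apply mem_onm_iff in L. auto. right. eapply onm_distinct; eauto.
  - intros [L|<-]. apply oor_l; stab. apply mem_onm_iff, L. apply oor_r; stab. apply feq_refl.
Qed.

Lemma onm_trans x p : o_is_trans (onm x) p.
Proof.
  intros u q Hq Hu v r Hr Hv. apply mem_onm in Hu. lift Hr. below Hu s Hs Hu.
  destruct Hu as (y & L & E). assert (H : fmem v (onm y) s) by (eapply fmem_cong_r; eauto).
  apply mem_onm in H. apply mem_onm. eapply dn_map. exact H.
  intros t Ht (z & L' & E'). exists z. split; auto. eapply wo_trans; eauto.
Qed.

Lemma o_is_trans_cong u v p : feq u v p -> o_is_trans u p -> o_is_trans v p.
Proof.
  intros E H w q Hq Hw w' r Hr Hw'. assert (Hrp : r ≼ p) by le.
  eapply fmem_cong_r. eapply feq_mono; eauto. apply (H w q Hq); auto.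
  eapply fmem_cong_r. apply feq_sym. eapply feq_mono; eauto. auto.
Qed.

Lemma stable_o_is_trans u : stable (o_is_trans u).
Proof. unfold o_is_trans, o_subset. stab. Qed.

Lemma onm_is_ord x p : o_is_ord (onm x) p.
Proof.
  split. apply onm_trans. intros u q Hq H. apply mem_onm in H.
  refine (dn_elim _ H _). apply stable_o_is_trans. intros r Hr (y & L & E).
  eapply o_is_trans_cong. apply feq_sym, E. apply onm_trans.
Qed.

Lemma mem_oset u p : fmem u oset p <-> dn (fun q => exists y, feq u (onm y) q) p.
Proof. apply mem_gset. Qed.

Lemma oset_is_ord p : o_is_ord oset p.
Proof.
  split.
  - intros u q Hq Hu v r Hr Hv. apply mem_oset in Hu. lift Hr. below Hu s Hs Hu.
    destruct Hu as (y & E). assert (H : fmem v (onm y) s) by (eapply fmem_cong_r; eauto).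
    apply mem_onm in H. apply mem_oset. eapply dn_map. exact H.
    intros t Ht (z & L' & E'). exists z. auto.
  - intros u q Hq H. apply mem_oset in H.
    refine (dn_elim _ H _). apply stable_o_is_trans. intros r Hr (y & E).
    eapply o_is_trans_cong. apply feq_sym, E. apply onm_trans.
Qed.

Lemma oset_is_limit p : inhabited K -> (forall x, exists y, lt x y) -> o_is_limit oset p.
Proof.
  intros [x0] H. split. apply oset_is_ord. split.
  - apply oex_intro with (onm x0); stab. apply mem_gset_intro.
  - intros u q Hq Hu. apply mem_oset in Hu. below Hu r Hr Hu. destruct Hu as [x E].
    destruct (H x) as [y L]. apply oex_intro with (onm y); stab. split. apply mem_gset_intro.
    eapply fmem_cong_l. apply feq_sym, E. apply mem_onm_intro, L.
Qed.

Lemma onm_is_limit x p : (exists y, lt y x) -> (forall y, lt y x -> exists z, lt y z /\ lt z x) ->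
  o_is_limit (onm x) p.
Proof.
  intros [x0 L0] H. split. apply onm_is_ord. split.
  - apply oex_intro with (onm x0); stab. apply mem_onm_intro, L0.
  - intros u q Hq Hu. apply mem_onm in Hu. below Hu r Hr Hu. destruct Hu as (y & L & E).
    destruct (H y L) as (z & L1 & L2). apply oex_intro with (onm z); stab.
    split. apply mem_onm_intro, L2.
    eapply fmem_cong_l. apply feq_sym, E. apply mem_onm_intro, L1.
Qed.
End Ordinals.
#[global] Hint Resolve stable_o_is_trans : stab.

(** * Natural numbers and finite sets in the extension *)

Section Naturals.
Context {P : Type} {PP : poset P}.
Implicit Types (p q r : P) (u v w : name P).
Local Open Scope oprop_scope.

Lemma nat_wo : well_order Nat.lt.
Proof. split. intros; eapply Nat.lt_trans; eauto. intros; lia. exact lt_wf. Qed.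

Definition nnm : nat -> name P := onm nat_wo.
Definition omega : name P := oset nat_wo.

Lemma nnm_not_limit n p : ~ o_is_limit (nnm n) p.
Proof.
  intros (_ & H1 & H2). destruct n as [|n].
  - destruct (H1 p (ple_refl p)) as (q & _ & u & Hu). apply mem_onm in Hu.
    destruct (Hu q (ple_refl q)) as (r & _ & k & Hk & _). unfold Nat.lt in Hk. lia.
  - assert (K := H2 (nnm n) p (ple_refl p) (mem_onm_intro nat_wo _ _ p (Nat.lt_succ_diag_r n))).
    destruct (K p (ple_refl p)) as (q & _ & u & Hu & Hn). apply mem_onm in Hu.
    destruct (Hu q (ple_refl q)) as (r & Hr & k & Hk & E). lift Hr.
    assert (L : fmem (nnm n) (nnm k) r) by (eapply fmem_cong_r; eauto).
    apply mem_onm_iff in L. unfold Nat.lt in *. lia.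
Qed.

Lemma stable_o_is_ord u : stable (o_is_ord u).
Proof. unfold o_is_ord. stab. Qed.

Lemma stable_o_is_limit u : stable (o_is_limit u).
Proof. unfold o_is_limit. pose proof stable_o_is_ord. stab. Qed.

Lemma omega_is_omega p : o_is_omega omega p.
Proof.
  split.
  - apply oset_is_limit. exact (inhabits 0). intro x. exists (S x). unfold Nat.lt. lia.
  - intros u q Hq Hu r Hr L. apply mem_oset in Hu. destruct (Hu r Hr) as (s & Hs & n & E).
    apply (@nnm_not_limit n s). eapply o_is_limit_cong. exact E.
    exact (proj1 (stable_o_is_limit u) _ _ Hs L).
Qed.

(** Induction on the name [u]. Its elements are numerals by induction; if it is nonempty, then, not
    being a limit, it acquires a largest element [n] at some extension, and is then the successor of
    [n]. *)
Lemma finite_ordinal u : forall p, o_is_ord u p -> (forall q, q ≼ p -> ~ o_is_limit u q) ->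
  (forall v q, q ≼ p -> fmem v u q -> forall r, r ≼ q -> ~ o_is_limit v r) ->
  dn (fun q => exists n, feq u (nnm n) q) p.
Proof.
  induction u as [A f IH v]. set (u := sup f v) in *. intros p Ho Hl He.
  assert (EL : forall w q, q ≼ p -> fmem w u q -> dn (fun r => exists n, feq w (nnm n) r) q).
  { intros w q Hq Hw. assert (Hw' := Hw). apply fmem_el in Hw'. eapply dn_bind. exact Hw'.
    intros r Hr (a & _ & E). change (feq w (f a) r) in E.
    assert (Ha : fmem (f a) u r) by (eapply fmem_cong_l; [exact E|eapply fmem_mono; eauto]).
    assert (Hrp : r ≼ p) by le.
    eapply dn_map.
    - apply (IH a r).
      + destruct Ho as [T1 T2]. split.
        * apply (T2 (f a) r Hrp Ha).
        * intros z s Hs Hz. apply (T2 z s). le. apply (T1 (f a) r Hrp Ha z s Hs Hz).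
      + intros s Hs. apply (He (f a) r Hrp Ha s Hs).
      + intros z s Hs Hz t Ht. destruct Ho as [T1 T2].
        apply (He z s). le. apply (T1 (f a) r Hrp Ha z s Hs Hz). auto.
    - intros s Hs [n En]. exists n. eapply feq_trans; eauto. eapply feq_mono; eauto. }
  intros q Hq.
  destruct (classic (exists r w, r ≼ q /\ fmem w u r)) as [(r & w & Hr & Hw)|Hn].
  2: { exists q. split; auto. exists 0. apply feq_ext. intros z r Hr. split; intro H.
       - exfalso. eauto.
       - exfalso. apply mem_onm in H. destruct (H r (ple_refl r)) as (s & _ & k & Hk & _).
         unfold Nat.lt in Hk. lia. }
  (* Without such a largest element below [r], the condition [r] would force [u] to be a limit. *)
  assert (Hx : exists s y, s ≼ r /\ fmem y u s /\ forall t z, t ≼ s -> fmem z u t -> ~ fmem y z t).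
  { apply NNPP. intro N. apply (Hl r). le. split; [|split].
    - refine (proj1 (stable_o_is_ord _) _ _ _ Ho). le.
    - apply oex_intro with w; stab.
    - intros y s Hs Hy t Ht. apply NNPP. intro N'. apply N. exists t, y.
      split. le. split. eapply fmem_mono; eauto.
      intros t' z Ht' H1 H2. apply N'. exists t'. split; auto. exists z. split; auto. }
  destruct Hx as (s & y & Hs & Hy & Hmax).
  assert (Hsp : s ≼ p) by le.
  destruct (EL y s Hsp Hy s (ple_refl s)) as (t & Ht & n & En). lift Ht.
  exists t. split. le. exists (S n). apply feq_ext. intros z t' Ht'. lift Ht'.
  split; intro Hz.
  - assert (Htp : t' ≼ p) by le. assert (Ez := EL z t' Htp Hz). below Ez t1 Ht1 Ez.
    destruct Ez as [k Ez].
    destruct (le_lt_dec k n) as [L|L].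
    + eapply fmem_cong_l. apply feq_sym, Ez. apply mem_onm_intro. unfold Nat.lt. lia.
    + exfalso. apply (Hmax t1 z). le. auto.
      eapply fmem_cong_l. apply feq_sym, En. eapply fmem_cong_r. apply feq_sym, Ez.
      apply mem_onm_intro, L.
  - apply mem_onm in Hz. below Hz t1 Ht1 Hz. destruct Hz as (k & Lk & Ez).
    destruct (Nat.eq_dec k n) as [->|Nk].
    + eapply fmem_cong_l; [|exact Hy]. eapply feq_trans. exact En. apply feq_sym, Ez.
    + destruct Ho as [T1 _]. apply (T1 y t1); auto. le.
      eapply fmem_cong_r. apply feq_sym, En. eapply fmem_cong_l. apply feq_sym, Ez.
      apply mem_onm_intro. unfold Nat.lt in *. lia.
Qed.

(** Needed because [o_finite] quantifies over any name [w] for the set of naturals, not just over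
    [omega]. *)
Lemma omega_elements w u p : o_is_omega w p -> fmem u w p -> dn (fun q => exists n, feq u (nnm n) q) p.
Proof.
  intros [[[T1 T2] _] N] Hu. apply finite_ordinal.
  - split. apply (T2 u p); auto. intros v q Hq Hv. apply (T2 v q Hq). apply (T1 u p (ple_refl p) Hu v q Hq Hv).
  - intros q Hq L. apply (N u p (ple_refl p) Hu q Hq L).
  - intros v q Hq Hv r Hr L. apply (N v q Hq (T1 u p (ple_refl p) Hu v q Hq Hv) r Hr L).
Qed.

Lemma finite_onm n p : o_finite (nnm n) p.
Proof.
  unfold o_finite. apply oex_intro with omega; [unfold o_is_omega; pose proof stable_o_is_limit; unfold o_card_le; stab|].
  apply oex_intro with (nnm n); [unfold o_is_omega; pose proof stable_o_is_limit; unfold o_card_le; stab|].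
  split. apply omega_is_omega. split. apply mem_gset_intro.
  unfold nnm. rewrite onm_eq. apply card_le_intro with (fun a b _ => a = b).
  - apply seg_distinct.
  - apply seg_distinct.
  - intros a b q r _ H. exact H.
  - intros a q Hq. exists q. eauto.
  - intros a b b' q _ -> ->. auto.
  - intros a a' b q _ -> ->. auto.
Qed.

(** The injection into a numeral [N] bounds the length of every list of distinct numerals forced
    into [s]. A longest such list, over all extensions of [q], exhausts the numerals of [s] below
    the condition that forces it. *)
Lemma finite_bounded s p : o_finite s p ->
  dn (fun q => exists l, forall i r, r ≼ q -> fmem (nnm i) s r -> In i l) p.
Proof.
  intros H. unfold o_finite in H. eapply dn_bind. exact H. clear H. intros q1 Hq1 (w & H).
  eapply dn_bind. exact H. clear H. intros q2 Hq2 (m & Hw & Hm & Hf).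
  eapply dn_bind. apply (@omega_elements w m q2 Hw Hm). intros q3 Hq3 (N & EN).
  eapply dn_bind. eapply dn_mono. exact Hq3. exact Hf. clear Hw. lift Hq3.
  intros q4 Hq4 (f & [HF1 HF2] & HI). lift Hq4.
  assert (V : forall i r, r ≼ q4 -> fmem (nnm i) s r -> dn (fun t => exists k, k < N /\ o_app f (nnm i) (nnm k) t) r).
  { intros i r Hr Hi. assert (Ha := HF2 _ r Hr Hi). eapply dn_bind. exact Ha.
    intros r1 Hr1 (y & Hy & _). assert (G := Hy). eapply dn_bind. exact G. intros r2 Hr2 (u & Hu1 & Hu2).
    assert (Hr2' : r2 ≼ q4) by le. assert (HF := HF1 u r2 Hr2' Hu2). eapply dn_bind. exact HF.
    intros r3 Hr3 (x & HF'). eapply dn_bind. exact HF'. intros r4 Hr4 (y' & _ & Hy' & E).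
    apply o_is_opair_iff in E, Hu1. lift Hr3. lift Hr4.
    assert (E2 : feq (npair x y') (npair (nnm i) y) r4) by (eapply feq_trans; [apply feq_sym, E|exact Hu1]). apply npair_inj in E2 as [_ E2].
    assert (EN' : feq m (nnm N) r4) by (eapply feq_mono; [|exact EN]; le).
    assert (L : fmem y' (nnm N) r4) by (eapply fmem_cong_r; eauto).
    apply mem_onm in L. eapply dn_map. exact L. intros r5 Hr5 (k & Lk & Ek). exists k. split; auto.
    lift Hr5. apply o_app_iff. eapply fmem_cong_l; [|exact Hu2]. eapply feq_trans. exact Hu1.
    apply npair_cong. apply feq_refl. eapply feq_trans. apply feq_sym, E2. exact Ek. }
  (* Deciding the values of the injection one by one along [l] gives an honest injection of [l] into
     the numbers below [N]. *)
  assert (Bd : forall l, NoDup l -> forall r, r ≼ q4 -> (forall i, In i l -> fmem (nnm i) s r) -> length l <= N).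
  { intros l ND r Hr Hl.
    assert (G : exists t g, t ≼ r /\ forall i, In i l -> g i < N /\ o_app f (nnm i) (nnm (g i)) t).
    { clear ND. induction l as [|j l IH].
      - exists r, (fun _ => 0). split; auto. intros i [].
      - destruct IH as (t & g & Ht & Hg). intros i Hi. apply Hl. right. auto.
        assert (Hj : fmem (nnm j) s t). { eapply fmem_mono; [exact Ht|]. apply Hl. left. auto. }
        assert (Htq : t ≼ q4) by le.
        destruct (V j t Htq Hj t (ple_refl t)) as (t' & Ht' & k & Lk & Hk).
        exists t', (fun i => if Nat.eq_dec i j then k else g i). split. le.
        intros i Hi. destruct (Nat.eq_dec i j) as [->|Nij]; auto.
        destruct Hi as [->|Hi]; [congruence|]. destruct (Hg i Hi) as [L1 L2]. split; auto.
        exact (@mono_o_app P _ _ _ _ _ _ Ht' L2). }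
    destruct G as (t & g & Ht & Hg).
    rewrite <- (length_map g l), <- (length_seq N 0). apply NoDup_incl_length.
    - apply NoDup_map_NoDup_ForallPairs; auto. intros i j Hi Hj Eg.
      apply (@onm_distinct P PP nat Nat.lt nat_wo i j t). assert (Htq : t ≼ q4) by le.
      apply (HI (nnm i) (nnm j) (nnm (g i)) t Htq). split. apply Hg; auto. rewrite Eg. apply Hg; auto.
    - intros k Hk. apply in_map_iff in Hk as (i & <- & Hi). apply in_seq. specialize (Hg i Hi). lia. }
  intros q Hq.
  assert (Mx : exists l r, NoDup l /\ r ≼ q /\ (forall i, In i l -> fmem (nnm i) s r) /\
    forall l' r', NoDup l' -> r' ≼ q -> (forall i, In i l' -> fmem (nnm i) s r') -> length l' <= length l).
  { pose (Pk := fun k => exists l r, NoDup l /\ r ≼ q /\ (forall i, In i l -> fmem (nnm i) s r) /\ length l + k = N).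
    assert (HN : exists k, Pk k). { exists N, nil, q. repeat split; auto. constructor. intros i []. }
    destruct (wo_least nat_wo Pk HN) as (k & (l & r & ND & Hr & Hl & El) & Hmin).
    exists l, r. repeat split; auto. intros l' r' ND' Hr' Hl'.
    destruct (le_lt_dec (length l') (length l)) as [|L]; auto. exfalso.
    assert (Hrq : r' ≼ q4) by le.
    assert (Lb := Bd l' ND' r' Hrq Hl'). apply (Hmin (N - length l')). unfold Nat.lt. lia.
    exists l', r'. repeat split; auto. lia. }
  destruct Mx as (l & r & ND & Hr & Hl & Hmax).
  exists r. split; auto. exists l. intros i t Ht Hi. apply NNPP. intro NI.
  assert (L : length (i :: l) <= length l).
  { apply (Hmax (i :: l) t). constructor; auto. le.
    intros j [<-|Hj]; auto. eapply fmem_mono; [exact Ht|]. auto. }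
  simpl in L. lia.
Qed.

Definition bnm (b : bool) : name P := nnm (if b then 1 else 0).
Definition two : name P := gset bnm.

Lemma bnm_distinct : distinct bnm.
Proof. intros a b p E. apply onm_distinct in E. destruct a, b; congruence. Qed.

Lemma nnm_succ n p : o_is_succ (nnm (S n)) (nnm n) p.
Proof.
  intro z. split; intros q Hq H.
  - apply mem_onm in H. below H r Hr H. destruct H as (k & Lk & E).
    destruct (Nat.eq_dec k n) as [->|N].
    + apply oor_r; stab.
    + apply oor_l; stab. eapply fmem_cong_l. apply feq_sym, E. apply mem_onm_intro. unfold Nat.lt in *. lia.
  - below H r Hr H. destruct H as [H|H].
    + apply mem_onm in H. apply mem_onm. eapply dn_map. exact H. intros s Hs (k & Lk & E).
      exists k. split; [unfold Nat.lt in *; lia|exact E].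
    + eapply fmem_cong_l. apply feq_sym, H. apply mem_onm_intro. unfold Nat.lt; lia.
Qed.

Lemma nnm_zero p : o_is_empty (nnm 0) p.
Proof.
  intros z q Hq H. apply mem_onm in H. destruct (H q (ple_refl q)) as (r & _ & k & Lk & _).
  unfold Nat.lt in Lk. lia.
Qed.

Lemma two_is_two p : o_is_two two p.
Proof.
  assert (E : feq two (nnm 2) p).
  { apply feq_ext. intros z q Hq. unfold two, nnm. rewrite mem_gset, mem_onm.
    split; intro H; eapply dn_map; try exact H; intros r Hr.
    - intros [b E]. exists (if b then 1 else 0). split; [destruct b; unfold Nat.lt; lia|exact E].
    - intros (k & Lk & E). exists (Nat.eqb k 1). unfold bnm.
      destruct k as [|[|k]]; simpl; auto. unfold Nat.lt in Lk; lia. }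
  apply oex_intro with (nnm 0). unfold o_is_succ, o_is_empty; stab.
  apply oex_intro with (nnm 1). unfold o_is_succ, o_is_empty; stab.
  split. apply nnm_zero. split. apply nnm_succ.
  intro z. destruct (nnm_succ 1 p z) as [H1 H2]. split; intros q Hq H; lift Hq.
  - apply H1; auto. eapply fmem_cong_r; eauto.
  - eapply fmem_cong_r. apply feq_sym, E. apply H2; auto.
Qed.
End Naturals.

Section Alephs.
Context {P : Type} {PP : poset P}.
Context {K L : Type} {ltK : K -> K -> Prop} {ltL : L -> L -> Prop}.
Variables (WK : well_order ltK) (WL : well_order ltL).

Lemma is_aleph_succ k : (forall p, o_is_aleph k (oset WK) p) ->
  (forall p (R : L -> K -> P -> Prop), (forall a b, stable (R a b)) ->
     total R p -> functional R p -> one_to_one R p -> False) ->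
  (forall x p, o_card_le (onm WL x) (oset WK) p) ->
  forall p, o_is_aleph (S k) (oset WL) p.
Proof.
  intros H1 H2 H3 p. simpl.
  apply oex_intro with (oset WK).
  - apply mono_oand. destruct k; simpl; unfold o_is_omega; [|stab].
    pose proof (@stable_o_is_limit P PP). stab.
    apply mono_oand. pose proof (@stable_o_is_ord P PP). stab. unfold o_card_le. stab.
  - split; auto. split. apply oset_is_ord. split.
    + intros q Hq H. apply card_le_elim in H; try apply onm_distinct.
      destruct H as (r & R & _ & HR & HT & HF & HO). eapply H2; eauto.
    + intros z q Hq Hz. apply mem_oset in Hz.
      refine (dn_elim _ Hz _); [unfold o_card_le; stab|]. intros r Hr (x & E).
      eapply o_card_le_cong; [apply feq_sym, E|apply feq_refl|auto].
Qed.
End Alephs.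

(** * Cardinal comparison in the metatheory *)

Definition injective {A B : Type} (f : A -> B) := forall x y, f x = f y -> x = y.
Definition emb (A B : Type) := exists f : A -> B, injective f.

Lemma emb_refl A : emb A A.
Proof. exists (fun x => x). intros x y. auto. Qed.

Lemma emb_trans A B C : emb A B -> emb B C -> emb A C.
Proof. intros [f Hf] [g Hg]. exists (fun x => g (f x)). intros x y H. auto. Qed.

(** Size at most [T], expressed by a partial surjection from [T] whose range may exceed [A]. In this
    form subsets and images are immediate. *)
Definition cov (T : Type) {X : Type} (A : X -> Prop) := exists R : T -> X -> Prop,
  (forall t x y, R t x -> R t y -> x = y) /\ forall x, A x -> exists t, R t x.

Section Cov.
Context {T X Y : Type}.

Lemma cov_sub (A B : X -> Prop) : (forall x, A x -> B x) -> cov T B -> cov T A.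
Proof. intros H (R & F & C). exists R. eauto. Qed.

Lemma cov_rel (A : X -> Prop) (F : X -> Y -> Prop) :
  (forall x y y', F x y -> F x y' -> y = y') -> cov T A ->
  cov T (fun y => exists x, A x /\ F x y).
Proof.
  intros HF (R & F1 & C). exists (fun t y => exists x, R t x /\ F x y). split.
  - intros t y y' (x & H1 & H2) (x' & H3 & H4). rewrite (F1 t x x') in *; eauto.
  - intros y (x & Ax & H). destruct (C x Ax) as [t Ht]. eauto.
Qed.

Lemma cov_comap (f : X -> Y) (A : X -> Prop) (B : Y -> Prop) :
  (forall x x', A x -> A x' -> f x = f x' -> x = x') -> (forall x, A x -> B (f x)) ->
  cov T B -> cov T A.
Proof.
  intros I H (R & F & C). exists (fun t x => A x /\ R t (f x)). split.
  - intros t x y [Ax Hx] [Ay Hy]. eauto.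
  - intros x Ax. destruct (C _ (H x Ax)) as [t Ht]. eauto.
Qed.

Lemma cov_emb (S : Type) (A : X -> Prop) : emb S T -> cov S A -> cov T A.
Proof.
  intros [f Hf] (R & F & C). exists (fun t x => exists s, t = f s /\ R s x). split.
  - intros t x y (s & -> & H) (s' & E & H'). apply Hf in E. subst. eauto.
  - intros x Ax. destruct (C x Ax) as [s Hs]. eauto.
Qed.

Lemma cov_self : cov T (fun _ : T => True).
Proof. exists eq. split; [congruence|eauto]. Qed.

Lemma cov_of_emb : emb X T -> cov T (fun _ : X => True).
Proof. intros [f Hf]. exists (fun t x => t = f x). split; [|eauto]. intros t x y -> E. auto. Qed.

Lemma cantor : ~ cov T (fun _ : T -> Prop => True).
Proof.
  intros (R & F & C). destruct (C (fun t => forall A, R t A -> ~ A t) I) as [t Ht].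
  assert (N : ~ (forall A, R t A -> ~ A t)). { intro H. exact (H _ Ht H). }
  apply N. intros A HA At. assert (E := F _ _ _ HA Ht). subst A. auto.
Qed.

Lemma cov_bigcup (A : X -> Prop) (B : X -> Y -> Prop) : emb (T * T) T -> cov T A ->
  (forall x, A x -> cov T (B x)) -> cov T (fun y => exists x, A x /\ B x y).
Proof.
  intros [pr Hpr] (R & F & C) HB.
  assert (HB' : forall x, exists R', (forall t y y', R' t y -> R' t y' -> y = y') /\
    (A x -> forall y, B x y -> exists t : T, R' t y)).
  { intro x. destruct (classic (A x)) as [Ax|N].
    - destruct (HB x Ax) as (R' & F' & C'). exists R'. auto.
    - exists (fun _ _ => False). split; [intros ? ? ? []|contradiction]. }
  apply choice in HB' as [R' HR'].
  exists (fun t y => exists t1 t2 x, t = pr (t1, t2) /\ R t1 x /\ R' x t2 y). split.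
  - intros t y y' (t1 & t2 & x & -> & H1 & H2) (t1' & t2' & x' & E & H3 & H4).
    apply Hpr in E. injection E as <- <-. rewrite <- (F _ _ _ H1 H3) in H4.
    exact (proj1 (HR' x) _ _ _ H2 H4).
  - intros y (x & Ax & Hy). destruct (C x Ax) as [t1 H1].
    destruct (proj2 (HR' x) Ax y Hy) as [t2 H2]. exists (pr (t1, t2)), t1, t2, x. auto.
Qed.
End Cov.

(** * Powers of trees *)

Inductive tree (X : Type) : Type := leaf (x : X) | node (a b : tree X).
Arguments leaf {X} x.
Arguments node {X} a b.

(** The power set of E = [tree X]. The constructor [node] is a pairing on E, so a function from E to
    the power set is coded by one subset of E; [pow] is this coding. *)
Definition Tof (X : Type) : Type := tree X -> Prop.

Section TreePowers.
Context {X : Type} (x0 : X).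
Let E := tree X.
Let T := Tof X.

Lemma emb_tree_Tof : emb E T.
Proof.
  exists (fun e e' => e = e'). intros a b H.
  assert (K := f_equal (fun f => f b) H). simpl in K. rewrite K. reflexivity.
Qed.

Lemma emb_leaf : emb X E.
Proof. exists leaf. intros a b H. injection H. auto. Qed.

Definition pow (f : E -> T) : T := fun e => match e with node a b => f a b | leaf _ => False end.

Lemma pow_inj : injective pow.
Proof.
  intros f g H. apply functional_extensionality. intro a. apply functional_extensionality. intro b.
  exact (f_equal (fun h => h (node a b)) H).
Qed.

Definition pr (s t : T) : T := pow (fun e => match e with leaf _ => s | node _ _ => t end).

Lemma pr_inj s t s' t' : pr s t = pr s' t' -> s = s' /\ t = t'.
Proof.
  intro H. apply pow_inj in H. split.
  - exact (f_equal (fun h => h (leaf x0)) H).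
  - exact (f_equal (fun h => h (node (leaf x0) (leaf x0))) H).
Qed.

Definition none : T := pr (fun _ => False) (fun _ => False).
Definition some (t : T) : T := pr (fun _ => True) t.

Lemma some_inj : injective some.
Proof. intros s t H. apply pr_inj in H. tauto. Qed.

Lemma some_none t : some t <> none.
Proof.
  intro H. apply pr_inj in H as [H _]. assert (K := f_equal (fun h => h (leaf x0)) H).
  simpl in K. rewrite <- K. exact I.
Qed.

Lemma emb_prod A B : emb A T -> emb B T -> emb (A * B) T.
Proof.
  intros [f Hf] [g Hg]. exists (fun ab => pr (f (fst ab)) (g (snd ab))).
  intros [a b] [a' b'] H. apply pr_inj in H as [H1 H2]. simpl in *. f_equal; auto.
Qed.

Lemma emb_TT : emb (T * T) T.
Proof. apply emb_prod; apply emb_refl. Qed.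

Lemma emb_list A : emb A T -> emb (list A) T.
Proof.
  intros [f Hf]. exists (fix c l := match l with nil => none | cons a l => some (pr (f a) (c l)) end).
  intros l. induction l as [|a l IH]; intros [|b k] H; auto.
  - symmetry in H. apply some_none in H. destruct H.
  - apply some_none in H. destruct H.
  - apply some_inj, pr_inj in H as [H1 H2]. f_equal; auto.
Qed.

Lemma emb_nat_tree : emb nat E.
Proof.
  exists (fun n => Nat.iter n (fun e => node e e) (leaf x0)).
  intros n. induction n as [|n IH]; intros [|m] H; simpl in *; try discriminate; auto.
  injection H as H _. f_equal. auto.
Qed.

Lemma cov_In A (l : list A) : cov E (fun a => In a l).
Proof.
  apply cov_emb with nat. apply emb_nat_tree. exists (fun n a => nth_error l n = Some a). split.
  - congruence.
  - intros a. apply In_nth_error.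
Qed.

(** Codes for points: [Bn k d s c] stands for the [k]-th support point of the chosen extension of
    the partial function that sends the point coded by [s j] to [c j], for [j] in [d]. [Bl] codes
    nothing and fills the places outside [d]. *)
Inductive btree : Type := Bl | Bn (k : E) (d : T) (s : E -> btree) (c : E -> T).

Lemma emb_btree : emb btree T.
Proof.
  exists (fix code t := match t with
    | Bl => none
    | Bn k d s c => some (pr (fun e => k = e) (pr d (pr (pow (fun e => code (s e))) (pow c))))
    end).
  intro t. induction t as [|k d s IH c]; intros [|k' d' s' c'] H; auto.
  - symmetry in H. apply some_none in H. destruct H.
  - apply some_none in H. destruct H.
  - apply some_inj, pr_inj in H as [H1 H]. apply pr_inj in H as [H2 H]. apply pr_inj in H as [H3 H4].
    apply pow_inj in H3, H4. subst. f_equal.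
    + assert (K := f_equal (fun h => h k') H1). simpl in K. rewrite K. reflexivity.
    + apply functional_extensionality. intro e. apply IH. exact (f_equal (fun h => h e) H3).
Qed.

(* Incompatible partial functions with supports indexed by [E] and fewer than
   [2^E] values form a family of size at most [2^E].  The trees name the points
   of the least set [D] of arguments such that whenever a partial function with
   domain in [D] extends to a member of the family, a chosen such extension has
   its support in [D]; every member is the chosen extension of its own trace. *)
Lemma antichain_cov (C Z V : Type) (f : C -> Z -> option V) (A : C -> Prop) :
  emb V T -> (forall c, A c -> cov E (fun z => f c z <> None)) ->
  (forall a b, A a -> A b -> a <> b -> exists z v w, f a z = Some v /\ f b z = Some w /\ v <> w) ->
  cov T A.
Proof.
  intros [g Hg] Hs Ha.
  destruct (classic (exists c, A c)) as [[c0 A0]|N].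
  2: { exists (fun _ _ => False). split; [intros ? ? ? []|]. intros x Ax. exfalso. eauto. }
  assert (Hs' : forall c, exists R : E -> Z -> Prop, (forall t x y, R t x -> R t y -> x = y) /\
    (A c -> forall z, f c z <> None -> exists t, R t z)).
  { intro c. destruct (classic (A c)) as [Ac|Nc].
    - destruct (Hs c Ac) as (R & F & Co). exists R. auto.
    - exists (fun _ _ => False). split; [intros ? ? ? []|contradiction]. }
  apply choice in Hs' as [R HR].
  (* [ext Q c] says that the member [c] of the family extends the partial function [Q]; [pick]
     singles out one such member by [epsilon], so it depends on [Q] alone. *)
  pose (ext := fun (Q : Z -> T -> Prop) c => A c /\ forall z t, Q z t -> exists v, f c z = Some v /\ g v = t).
  pose (pick := fun Q c => ext Q c /\ c = epsilon (inhabits c0) (ext Q)).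
  assert (pickE : forall Q c, ext Q c -> exists c', pick Q c').
  { intros Q c H. exists (epsilon (inhabits c0) (ext Q)). split; auto. apply epsilon_spec. eauto. }
  pose (ev := fix ev (t : btree) (z : Z) : Prop := match t with
    | Bl => False
    | Bn k d s c => exists x, pick (fun z' t' => exists j, d j /\ ev (s j) z' /\ c j = t') x /\ R x k z
    end).
  assert (evF : forall t x y, ev t x -> ev t y -> x = y).
  { intros [|k d s c] x y; simpl; [intros []|].
    intros (u & [_ Hu] & Ru) (u' & [_ Hu'] & Ru'). subst u'. subst u.
    eapply HR; eauto. }
  pose (QT := fun t => match t with Bl => fun _ _ => True
     | Bn k d s c => fun z' t' => exists j, d j /\ ev (s j) z' /\ c j = t' end).
  apply cov_emb with btree. apply emb_btree.
  exists (fun t x => pick (QT t) x). split.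
  { intros t x y [_ Hx] [_ Hy]. congruence. }
  intros a Aa.
  pose (D := fun z => exists t, ev t z).
  pose (d := fun j : E => exists z, R a j z /\ D z /\ f a z <> None).
  assert (Hsc : forall j, exists sc : btree * T, d j -> exists z v, R a j z /\ ev (fst sc) z /\ f a z = Some v /\ snd sc = g v).
  { intro j. destruct (classic (d j)) as [(z & H1 & [t Ht] & H3)|N].
    - destruct (f a z) as [v|] eqn:Ev; [|congruence]. exists (t, g v). intros _. exists z, v. auto.
    - exists (Bl, none). contradiction. }
  apply choice in Hsc as [sc Hsc].
  pose (t := fun k => Bn k d (fun j => fst (sc j)) (fun j => snd (sc j))).
  pose (Qa := fun z t => D z /\ exists v, f a z = Some v /\ g v = t).
  assert (EQ : forall k, QT (t k) = Qa).
  { intro k. apply functional_extensionality. intro z. apply functional_extensionality. intro u.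
    apply propositional_extensionality. simpl. split.
    - intros (j & Hd & He & Hu). destruct (Hsc j Hd) as (z' & v & H1 & H2 & H3 & H4).
      assert (z' = z) by (eapply evF; eauto). subst z'. split. exists (fst (sc j)). auto.
      exists v. split; congruence.
    - intros (HD & v & H1 & H2). destruct (proj2 (HR a) Aa z) as [j Hj]. congruence.
      assert (Hd : d j). { exists z. repeat split; auto. congruence. }
      exists j. split; auto. destruct (Hsc j Hd) as (z' & v' & K1 & K2 & K3 & K4).
      assert (z' = z) by (eapply HR; eauto). subst z'. split; auto. congruence. }
  destruct (pickE Qa a) as [x Hx].
  { split; auto. intros z u [_ H]. exact H. }
  (* If [a] and [x] differed, they would conflict at a point [z] of the support of [x]. Such a point
     is coded by some [t k], so it lies in [D], where [x] copies [a]. *)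
  assert (Exa : a = x).
  { apply NNPP. intro Ne. assert (Hx' := Hx). destruct Hx as [[Ax Hx] _].
    destruct (Ha a x Aa Ax Ne) as (z & v & w & H1 & H2 & H3).
    destruct (proj2 (HR x) Ax z) as [k Hk]. congruence.
    assert (HD : D z). { exists (t k). exists x. split; [|exact Hk].
      change (pick (QT (t k)) x). rewrite EQ. exact Hx'. }
    destruct (Hx z (g v)) as (v' & H4 & H5). { split; auto. exists v. auto. }
    apply Hg in H5. congruence. }
  (* [QT] ignores the index [k], so any tree may be put there. *)
  subst x. exists (t (leaf x0)). rewrite EQ. exact Hx.
Qed.
End TreePowers.

(** * The cardinals of the ground *)

(** Well-order the power set of [T]. Either some initial segment is not covered by [T], and the
    least such is taken, or the whole order serves, by Cantor's theorem. *)
Lemma successor_exists (T : Type) : exists S : {K : Type & K -> K -> Prop},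
  well_order (projT2 S) /\ (forall x, cov T (fun y => projT2 S y x)) /\
  ~ cov T (fun _ : projT1 S => True).
Proof.
  destruct (well_ordering (T -> Prop)) as [lt W].
  destruct (classic (exists x, ~ cov T (fun y => lt y x))) as [H|H].
  - destruct (wo_least W _ H) as (x & Hx & Hm).
    exists (existT (fun K => K -> K -> Prop) {y | lt y x} (fun a b => lt (proj1_sig a) (proj1_sig b))).
    simpl. split; [split|split].
    + intros a b c. apply (wo_trans W).
    + intros [a La] [b Lb]. simpl. destruct (wo_total W a b) as [L|[<-|L]]; auto.
      right. left. f_equal. apply proof_irrelevance.
    + intros [a La]. induction a as [a IH] using (well_founded_ind (wo_wf W)).
      constructor. intros [b Lb] L. apply IH. exact L.
    + intros [a La]. simpl. apply cov_comap with (f := @proj1_sig _ _) (B := fun y => lt y a); auto.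
      * intros [b Lb] [c Lc] _ _ E. simpl in E. subst. f_equal. apply proof_irrelevance.
      * apply NNPP. intro N. exact (Hm a La N).
    + intro Cv. apply Hx.
      apply cov_sub with (fun y => exists z : {y | lt y x}, True /\ proj1_sig z = y).
      * intros y L. exists (exist _ y L). auto.
      * apply cov_rel; auto. congruence.
  - exists (existT (fun K => K -> K -> Prop) (T -> Prop) lt). simpl. split; auto. split.
    + intro x. apply NNPP. eauto.
    + apply cantor.
Qed.

Definition successor (T : Type) : {K : Type & K -> K -> Prop} :=
  proj1_sig (constructive_indefinite_description _ (successor_exists T)).

Lemma successor_spec (T : Type) : well_order (projT2 (successor T)) /\
  (forall x, cov T (fun y => projT2 (successor T) y x)) /\
  ~ cov T (fun _ : projT1 (successor T) => True).
Proof. unfold successor. destruct constructive_indefinite_description. auto. Qed.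

(* [Kl l] is a regular cardinal, [Tl l] satisfies [Tl l ^ Kl l = Tl l] and
   [Kl (S l)] is the successor of [Tl l]. *)
Fixpoint Xl (l : nat) : Type :=
  match l with
  | 0 => nat
  | S l => (projT1 (successor (Tof (Xl l))) + Tof (Xl l))%type
  end.
Definition El l := tree (Xl l).
Definition Tl l := Tof (Xl l).
Definition Kl l : Type := match l with 0 => nat | S l => projT1 (successor (Tl l)) end.
Definition klt l : Kl l -> Kl l -> Prop :=
  match l with 0 => Nat.lt | S l => projT2 (successor (Tl l)) end.
Arguments klt {l} _ _.

Definition xl0 l : Xl l := match l with 0 => 0 | S l => inr (fun _ => False) end.

Lemma kwo l : well_order (@klt l).
Proof.
  destruct l as [|l].
  - split. exact Nat.lt_trans. intros; unfold klt, Nat.lt; lia. exact lt_wf.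
  - apply (successor_spec (Tl l)).
Qed.

(** [Xl (S l)] is the sum of [Kl (S l)] and [Tl l] so that both become leaves of [El (S l)], here
    and in [emb_Tl_El]. *)
Lemma emb_Kl_El l : emb (Kl l) (El l).
Proof.
  apply emb_trans with (Xl l); [|apply emb_leaf]. destruct l; [apply emb_refl|].
  exists inl. intros x y H. injection H. auto.
Qed.

Lemma emb_El_Tl l : emb (El l) (Tl l).
Proof. apply emb_tree_Tof. Qed.

Lemma emb_Tl_El l m : l < m -> emb (Tl l) (El m).
Proof.
  induction 1 as [|m H IH]; (eapply emb_trans; [|apply emb_leaf]);
    [|eapply emb_trans; [exact IH|]; eapply emb_trans; [apply emb_El_Tl|]];
    exists inr; intros x y K; injection K; auto.
Qed.

Lemma emb_Tl l m : l <= m -> emb (Tl l) (Tl m).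
Proof.
  intro H. destruct (Nat.eq_dec l m) as [->|N]. apply emb_refl.
  eapply emb_trans; [apply emb_Tl_El with (m := m); lia|apply emb_El_Tl].
Qed.

Lemma emb_TlTl l : emb (Tl l * Tl l) (Tl l).
Proof. apply emb_TT, xl0. Qed.

Lemma emb_nat_Tl l : emb nat (Tl l).
Proof. eapply emb_trans. apply (emb_nat_tree (xl0 l)). apply emb_El_Tl. Qed.

Lemma Kl_cov l : cov (Tl l) (fun _ : Kl l => True).
Proof. apply cov_of_emb. eapply emb_trans; [apply emb_Kl_El|apply emb_El_Tl]. Qed.

Lemma seg_cov l (x : Kl (S l)) : cov (Tl l) (fun y => klt y x).
Proof. apply (successor_spec (Tl l)). Qed.

Lemma Kl_not_cov l : ~ cov (Tl l) (fun _ : Kl (S l) => True).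
Proof. apply (successor_spec (Tl l)). Qed.

Lemma cov_sing l X (x : X) : cov (Tl l) (fun y => y = x).
Proof. exists (fun _ y => y = x). split; [congruence|]. intros y Hy. exists (fun _ => True). auto. Qed.

Lemma cov_union l X (A B : X -> Prop) : cov (Tl l) A -> cov (Tl l) B -> cov (Tl l) (fun x => A x \/ B x).
Proof.
  intros HA HB. apply cov_sub with (fun x => exists b : bool, True /\ if b then A x else B x).
  - intros x [H|H]; [exists true|exists false]; auto.
  - apply cov_bigcup; [apply emb_TlTl| |intros [] _; auto].
    apply cov_of_emb. eapply emb_trans; [|apply emb_nat_Tl].
    exists (fun b : bool => if b then 0 else 1). intros [] []; congruence.
Qed.

(** Regularity: if [A] were unbounded, [Kl (S l)] would be a union of [Tl l] many initial segments,
    each covered by [Tl l]. *)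
Lemma Kl_bounded l (A : Kl (S l) -> Prop) : cov (Tl l) A -> exists x, forall y, A y -> klt y x.
Proof.
  intro HA. apply NNPP. intro N. apply (Kl_not_cov (l := l)).
  apply cov_sub with (fun x => exists y, A y /\ (klt x y \/ x = y)).
  - intros x _. apply NNPP. intro N'. apply N. exists x. intros y Ay.
    destruct (wo_total (kwo (S l)) x y) as [L|[L|L]]; auto; exfalso; eauto.
  - apply cov_bigcup; auto. apply emb_TlTl. intros y _. apply cov_union. apply seg_cov. apply cov_sing.
Qed.

Lemma Kl_unbounded l (x : Kl l) : exists y, klt x y.
Proof.
  destruct l as [|l]. exists (S x). unfold klt, Nat.lt. lia.
  destruct (Kl_bounded (cov_sing l x)) as [y Hy]. eauto.
Qed.

Lemma Kl_inhabited l : inhabited (Kl l).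
Proof.
  destruct l as [|l]. exact (inhabits 0). apply NNPP. intro N. apply (Kl_not_cov (l := l)).
  exists (fun _ _ => False). split; [intros ? ? ? []|]. intro x. destruct (N (inhabits x)).
Qed.

(** * Hechler's forcing along a well-founded order *)

(* A condition assigns to finitely many [a : Q] a stem, approximating the
   generic sequence at [a], and a list of promises.  A promise is a name for a
   function on the naturals, to be dominated by the numerical part of the
   sequence at [a]: [v n] lists conditions, each with the value that it gives to
   the function at [n]. *)
Inductive raw (Q S I : Type) : Type :=
| Raw (c : Q -> option (list (nat * S) * list (nat -> I -> option (raw Q S I * nat)))).

Section Hechler.
Context {Q S I : Type} {qlt : Q -> Q -> Prop}.
Hypothesis qwf : well_founded qlt.
Hypothesis qtrans : forall a b c, qlt a b -> qlt b c -> qlt a c.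

Notation raw := (raw Q S I).
Definition hname : Type := nat -> I -> option (raw * nat).
Definition at_ (p : raw) : Q -> option (list (nat * S) * list hname) := match p with Raw c => c end.

Definition fin (p : raw) := exists l, forall a, at_ p a <> None -> In a l.

Section Promises.
Variable R : raw -> raw -> Prop.

(* [r] decides that the name [v] is at most [m] at [n]. *)
Definition bnd (r : raw) (v : hname) (n m : nat) :=
  forall i c j, v n i = Some (c, j) -> m < j -> ~ exists r', fin r' /\ R r' r /\ R r' c.

(* [q] forces the name [v] to be at most [m] at [n], if [v n] has a value at all. *)
Definition satb (q : raw) (v : hname) (n m : nat) :=
  forall r, fin r -> R r q -> (exists m', bnd r v n m') -> bnd r v n m.
End Promises.

Definition okF (a : Q) (rec : forall b, qlt b a -> raw -> raw -> Prop) (q p : raw) : Prop :=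
  forall s vs, at_ p a = Some (s, vs) ->
  exists t vs', at_ q a = Some (s ++ t, vs') /\ incl vs vs' /\
    forall n m x v, In v vs -> length s <= n -> nth_error (s ++ t) n = Some (m, x) ->
      satb (fun r r' => forall b (L : qlt b a), rec b L r r') q v n m.

(* [ok a q p]: at the coordinate [a] the condition [q] extends [p] and keeps the
   promises of [p]; what [q] forces about a promise at [a] is computed from the
   order below [a]. *)
Definition ok : Q -> raw -> raw -> Prop := Fix qwf (fun _ => raw -> raw -> Prop) okF.

Definition lebel (a : Q) (r r' : raw) := forall b, qlt b a -> ok b r r'.
Definition hle (q p : raw) := forall a, ok a q p.

Lemma ok_iff a q p : ok a q p <->
  forall s vs, at_ p a = Some (s, vs) ->
  exists t vs', at_ q a = Some (s ++ t, vs') /\ incl vs vs' /\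
    forall n m x v, In v vs -> length s <= n -> nth_error (s ++ t) n = Some (m, x) ->
      satb (lebel a) q v n m.
Proof.
  unfold ok at 1. rewrite Fix_eq. reflexivity.
  intros x f g H. replace g with f; auto.
  apply functional_extensionality_dep. intro b. apply functional_extensionality_dep. auto.
Qed.

Lemma ok_same a q p : at_ q a = at_ p a -> ok a q p.
Proof.
  intro E. apply ok_iff. intros s vs H. exists [], vs. rewrite app_nil_r.
  split. congruence. split. apply incl_refl.
  intros n m x v _ L N. assert (K : nth_error s n <> None) by congruence.
  apply nth_error_Some in K. lia.
Qed.

Lemma ok_refl a p : ok a p p.
Proof. apply ok_same. reflexivity. Qed.

Lemma ok_loc_r a q p p' : at_ p a = at_ p' a -> ok a q p -> ok a q p'.
Proof. rewrite !ok_iff. intros E H s vs K. apply H. congruence. Qed.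

Lemma satb_loc a q q' v n m : (forall b, qlt b a -> at_ q b = at_ q' b) ->
  satb (lebel a) q v n m -> satb (lebel a) q' v n m.
Proof.
  intros E H r Fr Hr. apply H; auto. intros b L. eapply ok_loc_r; [|apply Hr; auto].
  symmetry. auto.
Qed.

Lemma ok_loc_l a q q' p : at_ q a = at_ q' a -> (forall b, qlt b a -> at_ q b = at_ q' b) ->
  ok a q p -> ok a q' p.
Proof.
  rewrite !ok_iff. intros E E' H s vs K. destruct (H s vs K) as (t & vs' & H1 & H2 & H3).
  exists t, vs'. split. congruence. split; auto.
  intros n m x v Hv Hn Hs. eapply satb_loc; eauto.
Qed.

(** An entry of [r] beyond the stem of [q] respects the promises of [p] because [q] has inherited
    them. An entry already in [q] was checked against [q], and the check passes on to [r] by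
    transitivity below [a], the induction hypothesis. *)
Lemma ok_trans a : forall p q r, (forall b, qlt b a -> ok b r q) -> ok a r q ->
  (forall b, qlt b a -> ok b q p) -> ok a q p -> ok a r p.
Proof.
  induction a as [a IH] using (well_founded_ind qwf). intros p q r Hb Ha Kb Ka.
  assert (T : forall p q r, lebel a r q -> lebel a q p -> lebel a r p).
  { intros p' q' r' H1 H2 b L. apply (IH b L p' q' r'); eauto. }
  rewrite ok_iff in *. intros s vs H. destruct (Ka s vs H) as (t & vs' & H1 & H2 & H3).
  destruct (Ha _ _ H1) as (t' & vs'' & H4 & H5 & H6).
  exists (t ++ t'), vs''. rewrite app_assoc. split; auto. split. eapply incl_tran; eauto.
  intros n m x v Hv Hn Hs. destruct (le_lt_dec (length (s ++ t)) n) as [L|L].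
  - eapply H6; eauto.
  - rewrite nth_error_app1 in Hs by auto. intros r' Fr Hr Hm.
    apply (H3 n m x v Hv Hn Hs r' Fr); auto. eapply T; eauto.
Qed.

Lemma lebel_trans a p q r : lebel a r q -> lebel a q p -> lebel a r p.
Proof. intros H K b L. apply ok_trans with q; auto; intros c Lc; [apply H|apply K]; eauto. Qed.

Lemma hle_trans p q r : hle r q -> hle q p -> hle r p.
Proof. intros H K a. apply ok_trans with q; auto. Qed.

Lemma hle_refl p : hle p p.
Proof. intro a. apply ok_refl. Qed.

Lemma bnd_mono a r r' v n m : lebel a r' r -> bnd (lebel a) r v n m -> bnd (lebel a) r' v n m.
Proof.
  intros L H i c j Hi Hj (u & Fu & H1 & H2). apply (H i c j Hi Hj).
  exists u. split; [|split]; auto. eapply lebel_trans; [exact H1|exact L].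
Qed.

Lemma bnd_le a r v n m m' : m <= m' -> bnd (lebel a) r v n m -> bnd (lebel a) r v n m'.
Proof. intros L H i c j Hi Hj. apply (H i c j Hi). lia. Qed.

Lemma satb_mono a r r' v n m : lebel a r' r -> satb (lebel a) r v n m -> satb (lebel a) r' v n m.
Proof. intros L H u Fu Hu. apply H; auto. eapply lebel_trans; eauto. Qed.

Lemma hle_stem q p a s vs : hle q p -> at_ p a = Some (s, vs) ->
  exists t vs', at_ q a = Some (s ++ t, vs') /\ incl vs vs'.
Proof. intros H E. specialize (H a). rewrite ok_iff in H. destruct (H s vs E) as (t & vs' & ? & ? & _). eauto. Qed.

Definition mrg (A : Q -> Prop) (r q : raw) : raw :=
  Raw (fun b => if excluded_middle_informative (A b) then at_ r b else at_ q b).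

Lemma mrg_in A r q b : A b -> at_ (mrg A r q) b = at_ r b.
Proof. intro H. simpl. destruct excluded_middle_informative; tauto. Qed.

Lemma mrg_out A r q b : ~ A b -> at_ (mrg A r q) b = at_ q b.
Proof. intro H. simpl. destruct excluded_middle_informative; tauto. Qed.

Lemma mrg_fin A r q : fin r -> fin q -> fin (mrg A r q).
Proof.
  intros [l Hl] [k Hk]. exists (l ++ k). intros a. simpl. intro H. apply in_or_app.
  destruct excluded_middle_informative; auto.
Qed.

Lemma mrg_ok_in (A : Q -> Prop) r q b : (forall b c, A b -> qlt c b -> A c) -> A b -> ok b (mrg A r q) r.
Proof.
  intros HA Hb. apply ok_same. apply mrg_in, Hb.
Qed.

(** The order at a coordinate depends on the extending condition only at and below that coordinate,
    so [r] may replace [q] on a downward closed set. *)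
Lemma mrg_le (A : Q -> Prop) r q : (forall b c, A b -> qlt c b -> A c) -> (forall b, A b -> ok b r q) ->
  hle (mrg A r q) q.
Proof.
  intros HA H b. destruct (classic (A b)) as [Hb|Hb].
  - apply ok_loc_l with r; auto.
    + symmetry. apply mrg_in, Hb.
    + intros c L. symmetry. apply mrg_in. eauto.
  - apply ok_same, mrg_out, Hb.
Qed.

Definition join (p q : raw) : raw := Raw (fun a =>
  match at_ p a, at_ q a with
  | Some (s, vs), Some (_, vs') => Some (s, vs ++ vs')
  | Some x, None => Some x
  | None, y => y
  end).

Definition stem (p : raw) (a : Q) : option (list (nat * S)) := option_map fst (at_ p a).

Lemma join_fin p q : fin p -> fin q -> fin (join p q).
Proof.
  intros [l Hl] [k Hk]. exists (l ++ k). intros a H. apply in_or_app.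
  destruct (at_ p a) eqn:Ep. left. apply Hl. congruence.
  right. apply Hk. simpl in H. rewrite Ep in H. auto.
Qed.

Lemma ok_stem a q p s vs vs' : at_ p a = Some (s, vs) -> at_ q a = Some (s, vs') -> incl vs vs' -> ok a q p.
Proof.
  intros Ep Eq Hi. apply ok_iff. intros s0 vs0 E. rewrite Ep in E. injection E as <- <-.
  exists [], vs'. rewrite app_nil_r. split; auto. split; auto.
  intros n m x v _ L N. assert (K : nth_error s n <> None) by congruence.
  apply nth_error_Some in K. lia.
Qed.

(** No stem becomes longer, so there is no new entry at which a promise would have to be checked. *)
Lemma join_le p q : (forall a s t, stem p a = Some s -> stem q a = Some t -> s = t) ->
  hle (join p q) p /\ hle (join p q) q.
Proof.
  unfold stem. intro H. split; intro a; specialize (H a); destruct (at_ p a) as [[s vs]|] eqn:Ep;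
    destruct (at_ q a) as [[t vs']|] eqn:Eq; simpl in H;
    try (specialize (H s t eq_refl eq_refl); subst t);
    try (apply ok_same; simpl; rewrite ?Ep, ?Eq; reflexivity).
  - eapply ok_stem; eauto. simpl. rewrite Ep, Eq. reflexivity. apply incl_appl, incl_refl.
  - eapply ok_iff. intros s vs E. congruence.
  - eapply ok_stem; eauto. simpl. rewrite Ep, Eq. reflexivity. apply incl_appr, incl_refl.
  - apply ok_iff. intros s' vs' E. congruence.
Qed.

Definition upd (p : raw) (a : Q) (x : list (nat * S) * list hname) : raw :=
  Raw (fun b => if excluded_middle_informative (b = a) then Some x else at_ p b).

Lemma upd_eq p a x : at_ (upd p a x) a = Some x.
Proof. simpl. destruct excluded_middle_informative; congruence. Qed.

Lemma upd_ne p a x b : b <> a -> at_ (upd p a x) b = at_ p b.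
Proof. intro. simpl. destruct excluded_middle_informative; congruence. Qed.

Lemma upd_fin p a x : fin p -> fin (upd p a x).
Proof.
  intros [l Hl]. exists (a :: l). intros b H.
  destruct (classic (b = a)) as [->|N]. left. auto. right. apply Hl. rewrite upd_ne in H; auto.
Qed.

Lemma upd_le p a x : ok a (upd p a x) p -> hle (upd p a x) p.
Proof.
  intros H b. destruct (classic (b = a)) as [->|N]; auto. apply ok_same, upd_ne, N.
Qed.

Lemma upd_le_new p a x : at_ p a = None -> hle (upd p a x) p.
Proof. intro H. apply upd_le. apply ok_iff. intros s vs E. congruence. Qed.

Lemma upd_le_promise p a s vs v : at_ p a = Some (s, vs) -> hle (upd p a (s, v :: vs)) p.
Proof.
  intro H. apply upd_le. eapply ok_stem. exact H. apply upd_eq. apply incl_tl, incl_refl.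
Qed.

Lemma qirrefl a : ~ qlt a a.
Proof. induction a as [a IH] using (well_founded_ind qwf). intro H. exact (IH a H H). Qed.

(** After extending below [a], each promise is either bounded at [n], or can be bounded by no
    further extension and then [satb] holds vacuously. Thus promises that are not names of total
    functions never block the lengthening of a stem. *)
Lemma decide_names a n vs : forall q, fin q -> exists r m, fin r /\ hle r q /\
  (forall b, ~ qlt b a -> at_ r b = at_ q b) /\
  forall v m', In v vs -> m <= m' -> satb (lebel a) r v n m'.
Proof.
  induction vs as [|v vs IH]; intros q Fq.
  - exists q, 0. repeat split; auto. apply hle_refl. intros v m' [].
  - destruct (IH q Fq) as (r & m & Fr & Hr & Er & Hm).
    destruct (classic (exists r0 m0, fin r0 /\ lebel a r0 r /\ bnd (lebel a) r0 v n m0)) as [(r0 & m0 & F0 & L0 & B0)|N].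
    + assert (D : forall b c, qlt b a -> qlt c b -> qlt c a) by eauto.
      exists (mrg (fun b => qlt b a) r0 r), (max m m0).
      assert (Lr : hle (mrg (fun b => qlt b a) r0 r) r) by (apply mrg_le; auto).
      split; [|split; [|split]].
      * apply mrg_fin; auto.
      * eapply hle_trans; eauto.
      * intros b Hb. rewrite mrg_out; auto.
      * intros w m' [<-|Hw] L.
        -- intros u Fu Hu _. apply bnd_le with m0. lia. eapply bnd_mono; [|exact B0].
           eapply lebel_trans. exact Hu. intros b Lb. eapply mrg_ok_in; eauto.
        -- eapply satb_mono. intros b _. apply Lr. apply Hm; auto. lia.
    + exists r, m. repeat split; auto. intros w m' [<-|Hw] L; auto.
      intros u Fu Hu [m1 B1]. exfalso. apply N. eauto.
Qed.

Lemma extend_stem q a s vs N x : fin q -> at_ q a = Some (s, vs) ->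
  exists r m, fin r /\ hle r q /\ N <= m /\ at_ r a = Some (s ++ [(m, x)], vs) /\
    forall b, b <> a -> ~ qlt b a -> at_ r b = at_ q b.
Proof.
  intros Fq Eq. destruct (decide_names a (length s) vs Fq) as (r0 & m0 & F0 & H0 & E0 & B0).
  (* [m0] respects all the promises made at [a]; taking the maximum with [N] makes the new entry as
     large as required. *)
  exists (upd r0 a (s ++ [(max m0 N, x)], vs)), (max m0 N).
  assert (Ea : at_ r0 a = Some (s, vs)) by (rewrite E0; auto using qirrefl).
  split; [|split; [|split; [|split]]].
  - apply upd_fin, F0.
  - eapply hle_trans; [|exact H0]. apply upd_le. apply ok_iff. intros s' vs' E.
    rewrite Ea in E. injection E as <- <-. exists [(max m0 N, x)], vs.
    split. apply upd_eq. split. apply incl_refl.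
    intros n m y v Hv Ln Hn. assert (n = length s).
    { assert (K : nth_error (s ++ [(max m0 N, x)]) n <> None) by congruence.
      apply nth_error_Some in K. rewrite length_app in K. simpl in K. lia. }
    subst n. rewrite nth_error_app2, Nat.sub_diag in Hn by lia. simpl in Hn. injection Hn as <- <-.
    apply satb_loc with r0. intros b L. symmetry. apply upd_ne. intros ->. eapply qirrefl; eauto.
    apply B0; auto. lia.
  - lia.
  - apply upd_eq.
  - intros b Nb Lb. rewrite upd_ne by auto. auto.
Qed.

Lemma extend_stem_to q a n (x0 : S) : fin q -> exists r s vs, fin r /\ hle r q /\ at_ r a = Some (s, vs) /\
  n <= length s /\ forall b, b <> a -> ~ qlt b a -> at_ r b = at_ q b.
Proof.
  intro Fq. induction n as [|n (r & s & vs & Fr & Hr & Er & Ln & Eb)].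
  - destruct (at_ q a) as [[s vs]|] eqn:E.
    + exists q, s, vs. repeat split; auto. apply hle_refl. lia.
    + exists (upd q a ([], [])), [], []. split; [|split; [|split; [|split]]].
      * apply upd_fin, Fq.
      * apply upd_le_new, E.
      * apply upd_eq.
      * auto.
      * intros. apply upd_ne; auto.
  - destruct (extend_stem a 0 x0 Fr Er) as (r' & m & Fr' & Hr' & _ & Er' & Eb').
    exists r', (s ++ [(m, x0)]), vs. rewrite length_app. simpl. repeat split; auto. eapply hle_trans; eauto. lia.
    intros b N L. rewrite Eb', Eb; auto.
Qed.

Lemma promise_kept h h' b s vs v s' vs' n m x : fin h' -> hle h' h ->
  at_ h b = Some (s, vs) -> In v vs -> length s <= n ->
  at_ h' b = Some (s', vs') -> nth_error s' n = Some (m, x) ->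
  (exists m', bnd (lebel b) h' v n m') -> bnd (lebel b) h' v n m.
Proof.
  intros F H E Hv Ln E' Hn Hm. assert (K := H b). rewrite ok_iff in K.
  destruct (K s vs E) as (t & vs'' & E1 & _ & Hs). rewrite E' in E1. injection E1 as -> ->.
  apply (Hs n m x v Hv Ln Hn h' F); auto. intros c _. apply ok_refl.
Qed.

(** Promises at [b] test compatibility only below [b]. For a condition [c] supported below [b] this
    is true compatibility: put the common extension [r] in place of [h] below [b] and keep [h]
    elsewhere. *)
Lemma incompatible_below h c b : fin h -> (forall a, at_ c a <> None -> qlt a b) ->
  (exists r, fin r /\ lebel b r h /\ lebel b r c) -> exists r, fin r /\ hle r h /\ hle r c.
Proof.
  intros Fh Hc (r & Fr & H1 & H2). exists (mrg (fun a => qlt a b) r h).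
  assert (D : forall a a', qlt a b -> qlt a' a -> qlt a' b) by eauto.
  split. apply mrg_fin; auto. split. apply mrg_le; auto.
  intro a. destruct (classic (qlt a b)) as [L|L].
  - apply ok_loc_l with r; auto.
    + symmetry. apply mrg_in; auto.
    + intros a' L'. symmetry. apply mrg_in. eauto.
  - apply ok_iff. intros s vs E. exfalso. apply L, Hc. congruence.
Qed.
End Hechler.

(** * The forcing notion *)

Class params := { pk : nat; pn : nat; pk_pos : 1 <= pk; pk_le : pk <= pn }.

Section Conditions.
Context {pp : params}.

Definition Q : Type := (Kl pk * Kl pn)%type.
Definition kle {l} (x y : Kl l) := klt x y \/ x = y.
Definition qle (a b : Q) := kle (fst a) (fst b) /\ kle (snd a) (snd b).
Definition qlt (a b : Q) := qle a b /\ a <> b.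

Lemma kle_trans l (x y z : Kl l) : kle x y -> kle y z -> kle x z.
Proof.
  intros [H| ->] [K| ->]; unfold kle; auto. left. eapply wo_trans; eauto. apply kwo.
Qed.

Lemma kle_antisym l (x y : Kl l) : kle x y -> kle y x -> x = y.
Proof.
  intros [H| ->] [K|E]; auto. exfalso. apply (wo_irrefl (kwo l)) with x.
  eapply wo_trans; eauto. apply kwo.
Qed.

Lemma qle_trans a b c : qle a b -> qle b c -> qle a c.
Proof. intros [] []. split; eapply kle_trans; eauto. Qed.

Lemma qle_antisym a b : qle a b -> qle b a -> a = b.
Proof. destruct a, b. intros [] []. simpl in *. f_equal; apply kle_antisym; auto. Qed.

Lemma qlt_trans a b c : qlt a b -> qlt b c -> qlt a c.
Proof.
  intros [H1 N1] [H2 N2]. split. eapply qle_trans; eauto. intros ->.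
  apply N2, qle_antisym; auto.
Qed.

Lemma qlt_wf : well_founded qlt.
Proof.
  intros [x y]. revert y. induction x as [x IHx] using (well_founded_ind (wo_wf (kwo pk))).
  intro y. induction y as [y IHy] using (well_founded_ind (wo_wf (kwo pn))).
  constructor. intros [x' y'] [[[H|H] [K|K]] N]; simpl in *; subst; auto. congruence.
Qed.

Definition stems : Type := list (nat * Tl 0).
(** The names of promises are listed along two kinds of indices: [Tl 0] for names read off a family
    of conditions given by [easton], and stems for the generic sequence at a lower coordinate. The
    labels in [Tl 0] serve to collapse [Tl 0]. *)
Definition HC : Type := raw Q (Tl 0) (Tl 0 + stems).

(* [names R l] contains all the names that two distinct generic functions of
   level [l] must not share: a set of this size is too small for [Lam l]. *)
Definition names (R : Type) (l : nat) : Type :=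
  ((Kl (S l) * (Kl (S l) -> bool -> R -> Prop)) + (nat -> bool -> R -> Prop))%type.
(** The power set beats the number of names by Cantor's theorem; the factor [Tl pn] makes some fibre
    of a map into the names too large for an antichain. *)
Definition lamOf (R : Type) (l : nat) : Type := (names R l * Tl pn -> Prop)%type.
(** Room for the parts of conditions below level [l]. It comes before [cond] because the index type
    of level [l] is built from it. *)
Fixpoint RT (l : nat) : Type :=
  match l with
  | 0 => HC
  | S l => (RT l * (lamOf (RT l) l * Kl (S l) -> option (Tl (S l))))%type
  end.
Definition Lam (l : nat) : Type := lamOf (RT l) l.

(** If every fibre were covered by [Tl pn], then [Lam l] would be covered by
    [names (RT l) l * Tl pn], of which it is the power set. *)
Lemma pigeonhole l (f : Lam l -> names (RT l) l) :
  exists v, ~ cov (Tl pn) (fun xi => f xi = v).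
Proof.
  apply NNPP. intro N. apply (@cantor (names (RT l) l * Tl pn)).
  assert (H : forall v, exists R : Tl pn -> Lam l -> Prop,
    (forall t x y, R t x -> R t y -> x = y) /\ forall x, f x = v -> exists t, R t x).
  { intro v. apply NNPP. intro K. apply N. exists v. exact K. }
  apply choice in H as [R HR].
  exists (fun vt xi => R (fst vt) (snd vt) xi). split.
  - intros [v t] x y. apply HR.
  - intros xi _. destruct (proj2 (HR (f xi)) xi eq_refl) as [t Ht]. exists (f xi, t). exact Ht.
Qed.

Lemma Lam_inhabited l : Lam l.
Proof. exact (fun _ => True). Qed.

Record cond := {
  ch : HC;
  cp : forall l, Lam l -> Kl (S l) -> option (Tl (S l));
  ch_fin : fin ch;
  cp_small : forall l, cov (Tl l) (fun y => @cp l (fst y) (snd y) <> None);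
  cp_bound : forall l xi x, pn <= l -> @cp l xi x = None }.
Arguments cp c l xi x : clear implicits.

Definition hleq (q p : HC) := hle qlt_wf q p.

Definition lev_le l (q p : cond) := forall xi x t, cp p l xi x = Some t -> cp q l xi x = Some t.
(** The order of the lower factor, which contains Hechler's forcing; [hile] is that of the upper
    factor. Both are relations on whole conditions, so no product of posets has to be split. *)
Definition lole m (q p : cond) := hleq (ch q) (ch p) /\ forall l, l < m -> lev_le l q p.
Definition hile m (q p : cond) := forall l, m <= l -> lev_le l q p.
Definition cle (q p : cond) := hleq (ch q) (ch p) /\ forall l, lev_le l q p.

Lemma hleq_trans p q r : hleq p q -> hleq q r -> hleq p r.
Proof. intros. eapply hle_trans; eauto. exact qlt_trans. Qed.

Lemma hleq_refl p : hleq p p.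
Proof. apply hle_refl. Qed.

#[global] Instance cond_poset : poset cond.
Proof.
  refine {| ple := cle |}.
  - intro p. split. apply hleq_refl. intros l xi x t. auto.
  - intros p q r [H1 H2] [K1 K2]. split. eapply hleq_trans; eauto.
    intros l xi x t H. apply H2, K2, H.
Defined.

Lemma cle_iff m (q p : cond) : q ≼ p <-> lole m q p /\ hile m q p.
Proof.
  split.
  - intros [H1 H2]. split; [split|]; auto. intros l _. auto.
  - intros [[H1 H2] H3]. split; auto. intro l. destruct (le_lt_dec m l); auto.
Qed.

Lemma lole_trans m p q r : lole m p q -> lole m q r -> lole m p r.
Proof.
  intros [H1 H2] [K1 K2]. split. eapply hleq_trans; eauto.
  intros l L xi x t H. apply H2, K2; auto.
Qed.

Lemma hile_trans m p q r : hile m p q -> hile m q r -> hile m p r.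
Proof. intros H K l L xi x t E. apply H, K; auto. Qed.

Lemma lole_refl m p : lole m p p.
Proof. split. apply hleq_refl. intros l _ xi x t. auto. Qed.

Lemma hile_refl m p : hile m p p.
Proof. intros l _ xi x t. auto. Qed.

Lemma build (h : HC) (G : forall l, Lam l -> Kl (S l) -> Tl (S l) -> Prop) : fin h ->
  (forall l xi x t t', @G l xi x t -> @G l xi x t' -> t = t') ->
  (forall l, cov (Tl l) (fun y => exists t, @G l (fst y) (snd y) t)) ->
  (forall l xi x t, @G l xi x t -> l < pn) ->
  exists p, ch p = h /\ forall l xi x t, cp p l xi x = Some t <-> @G l xi x t.
Proof.
  intros Fh F C B.
  pose (c := fun l xi x => match excluded_middle_informative (exists t, @G l xi x t) with
    | left H => Some (proj1_sig (constructive_indefinite_description _ H))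
    | right _ => None end).
  assert (Hc : forall l xi x t, c l xi x = Some t <-> G l xi x t).
  { intros l xi x t. unfold c. destruct excluded_middle_informative as [H|H].
    - destruct constructive_indefinite_description as [t' Ht']. simpl. split.
      + intro E. injection E as <-. auto.
      + intro K. f_equal. eauto.
    - split. congruence. intro K. exfalso. eauto. }
  assert (S : forall l, cov (Tl l) (fun y => c l (fst y) (snd y) <> None)).
  { intro l. apply cov_sub with (2 := C l). intros [xi x] H. simpl in *.
    destruct (c l xi x) as [t|] eqn:E; [|congruence]. apply Hc in E. eauto. }
  assert (N : forall l xi x, pn <= l -> c l xi x = None).
  { intros l xi x L. destruct (c l xi x) as [t|] eqn:E; auto. apply Hc, B in E. lia. }
  exists (Build_cond c Fh S N). auto.
Qed.

Lemma cov_support l p : cov (Tl l) (fun y => exists t, cp p l (fst y) (snd y) = Some t).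
Proof.
  apply cov_sub with (2 := cp_small p l). intros y [t H]. congruence.
Qed.

Lemma cp_lt p l xi x t : cp p l xi x = Some t -> l < pn.
Proof.
  intro H. destruct (le_lt_dec pn l) as [L|]; auto. rewrite cp_bound in H; [discriminate|auto].
Qed.

(** Packing the level with the data allows a graph given at one level [l0] to be compared with
    entries at an arbitrary level without transport along equalities. *)
Definition sig_lev l (xi : Lam l) (x : Kl (S l)) (t : Tl (S l)) :
  {l : nat & (Lam l * Kl (S l) * Tl (S l))%type} := existT _ l (xi, x, t).
Arguments sig_lev l xi x t : clear implicits.

Lemma sig_lev_inj l xi x t xi' x' t' : sig_lev l xi x t = sig_lev l xi' x' t' ->
  xi = xi' /\ x = x' /\ t = t'.
Proof.
  intro H. apply inj_pair2_eq_dec in H; [|apply Nat.eq_dec]. injection H. auto.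
Qed.

Lemma sig_lev_lev l xi x t l' xi' x' t' : sig_lev l xi x t = sig_lev l' xi' x' t' -> l = l'.
Proof. intro H. exact (f_equal (@projT1 _ _) H). Qed.

Lemma extend_level p l0 (G : Lam l0 -> Kl (S l0) -> Tl (S l0) -> Prop) : l0 < pn ->
  (forall xi x t t', G xi x t -> G xi x t' -> t = t') ->
  cov (Tl l0) (fun y => exists t, G (fst y) (snd y) t) ->
  exists q, q ≼ p /\ ch q = ch p /\
    (forall l, l <> l0 -> lev_le l p q) /\
    forall xi x t, cp q l0 xi x = Some t <->
      cp p l0 xi x = Some t \/ (cp p l0 xi x = None /\ G xi x t).
Proof.
  intros L F C.
  destruct (@build (ch p) (fun l xi x t => cp p l xi x = Some t \/
    (cp p l xi x = None /\ exists xi0 x0 t0, G xi0 x0 t0 /\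
      sig_lev l xi x t = sig_lev l0 xi0 x0 t0))) as (q & Hq1 & Hq2).
  - apply ch_fin.
  - intros l xi x t t' [H|[H (a & b & c & K1 & K2)]] [H'|[H' (a' & b' & c' & K1' & K2')]]; try congruence.
    assert (l = l0) by (apply sig_lev_lev in K2; auto). subst l.
    apply sig_lev_inj in K2 as (-> & -> & ->). apply sig_lev_inj in K2' as (-> & -> & ->). eauto.
  - intro l. apply cov_sub with (fun y => (exists t, cp p l (fst y) (snd y) = Some t) \/
      (exists t xi0 x0 t0, G xi0 x0 t0 /\ sig_lev l (fst y) (snd y) t = sig_lev l0 xi0 x0 t0)).
    + intros y (t & [H|[_ H]]); eauto.
    + apply cov_union. apply cov_support.
      destruct (Nat.eq_dec l l0) as [->|N].
      * apply cov_sub with (2 := C). intros y (t & a & b & c & K1 & K2).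
        apply sig_lev_inj in K2 as (-> & -> & ->). eauto.
      * apply cov_sub with (2 := cov_support l p). intros y (t & a & b & c & K1 & K2).
        apply sig_lev_lev in K2. contradiction.
  - intros l xi x t [H|[_ (a & b & c & _ & H)]]. eapply cp_lt; eauto.
    apply sig_lev_lev in H. lia.
  - exists q. split; [split|split; [|split]].
    + rewrite Hq1. apply hleq_refl.
    + intros l xi x t H. apply Hq2. auto.
    + auto.
    + intros l N xi x t H. apply Hq2 in H as [H|[_ (a & b & c & _ & H)]]; auto.
      apply sig_lev_lev in H. contradiction.
    + intros xi x t. rewrite Hq2. split; intros [H|[H K]]; auto; right; split; auto.
      * destruct K as (a & b & c & K1 & K2). apply sig_lev_inj in K2 as (-> & -> & ->). auto.
      * eauto.
Qed.

Definition comb (m : nat) (r s : cond) : cond.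
Proof.
  refine {| ch := ch r; cp := fun l => if lt_dec l m then cp r l else cp s l |}.
  - apply ch_fin.
  - intro l. destruct (lt_dec l m); apply cp_small.
  - intros l xi x L. destruct (lt_dec l m); apply cp_bound; auto.
Defined.

Lemma comb_lo m r s : lole m (comb m r s) r /\ lole m r (comb m r s).
Proof.
  split; (split; [apply hleq_refl|]); intros l L xi x t; simpl; destruct (lt_dec l m); auto; lia.
Qed.

Lemma comb_hi m r s : hile m (comb m r s) s /\ hile m s (comb m r s).
Proof.
  split; intros l L xi x t; simpl; destruct (lt_dec l m); auto; lia.
Qed.

Lemma comb_le m r s p : lole m r p -> hile m s p -> comb m r s ≼ p.
Proof.
  intros H K. apply (cle_iff m). split.
  - eapply lole_trans; [exact (proj1 (comb_lo m r s))|exact H].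
  - eapply hile_trans; [exact (proj1 (comb_hi m r s))|exact K].
Qed.

Lemma le_comb m r s p : lole m p r -> hile m p s -> p ≼ comb m r s.
Proof.
  intros H K. apply (cle_iff m). split.
  - eapply lole_trans; [exact H|exact (proj2 (comb_lo m r s))].
  - eapply hile_trans; [exact K|exact (proj2 (comb_hi m r s))].
Qed.

Lemma le_lole m q p : q ≼ p -> lole m q p.
Proof. intro H. apply (cle_iff m) in H. tauto. Qed.

Lemma le_hile m q p : q ≼ p -> hile m q p.
Proof. intro H. apply (cle_iff m) in H. tauto. Qed.

Definition agree l (c c' : cond) :=
  forall xi x t t', cp c l xi x = Some t -> cp c' l xi x = Some t' -> t = t'.

(** Closure of the upper factor: for [l] at least [m], a union of [Tl m] many supports covered by
    [Tl l] is still covered by [Tl l]. *)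
Lemma hi_union m (p0 : cond) (F : cond -> Prop) : m <= pn -> cov (Tl m) F ->
  (forall c c' l, m <= l -> F c -> F c' -> agree l c c') ->
  exists p, ch p = ch p0 /\
    (forall l xi x t, l < m -> cp p l xi x = Some t <-> cp p0 l xi x = Some t) /\
    (forall l xi x t, m <= l -> cp p l xi x = Some t <-> exists c, F c /\ cp c l xi x = Some t).
Proof.
  intros Hm C A.
  destruct (@build (ch p0) (fun l xi x t => (l < m /\ cp p0 l xi x = Some t) \/
    (m <= l /\ exists c, F c /\ cp c l xi x = Some t))) as (p & H1 & H2).
  - apply ch_fin.
  - intros l xi x t t' [[L H]|[L (c & Fc & H)]] [[L' H']|[L' (c' & Fc' & H')]]; try lia.
    congruence. exact (A c c' l L Fc Fc' xi x t t' H H').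
  - intro l. destruct (le_lt_dec m l) as [L|L].
    + apply cov_sub with (fun y => exists c, F c /\ exists t, cp c l (fst y) (snd y) = Some t).
      * intros y (t & [[L' _]|[_ (c & H)]]). lia. destruct H. eauto.
      * apply cov_bigcup. apply emb_TlTl. eapply cov_emb; [|exact C]. apply emb_Tl, L.
        intros c _. apply cov_support.
    + apply cov_sub with (2 := cov_support l p0). intros y (t & [[_ H]|[L' _]]). eauto. lia.
  - intros l xi x t [[_ H]|[_ (c & _ & H)]]; eapply cp_lt; eauto.
  - exists p. split; auto. split; intros l xi x t L; rewrite H2.
    + split. intros [[_ H]|[L' _]]; auto; lia. auto.
    + split. intros [[L' H]|[_ H]]; auto; lia. auto.
Qed.

Definition locompat m (a b : cond) := exists q, lole m q a /\ lole m q b.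

Lemma agree_locompat m a b :
  (forall z s t, stem (ch a) z = Some s -> stem (ch b) z = Some t -> s = t) ->
  (forall l, l < m -> agree l a b) -> locompat m a b.
Proof.
  intros Hs Ha. destruct (join_le qlt_wf _ _ Hs) as [J1 J2].
  destruct (@build (join (ch a) (ch b)) (fun l xi x t =>
     l < m /\ (cp a l xi x = Some t \/ cp b l xi x = Some t))) as (q & H1 & H2).
  - apply join_fin; apply ch_fin.
  - intros l xi x t t' [L [H|H]] [_ [H'|H']]; try congruence.
    eapply Ha; eauto. symmetry. eapply Ha; eauto.
  - intro l. apply cov_sub with (fun y => (exists t, cp a l (fst y) (snd y) = Some t) \/
      (exists t, cp b l (fst y) (snd y) = Some t)).
    + intros y (t & _ & [H|H]); eauto.
    + apply cov_union; apply cov_support.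
  - intros l xi x t [_ [H|H]]; eapply cp_lt; eauto.
  - exists q. unfold lole. rewrite H1. split; (split; [auto|]); intros l L xi x t H; apply H2; auto.
Qed.

Lemma emb_list0 : emb stems (Tl 0).
Proof. apply (emb_list (xl0 0)), (emb_prod (xl0 0)). apply emb_nat_Tl. apply emb_refl. Qed.

Definition tr_val m l (L : l < m) : Tl (S l) -> Tl m :=
  proj1_sig (constructive_indefinite_description _ (emb_Tl L)).

Lemma tr_val_inj m l (L : l < m) : injective (tr_val L).
Proof. unfold tr_val. destruct constructive_indefinite_description. auto. Qed.

Definition point : Type := (Q + {l : nat & (Lam l * Kl (S l))%type})%type.
(** The part below level [m] as one partial function, the shape that [antichain_cov] requires.
    Promises are left out, since conditions with agreeing stems can be joined. *)
Definition trace m (a : cond) (z : point) : option (stems + Tl m) :=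
  match z with
  | inl z => option_map inl (stem (ch a) z)
  | inr (existT l y) =>
    match lt_dec l m with
    | left L => option_map (fun t => inr (tr_val L t)) (cp a l (fst y) (snd y))
    | right _ => None
    end
  end.

Lemma trace_agree m a b :
  (forall z s t, trace m a z = Some s -> trace m b z = Some t -> s = t) -> locompat m a b.
Proof.
  intro H. apply agree_locompat.
  - intros z s t Hs Ht. specialize (H (inl z)). simpl in H. rewrite Hs, Ht in H. simpl in H.
    specialize (H _ _ eq_refl eq_refl). injection H. auto.
  - intros l L xi x t t' Ht Ht'. specialize (H (inr (existT _ l (xi, x)))). simpl in H.
    destruct (lt_dec l m) as [L'|]; [|lia]. rewrite Ht, Ht' in H. simpl in H.
    specialize (H _ _ eq_refl eq_refl). injection H as H. eapply tr_val_inj; eauto.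
Qed.

Lemma trace_cov m a : cov (El m) (fun z => trace m a z <> None).
Proof.
  pose (B := fun (i : nat) (z : point) => match i with
    | 0 => exists q, stem (ch a) q <> None /\ inl q = z
    | S l => exists y, (exists t, cp a l (fst y) (snd y) = Some t) /\ l < m /\ inr (existT _ l y) = z
    end).
  apply cov_sub with (fun z => exists i, True /\ B i z).
  { intros [q|[l [xi x]]] H; simpl in H.
    - exists 0. split; auto. exists q. split; auto. intro E. rewrite E in H. auto.
    - exists (S l). split; auto. exists (xi, x). destruct (lt_dec l m) as [L|]; [|destruct (H eq_refl)].
      simpl. destruct (cp a l xi x) as [t|] eqn:E; [|destruct (H eq_refl)]. eauto. }
  apply cov_bigcup.
  - exists (fun p => node (fst p) (snd p)). intros [x y] [x' y'] H. simpl in H. injection H as -> ->. auto.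
  - apply cov_of_emb, (emb_nat_tree (xl0 m)).
  - intros [|l] _; simpl.
    + apply cov_rel. congruence. destruct (ch_fin a) as [k Hk].
      apply cov_sub with (2 := cov_In (xl0 m) k). intros q H. apply Hk. intro E. apply H.
      unfold stem. rewrite E. auto.
    + destruct (lt_dec l m) as [L|N].
      * apply cov_rel. intros y z z' [_ <-] [_ <-]. auto.
        eapply cov_emb. apply emb_Tl_El, L. apply cov_support.
      * exists (fun _ _ => False). split; [intros ? ? ? []|]. intros z (y & _ & L & _). contradiction.
Qed.

Lemma trace_values m : emb (stems + Tl m) (Tl m).
Proof.
  destruct emb_list0 as [f Hf]. assert (Hm : emb (Tl 0) (Tl m)) by (apply emb_Tl; lia).
  destruct Hm as [g Hg].
  exists (fun v => match v with inl s => some (g (f s)) | inr t => pr (fun _ => False) t end).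
  assert (N : forall s t, some s <> pr (fun _ => False) t :> Tl m).
  { intros s t E. apply (pr_inj (xl0 m)) in E as [E _].
    assert (K := f_equal (fun h => h (leaf (xl0 m))) E). simpl in K. rewrite <- K. exact I. }
  intros [s|t] [s'|t'] E.
  - apply (some_inj (xl0 m)) in E. f_equal. auto.
  - destruct (N _ _ E).
  - symmetry in E. destruct (N _ _ E).
  - apply (pr_inj (xl0 m)) in E as [_ E]. f_equal. auto.
Qed.

Lemma antichain m (A : cond -> Prop) :
  (forall a b, A a -> A b -> a <> b -> ~ locompat m a b) -> cov (Tl m) A.
Proof.
  intro H. apply (antichain_cov (xl0 m)) with (f := trace m).
  - apply trace_values.
  - intros c _. apply trace_cov.
  - intros a b Aa Ab N. apply NNPP. intro K. apply (H a b Aa Ab N). apply trace_agree.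
    intros z s t Hs Ht. apply NNPP. intro Nst. apply K. eauto 6.
Qed.

(* Easton's lemma.  Take a maximal family of pairs [(w, c)], with [c] in [Dec w],
   such that conditions paired with the same [w] are incompatible below level [m]
   and all the conditions agree above it; it is small by [antichain], so the parts
   above [m] have a union. *)
Lemma easton m (W : Type) (Dec : W -> cond -> Prop) (p0 : cond) : m <= pn ->
  cov (Tl m) (fun _ : W => True) ->
  (forall w p q, q ≼ p -> Dec w p -> Dec w q) ->
  (forall w q, q ≼ p0 -> exists r, r ≼ q /\ Dec w r) ->
  exists p, p ≼ p0 /\ lole m p0 p /\ exists a : W -> Tl m -> cond -> Prop,
    (forall w t c c', a w t c -> a w t c' -> c = c') /\
    (forall w t c, a w t c -> Dec w (comb m c p)) /\
    forall w q, q ≼ p -> exists t c q', a w t c /\ q' ≼ q /\ q' ≼ comb m c p.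
Proof.
  intros Hm CW Dm Dd.
  destruct (@zorn_family (W * cond) (fun A =>
    (forall w c, A (w, c) -> Dec w c /\ c ≼ p0) /\
    (forall w c c', A (w, c) -> A (w, c') -> c <> c' -> ~ locompat m c c') /\
    (forall w c w' c' l, m <= l -> A (w, c) -> A (w', c') -> agree l c c'))) as (A & (A1 & A2 & A3) & Max).
  { intros F HF tot. split; [|split].
    - intros w c (A & FA & H). apply (HF A FA). auto.
    - intros w c c' (A & FA & H) (A' & FA' & H').
      destruct (tot A A' FA FA') as [K|K]; [destruct (HF A' FA') as (_ & L & _)|destruct (HF A FA) as (_ & L & _)]; eauto.
    - intros w c w' c' l Ll (A & FA & H) (A' & FA' & H').
      destruct (tot A A' FA FA') as [K|K]; [destruct (HF A' FA') as (_ & _ & L)|destruct (HF A FA) as (_ & _ & L)]; eauto. }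
  assert (CA : forall w, cov (Tl m) (fun c => A (w, c))).
  { intro w. apply antichain. intros c c' H H'. apply (A2 w c c' H H'). }
  destruct (@hi_union m p0 (fun c => c = p0 \/ exists w, True /\ A (w, c)) Hm) as (p & P1 & P2 & P3).
  { apply cov_union. apply cov_sing. apply cov_bigcup; auto. apply emb_TlTl. }
  { intros c c' l L [->|(w & _ & H)] [->|(w' & _ & H')] xi x t t' E E'.
    - congruence.
    - destruct (A1 _ _ H') as [_ [_ Hc]]. apply Hc in E. congruence.
    - destruct (A1 _ _ H) as [_ [_ Hc]]. apply Hc in E'. congruence.
    - exact (A3 w c w' c' l L H H' xi x t t' E E'). }
  assert (Hp0 : hile m p p0).
  { intros l L xi x t H. apply P3; auto. exists p0. auto. }
  assert (Hlo : lole m p p0 /\ lole m p0 p).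
  { unfold lole. rewrite P1. split; (split; [apply hleq_refl|]); intros l L xi x t H; apply P2; auto. }
  assert (Hpc : forall w c, A (w, c) -> hile m p c).
  { intros w c H l L xi x t E. apply P3; auto. exists c. eauto. }
  exists p. split. apply (cle_iff m). tauto. split. tauto.
  assert (HR : forall w, exists R : Tl m -> cond -> Prop, (forall t x y, R t x -> R t y -> x = y) /\
    forall c, A (w, c) -> exists t, R t c) by exact CA.
  apply choice in HR as [R HR].
  exists (fun w t c => R w t c /\ A (w, c)). split; [|split].
  - intros w t c c' [H _] [H' _]. eapply HR; eauto.
  - intros w t c [_ H]. apply Dm with c. 2: apply A1, H.
    apply comb_le. apply lole_refl. eauto.
  - intros w q Hq.
    (* Otherwise an extension of [q] that settles [w] could be added to the maximal family. *)
    assert (K : exists c, A (w, c) /\ locompat m q c).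
    { apply NNPP. intro N.
      assert (Hq0 : q ≼ p0). { eapply ple_trans. exact Hq. apply (cle_iff m). tauto. }
      destruct (Dd w q Hq0) as (r & Hr & Dr).
      assert (Ar : A (w, r)).
      { assert (NL : forall c, A (w, c) -> ~ locompat m r c).
        { intros c H (u & H1 & H2). apply N. exists c. split; auto. exists u. split; auto.
          eapply lole_trans; [exact H1|]. apply le_lole, Hr. }
        apply (Max (fun wc => A wc \/ wc = (w, r))); auto. split; [|split].
        - intros w' c [H|E]; auto. injection E as -> ->. split; auto. eapply ple_trans; eauto.
        - intros w' c c' [H|E] [H'|E'] Nc.
          + eauto.
          + injection E' as -> ->. intros (u & H1 & H2). apply (NL c H). exists u. auto.
          + injection E as -> ->. auto.
          + congruence.
        (* From [m] on, [r] extends [p], the union of the family, so it agrees there with every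
           member. *)
        - assert (Hr' : hile m r p) by (apply le_hile; eapply ple_trans; eauto).
          intros w1 c w2 c' l L [H|E] [H'|E'] xi x t t' K K'.
          + exact (A3 w1 c w2 c' l L H H' xi x t t' K K').
          + injection E' as -> ->. assert (G := Hr' l L xi x t (Hpc _ _ H l L xi x t K)). congruence.
          + injection E as -> ->. assert (G := Hr' l L xi x t' (Hpc _ _ H' l L xi x t' K')). congruence.
          + congruence. }
      apply N. exists r. split; auto. exists r. split; [apply le_lole, Hr|apply lole_refl]. }
    destruct K as (c & Ac & u & H1 & H2). destruct (proj2 (HR w) c Ac) as [t Ht].
    exists t, c, (comb m u q). split; auto. split.
    + apply comb_le; auto. apply hile_refl.
    + apply le_comb. eapply lole_trans; [exact (proj1 (comb_lo m u q))|exact H2].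
      eapply hile_trans; [exact (proj1 (comb_hi m u q))|]. apply le_hile, Hq.
Qed.

Fixpoint enc (l : nat) (p : cond) : RT l :=
  match l with
  | 0 => ch p
  | S l => (enc l p, fun y => cp p l (fst y) (snd y))
  end.

Lemma enc_eq m p q : enc m p = enc m q -> ch p = ch q /\ forall l, l < m -> cp p l = cp q l.
Proof.
  induction m as [|m IH]; simpl; intro H. split; auto. lia.
  injection H as H1 H2. destruct (IH H1) as [H3 H4]. split; auto.
  intros l L. destruct (Nat.eq_dec l m) as [->|N].
  - apply functional_extensionality. intro xi. apply functional_extensionality. intro x.
    exact (f_equal (fun h => h (xi, x)) H2).
  - apply H4. lia.
Qed.

Lemma enc_lole m p q : enc m p = enc m q -> lole m p q.
Proof.
  intro H. apply enc_eq in H as [H1 H2]. split. rewrite H1. apply hleq_refl.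
  intros l L xi x t E. rewrite H2; auto.
Qed.
End Conditions.
Arguments cp {pp} c l xi x.

(** * Preservation and collapse of cardinals *)

Section Collapse.
Context {pp : params}.
Implicit Types (p q r : cond).

(** With the upper levels fixed as in [p], the value at [w] is settled by the [Tl m] many lower
    conditions of [easton], and each of them leaves at most one value. *)
Lemma cover m (W X : Type) (R : W -> X -> cond -> Prop) p0 : m <= pn ->
  cov (Tl m) (fun _ : W => True) -> (forall w x, mono (R w x)) -> functional R p0 ->
  exists p, p ≼ p0 /\ lole m p0 p /\ exists Y : W -> X -> Prop,
    (forall w, cov (Tl m) (Y w)) /\ forall w x q, q ≼ p -> R w x q -> Y w x.
Proof.
  intros Hm CW MR FR.
  (* [R] may be partial, so a condition settles [w] by forcing a value or by excluding all
     values. *)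
  destruct (@easton _ m W (fun w q => (exists x, R w x q) \/ (forall x r, r ≼ q -> ~ R w x r)) p0 Hm CW)
    as (p & Hp & Hlo & a & Fa & Da & Pa).
  - intros w p q Hq [[x H]|H]. left. exists x. eapply MR; eauto.
    right. intros x r Hr. apply H. le.
  - intros w q Hq. destruct (classic (exists x r, r ≼ q /\ R w x r)) as [(x & r & Hr & H)|N].
    + exists r. eauto.
    + exists q. split; auto. right. intros x r Hr H. apply N. eauto.
  - exists p. split; auto. split; auto.
    exists (fun w x => exists t c q, a w t c /\ q ≼ comb m c p /\ q ≼ p /\ R w x q). split.
    + intro w. exists (fun t x => exists c q, a w t c /\ q ≼ comb m c p /\ q ≼ p /\ R w x q). split.
      * intros t x x' (c & q & Hc & Hq1 & Hq2 & H) (c' & q' & Hc' & Hq1' & Hq2' & H').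
        rewrite <- (Fa _ _ _ _ Hc Hc') in *. destruct (Da _ _ _ Hc) as [[x0 H0]|H0].
        -- transitivity x0.
           ++ apply (FR w x x0 q); [le|exact H|exact (MR _ _ _ _ Hq1 H0)].
           ++ symmetry. apply (FR w x' x0 q'); [le|exact H'|exact (MR _ _ _ _ Hq1' H0)].
        -- destruct (H0 _ _ Hq1 H).
      * intros x (t & c & q & H). exists t, c, q. auto.
    + intros w x q Hq H. destruct (Pa w q Hq) as (t & c & q' & Hc & H1 & H2).
      exists t, c, q'.
      split; [exact Hc|split; [exact H2|split; [le|exact (MR _ _ _ _ H1 H)]]].
Qed.

Definition kn l : Kl l -> name cond := onm (kwo l).
Definition kset l : name cond := oset (kwo l).

Lemma kwo_0 : kwo 0 = nat_wo.
Proof. apply proof_irrelevance. Qed.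

Lemma kset_0 : kset 0 = omega.
Proof. unfold kset, omega. rewrite kwo_0. reflexivity. Qed.

(** Read backwards, a one-to-one [R] is a partial function on [Kl l]. By [cover] its possible
    values, which include all of [Kl (S l)], are covered by [Tl l]. *)
Lemma not_injected l p (R : Kl (S l) -> Kl l -> cond -> Prop) : l <= pn ->
  (forall a b, stable (R a b)) -> total R p -> functional R p -> one_to_one R p -> False.
Proof.
  intros L SR HT HF HO.
  destruct (@cover l (Kl l) (Kl (S l)) (fun w x => R x w) p L (Kl_cov l)) as (q & Hq & _ & Y & CY & HY).
  - intros w x. apply SR.
  - intros w x x' r Hr H H'. eapply HO; eauto.
  - apply (Kl_not_cov (l := l)).
    apply cov_sub with (fun x => exists w, True /\ Y w x).
    + intros x _. destruct (HT x q Hq) as (r & Hr & w & H). exists w. split; auto. eapply HY; eauto.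
    + apply cov_bigcup; auto. apply emb_TlTl. apply Kl_cov.
Qed.

(** [G] is the graph of a generic function from [Kl l] onto [Tl l]. A value is asked for together
    with the decision of all earlier arguments, so that the first argument with a given property can
    be decided. *)
Definition surjecting l (G : Kl l -> Tl l -> cond -> Prop) :=
  (forall w t, mono (G w t)) /\
  (forall w t t' p, G w t p -> G w t' p -> t = t') /\
  (forall p t, exists q, q ≼ p /\ exists w, G w t q /\ forall w', klt w' w -> exists t', G w' t' q).

(** A ground covering [C] of the segment below [x] by [Tl l], composed with the generic surjection,
    sends [Kl l] onto the segment; each [y] goes to the first argument whose value codes it. *)
Lemma segment_injected l (G : Kl l -> Tl l -> cond -> Prop) : surjecting G ->
  forall (x : Kl (S l)) p, o_card_le (kn (S l) x) (kset l) p.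
Proof.
  intros (MG & FG & DG) x p. unfold kn. rewrite onm_eq.
  destruct (@seg_cov l x) as (C & FC & HC).
  apply card_le_intro with (fun (y : {y : Kl (S l) | klt y x}) w q =>
    (exists t, G w t q /\ C t (proj1_sig y)) /\
    forall w', klt w' w -> exists t, G w' t q /\ ~ C t (proj1_sig y)).
  - apply seg_distinct.
  - apply onm_distinct.
  - intros y w q r Hr [(t & H1 & H2) H3]. split.
    + exists t. split; auto. eapply MG; eauto.
    + intros w' L. destruct (H3 w' L) as (t' & H4 & H5). exists t'. split; auto. eapply MG; eauto.
  - intros y q Hq. destruct (HC _ (proj2_sig y)) as [t Ht].
    destruct (DG q t) as (r & Hr & w & Hw & Hall).
    destruct (wo_least (kwo l) (fun w => exists t, G w t r /\ C t (proj1_sig y))) as (w0 & (t0 & H1 & H2) & H3).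
    { exists w, t. auto. }
    exists r. split; auto. exists w0. split; eauto. intros w' L.
    assert (Lw : klt w' w).
    { destruct (wo_total (kwo l) w' w) as [L'|[->|L']]; auto; exfalso.
      - apply (H3 w L). eauto.
      - apply (H3 w). eapply wo_trans; eauto. apply kwo. eauto. }
    destruct (Hall w' Lw) as [t' Ht']. exists t'. split; auto. intro K. apply (H3 w' L). eauto.
  - intros y w w' q _ [(t & H1 & H2) H3] [(t' & H1' & H2') H3'].
    destruct (wo_total (kwo l) w w') as [L|[E|L]]; auto; exfalso.
    + destruct (H3' w L) as (u & K1 & K2). rewrite (FG w u t q) in K2; auto.
    + destruct (H3 w' L) as (u & K1 & K2). rewrite (FG w' u t' q) in K2; auto.
  - intros [y Ly] [y' Ly'] w q _ [(t & H1 & H2) _] [(t' & H1' & H2') _]. simpl in *.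
    rewrite (FG w t' t q) in H2'; auto. assert (y = y') by eauto. subst. f_equal. apply proof_irrelevance.
Qed.

Definition with_ch (p : cond) (h : HC) (F : fin h) : cond :=
  {| ch := h; cp := cp p; ch_fin := F; cp_small := cp_small p; cp_bound := cp_bound p |}.

Lemma with_ch_le p h (F : fin h) : hleq h (ch p) -> with_ch p F ≼ p.
Proof. intro H. split; auto. intros l xi x t E. exact E. Qed.

Definition entry (a : Q) (i j : nat) (t : Tl 0) (p : cond) :=
  exists s vs, at_ (ch p) a = Some (s, vs) /\ nth_error s i = Some (j, t).

Lemma entry_mono a i j t : mono (entry a i j t).
Proof.
  intros p q Hq (s & vs & H1 & H2). destruct (hle_stem _ (proj1 Hq) H1) as (u & vs' & H3 & _).
  exists (s ++ u), vs'. split; auto. rewrite nth_error_app1; auto.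
  apply nth_error_Some. congruence.
Qed.

Lemma entry_fun a i j t j' t' p : entry a i j t p -> entry a i j' t' p -> j = j' /\ t = t'.
Proof.
  intros (s & vs & H1 & H2) (s' & vs' & H1' & H2'). rewrite H1 in H1'. injection H1' as <- <-.
  rewrite H2 in H2'. injection H2'. auto.
Qed.

Lemma Q_inhabited : inhabited Q.
Proof. destruct (Kl_inhabited pk) as [x], (Kl_inhabited pn) as [y]. exact (inhabits (x, y)). Qed.

Definition t0 : forall l, Tl l := fun l _ => True.

(** The labels along the stem at one coordinate: the next entry may carry any label. *)
Lemma collapse_0 : exists G : Kl 0 -> Tl 0 -> cond -> Prop, surjecting G.
Proof.
  destruct Q_inhabited as [a]. exists (fun w t p => exists j, entry a w j t p). split; [|split].
  - intros w t p q Hq [j H]. exists j. eapply entry_mono; eauto.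
  - intros w t t' p [j H] [j' H']. eapply entry_fun; eauto.
  - intros p t.
    destruct (extend_stem_to qlt_wf qlt_trans a 0 (t0 0) (ch_fin p)) as (h & s & vs & F1 & L1 & E1 & _).
    destruct (extend_stem qlt_wf qlt_trans a 0 t F1 E1) as (h' & j & F2 & L2 & _ & E2 & _).
    exists (with_ch p F2). split. apply with_ch_le. eapply hleq_trans; eauto.
    exists (length s). split.
    + exists j, (s ++ [(j, t)]), vs. split; auto. rewrite nth_error_app2, Nat.sub_diag; auto.
    + intros w Lw. destruct (nth_error s w) as [[j' t']|] eqn:E.
      * exists t', j', (s ++ [(j, t)]), vs. split; auto. rewrite nth_error_app1; auto.
      * apply nth_error_None in E. unfold klt, Nat.lt in Lw. lia.
Qed.

Lemma support_bounded p l (xi : Lam l) : exists b, forall x t, cp p l xi x = Some t -> klt x b.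
Proof.
  destruct (@Kl_bounded l (fun x => exists t, cp p l xi x = Some t)) as [b Hb]; eauto.
  apply cov_comap with (f := fun x => (xi, x)) (B := fun y => exists t, cp p l (fst y) (snd y) = Some t); auto.
  - intros x x' _ _ E. injection E. auto.
  - apply cov_support.
Qed.

Lemma collapse_succ l (xi : Lam l) : l < pn -> surjecting (fun w t p => cp p l xi w = Some t).
Proof.
  intro L. split; [|split].
  - intros w t p q Hq H. apply Hq, H.
  - congruence.
  - intros p t. destruct (support_bounded p xi) as [b Hb].
    (* [b] bounds the domain of the function at [xi]. The gaps below [b] receive the default [t0],
       and [b] receives [t]. *)
    destruct (@extend_level _ p l (fun xi' x t' => xi' = xi /\ ((klt x b /\ t' = t0 _) \/ (x = b /\ t' = t))) L)
      as (q & Hq & _ & _ & Eq).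
    + intros xi' x u u' [_ [[L1 ->]|[-> ->]]] [_ [[L2 ->]|[E ->]]]; auto; subst;
        exfalso; eapply (wo_irrefl (kwo (S l))); eauto.
    + apply cov_sub with (fun y => exists x, (klt x b \/ x = b) /\ (xi, x) = y).
      * intros [xi' x] (u & H). simpl in H. destruct H as (-> & [[K _]|[K _]]); exists x; auto.
      * apply cov_rel. congruence. apply cov_union. apply seg_cov. apply cov_sing.
    + assert (N : cp p l xi b = None).
      { destruct (cp p l xi b) as [u|] eqn:E; auto. exfalso.
        apply Hb in E. eapply (wo_irrefl (kwo (S l))); eauto. }
      exists q. split; auto. exists b. split.
      * apply Eq. right. auto.
      * intros w Lw. destruct (cp p l xi w) as [u|] eqn:E.
        -- exists u. apply Eq. auto.
        -- exists (t0 _). apply Eq. right. auto.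
Qed.

Lemma alephs l : l <= pn -> forall p, o_is_aleph l (kset l) p.
Proof.
  induction l as [|l IH]; intros L.
  - rewrite kset_0. intro p. apply omega_is_omega.
  - apply is_aleph_succ with (WK := kwo l) (WL := kwo (S l)).
    + apply IH. lia.
    + intros p R. apply not_injected. lia.
    + assert (G : exists G : Kl l -> Tl l -> cond -> Prop, surjecting G).
      { destruct l as [|l]. apply collapse_0. exists (fun w t p => cp p l (@Lam_inhabited _ l) w = Some t).
        apply collapse_succ. lia. }
      destruct G as [G HG]. apply (segment_injected HG).
Qed.
End Collapse.

(** * A cofinal subset of the Baire space *)

Section Cofinal.
Context {pp : params}.
Implicit Types (p q r : cond).
Local Open Scope oprop_scope.

#[local] Hint Resolve entry_mono : stab.

Definition fam (a : Q) : name cond := rel nnm nnm (fun i j p => exists t, entry a i j t p).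

Lemma nnm_distinct : distinct (@nnm cond).
Proof. apply onm_distinct. Qed.

Lemma entry_ex_mono a i j : mono (fun p => exists t, entry a i j t p).
Proof. intros p q Hq [t H]. exists t. eapply entry_mono; eauto. Qed.

Lemma entry_dense a i p : exists q j t, q ≼ p /\ entry a i j t q.
Proof.
  destruct (extend_stem_to qlt_wf qlt_trans a (S i) (t0 0) (ch_fin p)) as (h & s & vs & F1 & L1 & E1 & L & _).
  destruct (nth_error s i) as [[j t]|] eqn:E.
  - exists (with_ch p F1), j, t. split. apply with_ch_le, L1. exists s, vs. auto.
  - apply nth_error_None in E. lia.
Qed.

Lemma fam_fun a p : o_is_fun (fam a) omega omega p.
Proof.
  apply is_fun_rel; try apply onm_distinct.
  - intros. apply entry_ex_mono.
  - intros i q Hq. destruct (entry_dense a i q) as (r & j & t & Hr & H). eauto.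
  - intros i j j' q _ [t H] [t' H']. destruct (entry_fun H H'). auto.
Qed.

Lemma app_fam a i j t x p : entry a i j t p -> o_app (fam a) (nnm i) x p -> feq x (nnm j) p.
Proof.
  intros He H. apply o_app_iff in H. apply mem_rel in H; [|intros; apply entry_ex_mono].
  below H q Hq H. destruct H as (i' & j' & [t' H'] & E).
  apply npair_inj in E as [E1 E2]. apply nnm_distinct in E1. subst i'.
  destruct (entry_fun He H'). subst. auto.
Qed.

Lemma app_fam_intro a i j t p : entry a i j t p -> fmem (npair (nnm i) (nnm j)) (fam a) p.
Proof.
  intro H. apply (@val_rel _ _ _ _ nnm nnm nnm_distinct nnm_distinct (fun i j p => exists t, entry a i j t p)).
  intros. apply entry_ex_mono. apply dn_intro. apply entry_ex_mono. eauto.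
Qed.

Lemma stable_o_finite (s : name cond) : stable (o_finite s).
Proof. apply oex_stable. Qed.

Lemma lt_star_intro g b p N :
  (forall n q, N <= n -> q ≼ p -> exists r j m t,
     r ≼ q /\ fmem (npair (nnm n) (nnm j)) g r /\ entry b n m t r /\ j < m) ->
  o_lt_star omega g (fam b) p.
Proof.
  intro H. apply oex_intro with (nnm N); [pose proof stable_o_finite; stab|].
  split. apply finite_onm. intros i q Hq [Hi Hn].
  apply mem_oset in Hi. below Hi r Hr Hi. destruct Hi as [n E].
  assert (L : N <= n).
  { destruct (le_lt_dec N n); auto. exfalso. apply (Hn r (ple_refl r)).
    eapply fmem_cong_l. apply feq_sym, E. apply mem_onm_intro. auto. }
  intros q1 Hq1. assert (Hq1p : q1 ≼ p) by le.
  destruct (H n q1 L Hq1p) as (r1 & j & m & t & Hr1 & H1 & H2 & H3).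
  assert (Hr' : r1 ≼ r) by le. lift Hr'.
  exists r1. split; auto. exists (nnm j).
  apply oex_intro with (nnm m). stab.
  split; [|split].
  - apply o_app_iff. eapply fmem_cong_l; [|exact H1]. apply npair_cong; auto using feq_refl, feq_sym.
  - apply o_app_iff. eapply fmem_cong_l; [|exact (app_fam_intro H2)].
    apply npair_cong; auto using feq_refl, feq_sym.
  - apply mem_onm_intro. auto.
Qed.

(** All conditions listed at [n] that are compatible with [h'] below [b] give the value [j], so [j]
    is a bound for the promise. Hence the entry [m] is one as well, and [c], which [h'] extends,
    shows that it is at least [j]. *)
Lemma promise_value (h h' : HC) b s vs v s' vs' n m x i c j : fin h' -> hleq h' h ->
  at_ h b = Some (s, vs) -> In v vs -> length s <= n ->
  at_ h' b = Some (s', vs') -> nth_error s' n = Some (m, x) ->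
  v n i = Some (c, j) -> hleq h' c ->
  (forall i c j', v n i = Some (c, j') ->
     (exists u, fin u /\ lebel qlt_wf b u h' /\ lebel qlt_wf b u c) -> j' = j) ->
  j <= m.
Proof.
  intros F H E Hv L E' Hn Hi Hc Hu.
  assert (B : bnd (lebel qlt_wf b) h' v n m).
  { apply (@promise_kept _ _ _ _ qlt_wf h h' b s vs v s' vs' n m x F H E Hv L E' Hn).
    exists j. intros i' c' j' Hi' Lj K. rewrite (Hu _ _ _ Hi' K) in Lj. lia. }
  destruct (le_lt_dec j m) as [|Lm]; auto. exfalso. apply (B i c j Hi Lm).
  exists h'. split; auto. split. intros d _. apply hleq_refl. intros d _. apply Hc.
Qed.

Definition stem_cond (a : Q) (s : stems) : HC :=
  Raw (fun b => if excluded_middle_informative (b = a) then Some (s, []) else None).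

(** The canonical name of the generic sequence at [a]: each stem gives its own entries. The value is
    [S j] because a promise ensures only [<=], while strict domination is wanted. *)
Definition fam_name (a : Q) : hname :=
  fun n i => match i with
    | inl _ => None
    | inr s => match nth_error s n with Some (j, _) => Some (stem_cond a s, S j) | None => None end
    end.

Lemma add_promise (p : cond) b (v : hname) : exists q s vs, q ≼ p /\ cp q = cp p /\
  at_ (ch q) b = Some (s, vs) /\ In v vs.
Proof.
  destruct (at_ (ch p) b) as [[s vs]|] eqn:E.
  - assert (F : fin (upd (ch p) b (s, v :: vs))) by apply upd_fin, ch_fin.
    exists (with_ch p F), s, (v :: vs). split. apply with_ch_le, upd_le_promise, E.
    split; auto. split. apply upd_eq. left. auto.
  - assert (F : fin (upd (ch p) b ([], [v]))) by apply upd_fin, ch_fin.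
    exists (with_ch p F), [], [v]. split. apply with_ch_le, upd_le_new, E.
    split; auto. split. apply upd_eq. left. auto.
Qed.

Lemma stem_cond_le h a s vs : at_ h a = Some (s, vs) -> hleq h (stem_cond a s).
Proof.
  intros E b. destruct (classic (b = a)) as [->|N].
  - eapply ok_stem; [|exact E|]. simpl. destruct excluded_middle_informative; [reflexivity|congruence].
    intros x [].
  - apply ok_iff. intros s' vs' K. simpl in K. destruct excluded_middle_informative; congruence.
Qed.

(** Densely often the sequence at [b] promises to dominate [fam_name a]. The promise has one value
    at [n]: a listed stem compatible with the current one at [a] shares its [n]-th entry. *)
Lemma fam_increasing a b p : qlt a b -> o_lt_star omega (fam a) (fam b) p.
Proof.
  intro Lab.
  assert (D : dn (o_lt_star omega (fam a) (fam b)) p).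
  { intros q Hq. destruct (add_promise q b (fam_name a)) as (r & s & vs & Hr & _ & Er & Hv).
    exists r. split; auto. apply lt_star_intro with (length s).
    intros n u Ln Hu. destruct (entry_dense a n u) as (u1 & j & t & Hu1 & Ha).
    destruct (entry_dense b n u1) as (u2 & m & t' & Hu2 & Hb).
    assert (Ha2 := entry_mono Hu2 Ha).
    exists u2, j, m, t'. split. le. split. eapply app_fam_intro; eauto. split; auto.
    destruct Ha2 as (sa & va & Ea & Na). destruct Hb as (sb & vb & Eb & Nb).
    assert (K : S j <= m); [|exact K].
    assert (Hur : u2 ≼ r) by le.
    apply (@promise_value (ch r) (ch u2) b s vs (fam_name a) sb vb n m t' (inr sa) (stem_cond a sa) (S j)); auto.
    - apply ch_fin.
    - apply Hur.
    - simpl. rewrite Na. reflexivity.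
    - eapply stem_cond_le; eauto.
    - intros [i|s'] c j' Hi (w & Fw & W1 & W2); simpl in Hi; [discriminate|].
      destruct (nth_error s' n) as [[j1 t1]|] eqn:N1; [|discriminate]. injection Hi as <- <-.
      f_equal. specialize (W1 a Lab). specialize (W2 a Lab). rewrite ok_iff in W1, W2.
      destruct (W1 _ _ Ea) as (x1 & y1 & X1 & _).
      destruct (W2 s' []) as (x2 & y2 & X2 & _).
      { simpl. destruct excluded_middle_informative as [E|E]; [reflexivity|destruct (E eq_refl)]. }
      rewrite X1 in X2. injection X2 as X2 _.
      assert (Z1 : nth_error (sa ++ x1) n = Some (j, t)).
      { rewrite nth_error_app1; auto. apply nth_error_Some. congruence. }
      assert (Z2 : nth_error (s' ++ x2) n = Some (j1, t1)).
      { rewrite nth_error_app1; auto. apply nth_error_Some. congruence. }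
      rewrite X2 in Z1. congruence. }
  apply (oex_stable _). exact D.
Qed.

(** Lengthen the stem at [a] past [L], then the stem at [b] past that; the latter changes nothing at
    [a], which is not below [b]. The next entry at [a] may then exceed the one at [b], and a further
    change at [b] keeps its stem. *)
Lemma fam_separated a b p L : ~ qlt a b -> a <> b -> exists q i j m t t', q ≼ p /\ L <= i /\
  entry a i j t q /\ entry b i m t' q /\ m < j.
Proof.
  intros N Nab.
  destruct (extend_stem_to qlt_wf qlt_trans a L (t0 0) (ch_fin p)) as (h1 & s & vs & F1 & L1 & E1 & Ls & _).
  destruct (extend_stem_to qlt_wf qlt_trans b (S (length s)) (t0 0) F1) as (h2 & sb & vb & F2 & L2 & E2 & Lb & O2).
  rewrite <- (O2 a) in E1; auto.
  destruct (nth_error sb (length s)) as [[m t']|] eqn:En.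
  2: { apply nth_error_None in En. lia. }
  destruct (extend_stem qlt_wf qlt_trans a (S m) (t0 0) F2 E1) as (h3 & j & F3 & L3 & Lj & E3 & _).
  exists (with_ch p F3), (length s), j, m, (t0 0), t'. split; [|split; [|split; [|split]]]; auto.
  - apply with_ch_le. eapply hleq_trans; [exact L3|]. eapply hleq_trans; eauto.
  - exists (s ++ [(j, t0 0)]), vs. split; auto. rewrite nth_error_app2, Nat.sub_diag; auto.
  - destruct (hle_stem _ L3 E2) as (u & w & Eu & _). exists (sb ++ u), w. split; auto.
    rewrite nth_error_app1; auto.
Qed.

Lemma fam_reflects a b p : o_lt_star omega (fam a) (fam b) p -> qlt a b.
Proof.
  intro H. apply NNPP. intro N.
  destruct (H p (ple_refl p)) as (q & Hq & s & Hs & Hall).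
  destruct (finite_bounded Hs _ (ple_refl q)) as (q1 & Hq1 & l & Hl).
  assert (HL : exists L, forall i, In i l -> i < L).
  { exists (S (list_max l)). intros i Hi. assert (K : Forall (fun k => k <= list_max l) l) by (apply list_max_le; auto).
    rewrite Forall_forall in K. specialize (K i Hi). lia. }
  destruct HL as [L HL].
  assert (G : exists r i j m t t', r ≼ q1 /\ L <= i /\ entry a i j t r /\ entry b i m t' r /\ m <= j).
  { destruct (classic (a = b)) as [->|Nab].
    - destruct (entry_dense b L q1) as (r & j & t & Hr & E). exists r, L, j, j, t, t. auto 7.
    - destruct (fam_separated q1 L N Nab) as (r & i & j & m & t & t' & H1 & H2 & H3 & H4 & H5).
      exists r, i, j, m, t, t'. split; auto. split; auto. split; auto. split; auto. lia. }
  destruct G as (r & i & j & m & t & t' & Hr & Li & Ea & Eb & Lm).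
  assert (Hrq : r ≼ q) by le.
  assert (Hi : (∃ x y : name cond, o_app (fam a) (nnm i) x ∧ o_app (fam b) (nnm i) y ∧ x ∈ y) r).
  { apply (Hall (nnm i) r Hrq). split. apply mem_gset_intro.
    intros u Hu K. assert (Huq : u ≼ q1) by le. apply Hl in K; auto. apply HL in K. lia. }
  destruct (Hi r (ple_refl r)) as (r1 & Hr1 & x & Hx). destruct (Hx r1 (ple_refl r1)) as (r2 & Hr2 & y & X & Y & XY).
  assert (Hr2r : r2 ≼ r) by le.
  apply app_fam with (1 := entry_mono Hr2r Ea) in X. apply app_fam with (1 := entry_mono Hr2r Eb) in Y.
  assert (K : fmem (nnm j) (nnm m) r2). { eapply fmem_cong_l. exact X. eapply fmem_cong_r; eauto. }
  apply mem_onm_iff in K. unfold Nat.lt in K. lia.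
Qed.

Lemma fam_distinct : distinct fam.
Proof.
  intros a b p E. apply NNPP. intro N.
  assert (G : forall a b p, feq (fam a) (fam b) p -> a <> b -> ~ qlt a b -> False).
  { clear. intros a b p E N Nl. destruct (fam_separated p 0 Nl N) as (q & i & j & m & t & t' & Hq & _ & Ea & Eb & L).
    lift Hq. assert (K : fmem (npair (nnm i) (nnm j)) (fam b) q).
    { eapply fmem_cong_r. exact E. eapply app_fam_intro; eauto. }
    apply o_app_iff in K. apply (app_fam Eb) in K. apply nnm_distinct in K. lia. }
  destruct (classic (qlt a b)) as [L|L].
  - apply (G b a p); auto. apply feq_sym, E. intro L'. apply N. apply qle_antisym. apply L. apply L'.
  - apply (G a b p); auto.
Qed.

(** Since [1 <= pk], both factors have the form [Kl (S l)], in which a set covered by [Tl 0] is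
    bounded. *)
Lemma Q_bounded (A : Q -> Prop) : cov (Tl 0) A -> exists b, forall a, A a -> qlt a b.
Proof.
  intro C. assert (H1 := pk_pos). assert (H2 := pk_le).
  assert (B : forall l (f : Q -> Kl l), 1 <= l -> exists b, forall a, A a -> klt (f a) b).
  { intros [|l] f L; [lia|].
    destruct (@Kl_bounded l (fun x => exists a, A a /\ f a = x)) as [b Hb].
    - apply cov_rel. congruence. eapply cov_emb; [|exact C]. apply emb_Tl. lia.
    - exists b. intros a Ha. apply Hb. eauto. }
  destruct (B pk fst) as [b1 Hb1]; [lia|]. destruct (B pn snd) as [b2 Hb2]; [lia|].
  exists (b1, b2). intros a Ha. split.
  - split; left; simpl; auto.
  - intros ->. apply (wo_irrefl (kwo pk) b1). apply (Hb1 (b1, b2) Ha).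
Qed.

(** Easton's lemma at level 0 reduces [g] to a name built from [Tl 0] many Hechler conditions. Their
    supports lie below a single coordinate [b], where this name can be promised. *)
Lemma fam_dominates g p : o_is_fun g omega omega p -> (∃ f : name cond, f ∈ gset fam ∧ o_lt_star omega g f) p.
Proof.
  intro Hg. intros p0 Hp0. lift Hp0. clear p Hp0. rename p0 into p.
  assert (Hf := Hg). apply is_fun_gset in Hf as (_ & HT & HF); try apply onm_distinct.
  pose (R := fun i j => val nnm nnm g i j). 
  assert (MR : forall i j, mono (R i j)) by (intros; apply val_stable).
  destruct (@easton _ 0 nat (fun i q => exists j, R i j q) p) as (p1 & Hp1 & _ & a & Fa & Da & Pa).
  - lia.
  - apply cov_of_emb, emb_nat_Tl.
  - intros i q r Hr [j H]. exists j. eapply MR; eauto.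
  - intros i q Hq. exact (HT i q Hq).
  (* A condition of the family paired with the value of [g] at [n] that it forces once the levels
     are those of [p1]; [v] lists it with the successor of the value, to make the domination
     strict. *)
  - pose (Pv := fun n t cj => a n t (fst cj) /\ R n (snd cj) (comb 0 (fst cj) p1)).
    pose (v := (fun n i => match i with
      | inl t => match excluded_middle_informative (exists cj, Pv n t cj) with
         | left H => let cj := proj1_sig (constructive_indefinite_description _ H) in
            Some (ch (fst cj), S (snd cj))
         | right _ => None end
      | inr _ => None end) : hname (Q := Q) (S := Tl 0) (I := Tl 0 + stems)).
    assert (Hv : forall n i c j, v n i = Some (c, j) -> exists t cj, i = inl t /\ Pv n t cj /\ c = ch (fst cj) /\ j = S (snd cj)).
    { intros n [t|s] c j; simpl; [|discriminate]. destruct excluded_middle_informative as [H|H]; [|discriminate].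
      destruct constructive_indefinite_description as [cj K]. simpl. intro E. injection E as <- <-. eauto 6. }
    assert (Hv' : forall n t c, a n t c -> exists j, R n j (comb 0 c p1) /\ v n (inl t) = Some (ch c, S j)).
    { intros n t c Hc. simpl. destruct excluded_middle_informative as [H|H].
      - destruct constructive_indefinite_description as [[c' j] [K1 K2]]. simpl in *.
        rewrite (Fa _ _ _ _ Hc K1). eauto.
      - exfalso. apply H. destruct (Da n t c Hc) as [j Hj]. exists (c, j). split; auto. }
    destruct (@Q_bounded (fun x => exists n t c, a n t c /\ at_ (ch c) x <> None)) as [b Hb].
    { apply cov_sub with (fun x => exists nt : nat * Tl 0, True /\ exists c, (a (fst nt) (snd nt) c) /\ at_ (ch c) x <> None).
      - intros x (n & t & c & H). exists (n, t). eauto.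
      - apply cov_bigcup. apply emb_TlTl.
        + apply cov_of_emb. apply (emb_prod (xl0 0)). apply emb_nat_Tl. apply emb_refl.
        + intros [n t] _. apply cov_bigcup. apply emb_TlTl.
          * exists (fun _ c => a n t c). split; [intros u c c' H H'; exact (Fa _ _ _ _ H H')|].
            intros c Hc. exists (t0 0). exact Hc.
          * intros c _. destruct (ch_fin c) as [l Hl].
            apply cov_sub with (fun x => In x l); auto. eapply cov_emb; [apply emb_El_Tl|]. apply cov_In, (xl0 0). }
    destruct (add_promise p1 b v) as (p2 & s & vs & Hp2 & _ & Eb & Hin).
    exists p2. split. le. exists (fam b). split. apply mem_gset_intro.
    apply lt_star_intro with (length s). intros n q Ln Hq.
    destruct (entry_dense b n q) as (q1 & m & t & Hq1 & Hm).
    assert (Hq1p : q1 ≼ p1) by le.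
    destruct (Pa n q1 Hq1p) as (u & c & q2 & Hc & Hq2 & Hq2c).
    destruct (Hv' n u c Hc) as (j & Hj & Ev).
    assert (Hm2 := entry_mono Hq2 Hm). destruct (Hm2) as (sb & vb & E1 & E2).
    exists q2, j, m, t. split. le. split. exact (MR _ _ _ _ Hq2c Hj). split; auto.
    assert (K : S j <= m); [|exact K].
    assert (Hq2p : q2 ≼ p2) by le.
    apply (@promise_value (ch p2) (ch q2) b s vs v sb vb n m t (inl u) (ch c) (S j)); auto.
    + apply ch_fin.
    + apply Hq2p.
    + apply Hq2c.
    + intros i c' j' Hi' Hw. destruct (Hv _ _ _ _ Hi') as (t' & [c2 j2] & -> & [K1 K2] & -> & ->). simpl in *.
      (* The listed condition is supported below [b], so it has a true common extension with [q2],
         at which [g] has only one value. *)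
      f_equal. destruct (@incompatible_below _ _ _ _ qlt_wf qlt_trans (ch q2) (ch c2) b (ch_fin q2)) as (w & Fw & W1 & W2); auto.
      { intros x Hx. apply Hb. exists n, t', c2. auto. }
      assert (V1 : with_ch q2 Fw ≼ q2) by (apply with_ch_le, W1).
      assert (V2 : with_ch q2 Fw ≼ comb 0 c2 p1).
      { apply le_comb. split. exact W2. lia. apply le_hile, (ple_trans _ q2); [exact V1|].
        apply (ple_trans _ q1); [exact Hq2|exact Hq1p]. }
      apply (HF n j2 j (with_ch q2 Fw)). clear V2. le. exact (MR _ _ _ _ V2 K2).
      apply (MR _ _ _ _ V1). exact (MR _ _ _ _ Hq2c Hj).
Qed.

Definition qn (a : Q) : name cond := npair (kn pk (fst a)) (kn pn (snd a)).

Lemma qn_distinct : distinct qn.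
Proof.
  intros [a b] [a' b'] p E. apply npair_inj in E as [E1 E2].
  apply onm_distinct in E1, E2. simpl in *. congruence.
Qed.

Lemma prod_lt_iff a b p : o_prod_lt (qn a) (qn b) p <-> qlt a b.
Proof.
  split.
  - intros [H N]. split.
    + destruct (H p (ple_refl p)) as (q1 & Hq1 & x & H1). destruct (H1 q1 (ple_refl q1)) as (q2 & Hq2 & y & H2).
      destruct (H2 q2 (ple_refl q2)) as (q3 & Hq3 & x' & H3). destruct (H3 q3 (ple_refl q3)) as (q4 & Hq4 & y' & X & Y & Lx & Ly).
      apply o_is_opair_iff in X, Y. apply npair_inj in X as [X1 X2], Y as [Y1 Y2].
      apply (o_ord_le_cong (feq_sym _ _ _ X1) (feq_sym _ _ _ Y1)) in Lx.
      apply (o_ord_le_cong (feq_sym _ _ _ X2) (feq_sym _ _ _ Y2)) in Ly.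
      apply ord_le_iff in Lx, Ly. split; auto.
    + intros ->. apply (N p (ple_refl p)). apply feq_refl.
  - intros [[H1 H2] N]. split.
    + pose proof (@oor_stable cond _).
      apply oex_intro with (kn pk (fst a)); [unfold o_ord_le; stab|].
      apply oex_intro with (kn pn (snd a)); [unfold o_ord_le; stab|].
      apply oex_intro with (kn pk (fst b)); [unfold o_ord_le; stab|].
      apply oex_intro with (kn pn (snd b)); [unfold o_ord_le; stab|].
      split. apply o_is_opair_iff, feq_refl. split. apply o_is_opair_iff, feq_refl.
      split; apply ord_le_iff; auto.
    + intros q _ E. apply qn_distinct in E. contradiction.
Qed.

Lemma cofinal_iso_forced p : o_cofinal_iso pk pn p.
Proof.
  pose (h := rel qn fam (fun a b _ => a = b)).
  assert (Mh : forall a b, mono (fun _ : cond => a = b :> Q)) by (intros a b q r _ E; exact E).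
  assert (Hh : forall p, o_is_fun h (gset qn) (gset fam) p).
  { intro q. apply is_fun_rel; auto using qn_distinct, fam_distinct.
    intros a r Hr. exists r. eauto. intros a b b' r _ -> ->. auto. }
  apply (proj1 (dn_stable _)) with p; auto.
  intros q _. exists q. split; auto. exists omega.
  intros q1 Hq1. exists q1. split; auto. exists (kset pk).
  intros q2 Hq2. exists q2. split; auto. exists (kset pn).
  intros q3 Hq3. exists q3. split; auto. exists (gset qn).
  intros q4 Hq4. exists q4. split; auto. exists (gset fam).
  intros q5 Hq5. exists q5. split; auto. exists h.
  split. apply omega_is_omega. split. apply alephs, pk_le. split. apply alephs; auto.
  split; [|split; [|split]].
  - intro z. split; intros r Hr H.
    + apply mem_gset in H. below H s Hs H. destruct H as [[a b] E].
      apply oex_intro with (kn pk a); [stab|]. apply oex_intro with (kn pn b); [stab|].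
      split. apply mem_gset_intro. split. apply mem_gset_intro. apply o_is_opair_iff, E.
    + below H s1 Hs1 H. destruct H as [x H]. below H s2 Hs2 H. destruct H as (y & X & Y & E).
      apply o_is_opair_iff in E. apply mem_oset in X, Y. below X s3 Hs3 X. destruct X as [a X].
      below Y s4 Hs4 Y. destruct Y as [b Y].
      eapply fmem_cong_l; [|exact (mem_gset_intro qn (a, b) s4)].
      apply feq_sym. eapply feq_trans. exact E. apply npair_cong; auto.
  - split.
    + intros f r Hr H. apply mem_gset in H.
      refine (dn_elim (o_is_fun_stable _ _ _) H _). intros s Hs [a E].
      eapply o_is_fun_cong; [apply feq_sym, E|apply feq_refl|apply feq_refl|apply fam_fun].
    + intros g r Hr H. apply fam_dominates, H.
  - split.
    + apply is_inj_gset; auto using qn_distinct, fam_distinct. split; auto.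
      apply one_to_one_rel; auto using qn_distinct, fam_distinct.
      intros a a' b r _ -> ->. auto.
    + intros y r Hr H. apply mem_gset in H. below H s Hs H. destruct H as [a E].
      apply oex_intro with (qn a); [stab|]. split. apply mem_gset_intro.
      apply o_app_iff. eapply fmem_cong_l. apply npair_cong. apply feq_refl. apply feq_sym, E.
      apply (val_rel (na := qn) (nb := fam)); auto using qn_distinct, fam_distinct.
      intros s' Hs'. exists s'. auto.
  - intros x y f g r Hr (X & Y & F & G).
    assert (St : stable (o_prod_lt x y ⇔ o_lt_star omega f g)).
    { pose proof (o_prod_lt_stable x y) as S. pose proof (@oex_stable cond _) as S'.
      unfold oiff. apply stable_oand; apply stable_oimp; auto; try apply S'; apply stable_mono; auto; apply S'. }
    apply mem_gset in X, Y. apply o_app_iff in F, G.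
    refine (dn_elim St X _). intros s1 Hs1 [a E1]. clear X. lift Hs1.
    apply (proj2 St). eapply dn_bind. exact Y. intros s2 Hs2 [b E2]. clear Y. lift Hs2.
    assert (A : forall x a f s, feq x (qn a) s -> fmem (npair x f) h s -> dn (feq f (fam a)) s).
    { clear -Mh. intros x a f s E H. apply mem_rel in H; auto. eapply dn_map. exact H.
      intros t Ht (a1 & b1 & <- & E'). apply npair_inj in E' as [E3 E4]. lift Ht.
      assert (a = a1); [|subst; auto]. apply (@qn_distinct a a1 t). eapply feq_trans; eauto using feq_sym. }
    apply (A x a) in F; auto. apply (A y b) in G; auto.
    eapply dn_bind. exact F. intros s3 Hs3 F'. lift Hs3. eapply dn_map. exact G. intros s4 Hs4 G'. lift Hs4.
    clear A F G. split; intros t Ht K; lift Ht.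
    + apply (o_prod_lt_cong E1 E2) in K. apply prod_lt_iff in K.
      apply (o_lt_star_cong (feq_sym _ _ _ F') (feq_sym _ _ _ G')).
      apply fam_increasing, K.
    + apply (o_lt_star_cong F' G') in K.
      apply fam_reflects in K.
      apply (o_prod_lt_cong (feq_sym _ _ _ E1) (feq_sym _ _ _ E2)).
      apply prod_lt_iff, K.
Qed.
End Cofinal.

Section RelExt.
Context {P : Type} {PP : poset P} {A B : Type} (na : A -> name P) (nb : B -> name P).

Lemma rel_ext (R R' : A -> B -> P -> Prop) p : (forall a b, mono (R a b)) -> (forall a b, mono (R' a b)) ->
  (forall a b q, q ≼ p -> R a b q -> dn (R' a b) q) ->
  (forall a b q, q ≼ p -> R' a b q -> dn (R a b) q) ->
  feq (rel na nb R) (rel na nb R') p.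
Proof.
  intros M M' H H'. apply feq_ext. intros z q Hq. rewrite !mem_rel by auto.
  split; intro K; (eapply dn_bind; [exact K|]); intros r Hr (a & b & K' & E).
  - assert (Hrp : r ≼ p) by le. eapply dn_map. exact (H a b r Hrp K').
    intros s Hs L. exists a, b. split; auto. eapply feq_mono; eauto.
  - assert (Hrp : r ≼ p) by le. eapply dn_map. exact (H' a b r Hrp K').
    intros s Hs L. exists a, b. split; auto. eapply feq_mono; eauto.
Qed.

Lemma val_cong f g a b p : feq f g p -> val na nb f a b p -> val na nb g a b p.
Proof. apply fmem_cong_r. Qed.
End RelExt.
Arguments val_cong {P PP A B na nb f g a b p} _ _.

(** * Nice names and the generic functions *)

Section NiceNames.
Context {pp : params}.
Implicit Types (p q r u : cond).

(* The part of [R] that is decided below level [m], once the levels above are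
   fixed as in [q]. *)
Definition low (X : Type) m q (R : X -> bool -> cond -> Prop) : X -> bool -> RT m -> Prop :=
  fun x b e => exists r, enc m r = e /\ R x b (comb m r q).
Definition low_rel (X : Type) m (D : X -> bool -> RT m -> Prop) : X -> bool -> cond -> Prop :=
  fun x b p => dcl (fun p => D x b (enc m p)) p.

Definition decided (X : Type) m q (R : X -> bool -> cond -> Prop) x :=
  forall u, u ≼ q -> exists v c b, v ≼ u /\ v ≼ comb m c q /\ R x b (comb m c q).

(** Below [q] the truth of [R x b] depends only on the encoded lower part. So the name becomes an
    object over [RT m], and such objects are few compared with [Lam m]. *)
Lemma low_iff (X : Type) m q (R : X -> bool -> cond -> Prop) x b u :
  (forall b, stable (R x b)) -> decided m q R x ->
  (forall b b' u, u ≼ q -> R x b u -> R x b' u -> b = b') -> u ≼ q ->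
  R x b u <-> dn (low_rel m (low m q R) x b) u.
Proof.
  intros SR Dx FR Hu. split.
  - intros H u1 Hu1. assert (Hu1q : u1 ≼ q) by le.
    destruct (Dx u1 Hu1q) as (v & c & b' & H1 & H2 & H3).
    assert (b = b').
    { apply (FR b b' v). le. apply (proj1 (SR b) u v); auto. le. apply (proj1 (SR b') _ v H2 H3). }
    subst b'. exists v. split; auto. apply dcl_intro. exists v. split; auto.
    apply (proj1 (SR b) (comb m c q)); auto. apply comb_le.
    + apply le_lole, H2.
    + exact (proj2 (comb_hi _ _ _)).
  - intro H. apply (proj2 (SR b)). eapply dn_map. exact H.
    intros v Hv (w & Hw & r & E & K). apply (proj1 (SR b) (comb m r q)); auto.
    apply le_comb.
    + eapply lole_trans. apply le_lole, Hw. apply enc_lole. auto.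
    + apply le_hile. le.
Qed.

Lemma decided_mono (X : Type) m q q' (R : X -> bool -> cond -> Prop) x :
  (forall b, mono (R x b)) -> q' ≼ q -> decided m q R x -> decided m q' R x.
Proof.
  intros M H D u Hu. assert (Huq : u ≼ q) by le. destruct (D u Huq) as (v & c & b & H1 & H2 & H3).
  exists v, c, b. split; auto.
  assert (K : comb m c q' ≼ comb m c q).
  { apply comb_le. exact (proj2 (comb_lo _ _ _)). eapply hile_trans. apply le_hile, H. exact (proj2 (comb_hi _ _ _)). }
  split.
  - apply le_comb. eapply lole_trans. apply le_lole, H2. exact (proj1 (comb_lo _ _ _)). apply le_hile. le.
  - eapply M; eauto.
Qed.

Lemma decide_all (W : Type) m (R : W -> bool -> cond -> Prop) p : m <= pn ->
  cov (Tl m) (fun _ : W => True) -> (forall w b, mono (R w b)) -> total R p ->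
  exists q, q ≼ p /\ lole m p q /\ forall w, decided m q R w.
Proof.
  intros Hm CW M T.
  destruct (@easton _ m W (fun w q => exists b, R w b q) p Hm CW) as (q & Hq & Hlo & a & _ & Da & Pa).
  - intros w u v Hv [b H]. exists b. eapply M; eauto.
  - intros w u Hu. apply (T w u Hu).
  - exists q. split; auto. split; auto. intros w u Hu.
    destruct (Pa w u Hu) as (t & c & v & Hc & H1 & H2). destruct (Da w t c Hc) as [b Hb].
    exists v, c, b. auto.
Qed.

(** Levels from [pn] on are empty, so compatibility below [pn] is compatibility and [antichain]
    applies to all conditions. *)
Lemma compatible_pair (I : Type) (q : I -> cond) (A : I -> Prop) : ~ cov (Tl pn) A ->
  exists i j u, A i /\ A j /\ i <> j /\ u ≼ q i /\ u ≼ q j.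
Proof.
  intro N. apply NNPP. intro K.
  assert (KK : forall i j, A i -> A j -> i <> j -> ~ locompat pn (q i) (q j)).
  { intros i j Ai Aj Nij (u & H1 & H2).
    assert (HI : forall p, hile pn u p).
    { intros p l L xi x t E. rewrite cp_bound in E; [discriminate|auto]. }
    apply K. exists i, j, u. repeat split; auto; apply (cle_iff pn); auto. }
  apply N. apply cov_comap with (f := q) (B := fun c => exists i, A i /\ q i = c).
  - intros i j Ai Aj E. apply NNPP. intro Nij. apply (KK i j Ai Aj Nij).
    exists (q i). rewrite <- E. split; apply lole_refl.
  - eauto.
  - apply antichain. intros a b (i & Ai & <-) (j & Aj & <-) Nab. apply KK; auto. congruence.
Qed.

(** The values in [Tl (S l)] serve to collapse; testing them for one fixed element turns the same
    generic functions into functions to 2. *)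
Definition bit l (t : Tl l) : bool := if excluded_middle_informative (t = t0 l) then true else false.
Definition gbit l (xi : Lam l) (x : Kl (S l)) (b : bool) p := exists t, cp p l xi x = Some t /\ b = bit t.
Definition gen l (xi : Lam l) : name cond := rel (kn (S l)) bnm (gbit xi).

Lemma gbit_mono l (xi : Lam l) x b : mono (gbit xi x b).
Proof. intros p q Hq (t & H & E). exists t. split; auto. apply Hq, H. Qed.

Lemma bit_surj l b : exists t : Tl l, bit t = b.
Proof.
  destruct b.
  - exists (t0 l). unfold bit. destruct excluded_middle_informative; congruence.
  - exists (fun _ => False). unfold bit. destruct excluded_middle_informative as [E|]; auto.
    assert (K := f_equal (fun h => h (leaf (xl0 l))) E). unfold t0 in K. simpl in K.
    exfalso. rewrite K. exact Logic.I.
Qed.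

Lemma set_gbit l (xi : Lam l) x b p : l < pn -> cp p l xi x = None ->
  exists q, q ≼ p /\ ch q = ch p /\ gbit xi x b q /\ (forall l', l' <> l -> lev_le l' p q) /\
   (forall xi' x' t, cp q l xi' x' = Some t -> cp p l xi' x' = Some t \/ (xi' = xi /\ x' = x)).
Proof.
  intros L N. destruct (bit_surj (S l) b) as [t Ht].
  destruct (@extend_level _ p l (fun xi' x' t' => xi' = xi /\ x' = x /\ t' = t) L) as (q & Hq & Hch & Hl & E).
  - intros xi' x' u u' (_ & _ & ->) (_ & _ & ->). auto.
  - apply cov_sub with (fun y => y = (xi, x)).
    + intros [xi' x'] (u & H). simpl in H. destruct H as (-> & -> & _). auto.
    + apply cov_sing.
  - exists q. split; auto. split; auto. split; [|split; auto].
    + exists t. split; auto. apply E. right. auto.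
    + intros xi' x' u K. apply E in K as [K|(_ & -> & -> & _)]; auto.
Qed.

Lemma gen_fun l (xi : Lam l) p : l < pn -> o_is_fun (gen xi) (kset (S l)) two p.
Proof.
  intro L. apply is_fun_rel; try apply onm_distinct; try apply bnm_distinct.
  - intros. apply gbit_mono.
  - intros x q Hq. destruct (cp q l xi x) as [t|] eqn:E.
    + exists q. split; auto. exists (bit t), t. auto.
    + destruct (set_gbit xi x true q L E) as (r & Hr & _ & H & _). eauto.
  - intros x b b' q _ (t & H & ->) (t' & H' & ->). congruence.
Qed.

Lemma val_gen l (xi : Lam l) x b p : gbit xi x b p -> val (kn (S l)) bnm (gen xi) x b p.
Proof.
  intro H. apply val_rel; try apply onm_distinct; try apply bnm_distinct.
  intros; apply gbit_mono. apply dn_intro; auto. apply gbit_mono.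
Qed.

Lemma val_gen_eq l (xi : Lam l) x b b' p : l < pn -> gbit xi x b p ->
  val (kn (S l)) bnm (gen xi) x b' p -> b = b'.
Proof.
  intros L H K. apply val_gen in H. assert (F := gen_fun xi p L).
  apply is_fun_gset in F as (_ & _ & F); try apply onm_distinct; try apply bnm_distinct.
  apply (F x b b' p); auto.
Qed.

Lemma gen_distinct l : l < pn -> distinct (@gen l).
Proof.
  intros L xi eta p E. apply NNPP. intro N.
  destruct (support_bounded p xi) as [b Hb]. destruct (support_bounded p eta) as [c Hc].
  (* A point beyond both supports is free for [xi] and for [eta], so the two functions can be made
     to differ there. *)
  assert (Hx : exists x, cp p l xi x = None /\ cp p l eta x = None).
  { assert (I : forall x : Kl (S l), ~ klt x x) by (apply wo_irrefl, kwo).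
    assert (NN : forall (z : Lam l) y, (forall t, cp p l z y <> Some t) -> cp p l z y = None).
    { intros z y H. destruct (cp p l z y) as [t|]; auto. destruct (H t eq_refl). }
    assert (TT := @wo_trans _ _ (kwo (S l))).
    destruct (wo_total (kwo (S l)) b c) as [H|[->|H]]; [exists c|exists c|exists b];
      split; apply NN; intros t Ht; (apply Hb in Ht || apply Hc in Ht); solve [eapply I; eauto]. }
  destruct Hx as (x & Hx & Hy).
  destruct (set_gbit xi x true p L Hx) as (q & Hq & _ & K1 & _ & K2).
  assert (Hy' : cp q l eta x = None).
  { destruct (cp q l eta x) as [t|] eqn:Et; auto. destruct (K2 _ _ _ Et) as [K|[K _]]; congruence. }
  destruct (set_gbit eta x false q L Hy') as (r & Hr & _ & K3 & _).
  assert (K1' := gbit_mono Hr K1). assert (Hrp : r ≼ p) by le. lift Hrp.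
  assert (V := val_cong E (val_gen K1')). apply (val_gen_eq L K3) in V. discriminate.
Qed.
End NiceNames.

(** * The continuum *)

Section Continuum.
Context {pp : params}.
Implicit Types (p q r u : cond).
Local Open Scope oprop_scope.

Notation reals := (@funspace cond _ nat bool nnm bnm).
Notation subsets1 := (@funspace cond _ (Kl 1) bool (kn 1) bnm).

Lemma pn_pos : 0 < pn.
Proof. pose proof pk_pos. pose proof pk_le. lia. Qed.

Lemma mem_reals f p : fmem f reals p <-> o_is_fun f omega two p.
Proof. apply mem_funspace. apply onm_distinct. apply bnm_distinct. Qed.

Lemma mem_subsets1 f p : fmem f subsets1 p <-> o_is_fun f (kset 1) two p.
Proof. apply mem_funspace. apply onm_distinct. apply bnm_distinct. Qed.

Lemma real_rel f p : o_is_fun f omega two p -> feq f (rel nnm bnm (val nnm bnm f)) p.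
Proof. apply (@fun_eq_rel cond _ nat bool nnm bnm); [apply onm_distinct|apply bnm_distinct]. Qed.

(** At level 0 the lower part is a Hechler condition, so every real has a name in
    [nat -> bool -> HC -> Prop], the right summand of [names (RT 0) 0]. *)
Lemma real_nice f p : o_is_fun f omega two p ->
  exists q D, q ≼ p /\ feq f (rel nnm bnm (low_rel 0 D)) q.
Proof.
  intro Hf. assert (H := Hf). apply is_fun_gset in H as (_ & HT & HF); try apply onm_distinct; try apply bnm_distinct.
  destruct (@decide_all _ nat 0 (val nnm bnm f) p) as (q & Hq & _ & Dq); auto.
  - lia.
  - apply cov_of_emb, emb_nat_Tl.
  - intros. apply val_stable.
  - exists q, (low 0 q (val nnm bnm f)). split; auto. lift Hq.
    eapply feq_trans. apply real_rel, Hf.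
    assert (E : forall x b u, u ≼ q -> val nnm bnm f x b u <->
       dn (low_rel 0 (low 0 q (val nnm bnm f)) x b) u).
    { intros x b u Hu. apply low_iff; auto. intros; apply val_stable.
      intros b1 b2 v Hv. apply HF. le. }
    apply rel_ext.
    + intros; apply val_stable.
    + intros; apply dcl_mono.
    + intros x b u Hu. apply E, Hu.
    + intros x b u Hu K. apply dn_intro. apply val_stable. apply E; auto. apply dn_intro; auto. apply dcl_mono.
Qed.

Lemma not_card_le p : ~ o_card_le subsets1 reals p.
Proof.
  intro H. destruct (H p (ple_refl p)) as (q & Hq & F & [[F1 F2] F3]).
  assert (C : forall xi : Lam 0, exists rD, fst rD ≼ q /\ o_app F (gen xi) (rel nnm bnm (low_rel 0 (snd rD))) (fst rD)).
  { intro xi.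
    assert (Hxi : fmem (gen xi) subsets1 q) by (apply mem_subsets1, gen_fun, pn_pos).
    destruct (F2 _ q (ple_refl q) Hxi q (ple_refl q)) as (r1 & Hr1 & y & Hy & _).
    apply o_app_iff in Hy. destruct (F1 _ r1 Hr1 Hy r1 (ple_refl r1)) as (r2 & Hr2 & x' & K).
    destruct (K r2 (ple_refl r2)) as (r3 & Hr3 & y' & _ & Hy' & E).
    apply o_is_opair_iff, npair_inj in E as [_ E].
    assert (Hyr : fmem y reals r3) by (eapply fmem_cong_l; [apply feq_sym, E|exact Hy']).
    apply mem_reals, real_nice in Hyr as (r4 & D & Hr4 & E4).
    exists (r4, D). simpl. split. le. apply o_app_iff.
    assert (H4 : r4 ≼ r1) by le. lift H4.
    eapply fmem_cong_l; [|exact Hy]. apply npair_cong; auto using feq_refl. }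
  apply choice in C as [f Hf].
  (* Many generic subsets share one nice name [D] of a real; the other summand of [names] is never
     hit and its fibre is empty. *)
  destruct (@pigeonhole _ 0 (fun xi => inr (snd (f xi)))) as [[v|D] Hv].
  { apply Hv. exists (fun _ _ => False). split; [intros ? ? ? []|]. intros xi E. discriminate. }
  destruct (compatible_pair (fun xi => fst (f xi)) Hv) as (xi & eta & u & Exi & Eeta & N & U1 & U2).
  assert (Exi' : snd (f xi) = D) by congruence. assert (Eeta' : snd (f eta) = D) by congruence.
  apply N. destruct (Hf xi) as [G1 G2]. destruct (Hf eta) as [G3 G4]. rewrite Exi' in G2. rewrite Eeta' in G4.
  apply (@gen_distinct _ 0 pn_pos xi eta u).
  apply (F3 (gen xi) (gen eta) (rel nnm bnm (low_rel 0 D)) u). le.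
  split; (eapply (proj1 (dn_stable _)); [|eassumption]); auto.
Qed.

Lemma emb_nat_Kl l : exists e : nat -> Kl l, injective e.
Proof.
  destruct (Kl_inhabited l) as [x]. destruct (choice _ (@Kl_unbounded l)) as [s Hs].
  exists (fun n => Nat.iter n s x).
  assert (Lt : forall n m, n < m -> klt (Nat.iter n s x) (Nat.iter m s x)).
  { intros n m H. induction H as [|m H IH]; simpl. apply Hs. eapply wo_trans; [apply kwo|exact IH|apply Hs]. }
  intros n m E. destruct (lt_eq_lt_dec n m) as [[H|H]|H]; auto; apply Lt in H; rewrite E in H;
    destruct (wo_irrefl (kwo l) _ H).
Qed.

(** The real [f] moved along [e] into [Kl 1] and set to false elsewhere, so that [f] can be
    recovered from it. *)
Definition pad (e : nat -> Kl 1) (f : name cond) (x : Kl 1) (b : bool) p :=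
  (exists i, x = e i /\ val nnm bnm f i b p) \/ ((forall i, x <> e i) /\ b = false).

Lemma pad_mono e f x b : mono (pad e f x b).
Proof.
  intros p q Hq [(i & E & H)|H]; [left|right; auto]. exists i. split; auto. lift Hq. auto.
Qed.

Lemma pad_fun e f p : injective e -> o_is_fun f omega two p ->
  o_is_fun (rel (kn 1) bnm (pad e f)) (kset 1) two p.
Proof.
  intros He Hf. apply is_fun_gset in Hf as (_ & HT & HF); try apply onm_distinct; try apply bnm_distinct.
  apply is_fun_rel; try apply onm_distinct; try apply bnm_distinct.
  - intros. apply pad_mono.
  - intros x q Hq. destruct (classic (exists i, x = e i)) as [[i ->]|N].
    + destruct (HT i q Hq) as (r & Hr & b & Hb). exists r. split; auto. exists b. left. eauto.
    + exists q. split; auto. exists false. right. split; auto. intros i E. eauto.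
  - intros x b b' q Hq [(i & -> & H)|[N ->]] [(i' & E & H')|[N' ->]]; auto.
    + apply He in E. subst i'. apply (HF i b b' q); auto.
    + destruct (N' i); auto.
    + destruct (N i'); auto.
Qed.

Lemma pad_cong e f g p : feq f g p -> feq (rel (kn 1) bnm (pad e f)) (rel (kn 1) bnm (pad e g)) p.
Proof.
  intro E. assert (H : forall f g, feq f g p -> forall a b q, q ≼ p -> pad e f a b q -> dn (pad e g a b) q).
  { clear. intros f g E a b q Hq K. apply dn_intro. apply pad_mono. lift Hq.
    destruct K as [(i & -> & K)|K]; [left|right; auto]. exists i. split; auto. exact (val_cong E K). }
  apply rel_ext; try (intros; apply pad_mono); apply H; auto using feq_sym.
Qed.

Lemma pad_inj e f g p : injective e -> o_is_fun f omega two p -> o_is_fun g omega two p ->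
  feq (rel (kn 1) bnm (pad e f)) (rel (kn 1) bnm (pad e g)) p -> feq f g p.
Proof.
  intros He Hf Hg E.
  eapply feq_trans. apply real_rel, Hf.
  eapply feq_trans; [|apply feq_sym, real_rel, Hg].
  assert (H : forall f g, feq (rel (kn 1) bnm (pad e f)) (rel (kn 1) bnm (pad e g)) p ->
     forall i b q, q ≼ p -> val nnm bnm f i b q -> dn (val nnm bnm g i b) q).
  { clear -He. intros f g E i b q Hq K. lift Hq.
    assert (V : val (kn 1) bnm (rel (kn 1) bnm (pad e f)) (e i) b q).
    { apply val_rel; try apply onm_distinct; try apply bnm_distinct. intros; apply pad_mono.
      apply dn_intro. apply pad_mono. left. eauto. }
    apply (val_cong E) in V. apply val_rel in V; try apply onm_distinct; try apply bnm_distinct; [|intros; apply pad_mono].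
    eapply dn_map. exact V. intros r Hr [(i' & Ei & K')|[N _]].
    apply He in Ei. subst. auto. destruct (N i); auto. }
  apply rel_ext; try (intros; apply val_stable); apply H; auto using feq_sym.
Qed.

Lemma reals_le p : o_card_le reals subsets1 p.
Proof.
  destruct (emb_nat_Kl 1) as [e He].
  pose (J := sup (fun R : nat -> bool -> cond -> Prop =>
       npair (rel nnm bnm R) (rel (kn 1) bnm (pad e (rel nnm bnm R))))
     (fun R => o_is_fun (rel nnm bnm R) omega two)).
  assert (MJ : forall z q, fmem z J q -> dn (fun r => exists f, o_is_fun f omega two r /\
     feq z (npair f (rel (kn 1) bnm (pad e f))) r) q).
  { intros z q H. eapply dn_map. exact H. intros r Hr (R & HR & E).
    exists (rel nnm bnm R). split; auto. apply dcl_of_mono in HR; auto. stab. }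
  assert (AJ : forall x y q, o_app J x y q -> dn (fun r => o_is_fun x omega two r /\
     feq y (rel (kn 1) bnm (pad e x)) r) q).
  { intros x y q H. apply o_app_iff, MJ in H. eapply dn_map. exact H. intros r Hr (f & Hf & E).
    apply npair_inj in E as [E1 E2]. split.
    - eapply o_is_fun_cong; [apply feq_sym, E1|apply feq_refl|apply feq_refl|exact Hf].
    - eapply feq_trans. exact E2. apply pad_cong, feq_sym, E1. }
  assert (IJ : forall f q, o_is_fun f omega two q -> o_app J f (rel (kn 1) bnm (pad e f)) q).
  { intros f q Hf. apply o_app_iff.
    assert (E : feq f (rel nnm bnm (val nnm bnm f)) q)
      by (apply real_rel; auto).
    eapply fmem_cong_l; [|apply (@fmem_intro _ _ (nat -> bool -> cond -> Prop) _ _ (val nnm bnm f))].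
    - apply feq_sym, npair_cong. exact E. apply pad_cong, E.
    - apply dcl_intro. eapply o_is_fun_cong; [exact E|apply feq_refl|apply feq_refl|exact Hf]. }
  apply oex_intro with J; [unfold o_is_inj; stab|]. split; [split|].
  - intros z q Hq H. apply MJ in H. below H r Hr H. destruct H as (f & Hf & E).
    apply oex_intro with f; [stab|]. apply oex_intro with (rel (kn 1) bnm (pad e f)); [stab|].
    split. apply mem_reals, Hf. split. apply mem_subsets1, pad_fun; auto. apply o_is_opair_iff, E.
  - intros x q Hq H. apply mem_reals in H. apply oex_intro with (rel (kn 1) bnm (pad e x)); [stab|].
    split. apply IJ, H. intros z r Hr K. apply AJ in K. below K s Hs K. apply K.
  - intros x x' y q Hq [K1 K2]. apply AJ in K1, K2. below K1 r Hr K1. destruct K1 as [X1 Y1].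
    below K2 s Hs K2. destruct K2 as [X2 Y2]. eapply pad_inj; eauto.
    eapply feq_trans; [apply feq_sym, Y1|exact Y2].
Qed.

Lemma continuum_lt_forced p : o_continuum_lt p.
Proof.
  intros q Hq. exists q. split; auto. exists omega.
  intros q1 Hq1. exists q1. split; auto. exists (kset 1).
  intros q2 Hq2. exists q2. split; auto. exists two.
  intros q3 Hq3. exists q3. split; auto. exists reals.
  intros q4 Hq4. exists q4. split; auto. exists subsets1.
  split. apply omega_is_omega. split. apply alephs, pn_pos. split. apply two_is_two.
  split; [|split; [|split]].
  - intro f. split; intros r Hr H; apply mem_reals; auto.
  - intro f. split; intros r Hr H; apply mem_subsets1; auto.
  - apply reals_le.
  - intros r Hr H. exact (not_card_le H).
Qed.
End Continuum.

(** * Weak diamond *)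

Section Fusion.
Context {pp : params}.
Variables (i : nat).
Hypothesis Hi : S i < pn.
Let l := S i.
Let K := Kl (S l).
Implicit Types (p q r u : cond).
Local Open Scope oprop_scope.

Notation kl := (kn (S l)).
Notation sg := (@seg cond (Kl (S l)) (@klt (S l)) (kwo (S l))).

Lemma kl_eq (x : K) : kl x = gset (@sg x).
Proof. apply onm_eq. Qed.

Variables (b c : name cond) (p0 : cond) (xi : Lam l).
Hypothesis Hb : o_is_fun b (kset (S l)) two p0.
Hypothesis Hc : o_is_club c (kset (S l)) p0.

Let R := val kl bnm b.

Lemma R_stable x v : stable (R x v).
Proof. apply val_stable. Qed.

Lemma R_total : total R p0.
Proof. apply is_fun_gset in Hb; [apply Hb|apply onm_distinct|apply bnm_distinct]. Qed.

Lemma R_functional : functional R p0.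
Proof. apply is_fun_gset in Hb; [apply Hb|apply onm_distinct|apply bnm_distinct]. Qed.

(** What the limit of the steps needs at the supremum of the ordinals [al]: there [b] is decided by
    lower parts, the club has been met cofinally, and the function at [xi] is still undefined. The
    part below level [l] never changes, so the limit is a union of upper levels. *)
Record stp (p : cond) (al : K) (p' : cond) (al' : K) : Prop := {
  stp_le : p' ≼ p;
  stp_lo : lole l p p';
  stp_lt : klt al al';
  stp_dec : forall y, klt y al -> decided l p' R y;
  stp_club : forall u, u ≼ p' -> exists v x, v ≼ u /\ klt al x /\ klt x al' /\ fmem (kl x) c v;
  stp_supp : forall x t, cp p' l xi x = Some t -> klt x al' }.

Lemma stp_exists p al : p ≼ p0 -> exists p' al', stp p al p' al'.
Proof.
  intro Hp.
  destruct (@decide_all _ {y : K | klt y al} l (fun y => R (proj1_sig y)) p) as (p1 & Hp1 & Hlo1 & D1).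
  - lia.
  - eapply cov_comap with (f := @proj1_sig _ _) (B := fun y => klt y al).
    + intros [x Lx] [y Ly] _ _ E. simpl in E. subst. f_equal. apply proof_irrelevance.
    + intros [x Lx] _. exact Lx.
    + apply seg_cov.
  - intros; apply R_stable.
  - intros [y Ly] q Hq. apply (R_total y). le.
  - destruct (@easton _ l unit (fun _ q => exists x, klt al x /\ fmem (kl x) c q) p1) as (p2 & Hp2 & Hlo2 & a & Fa & Da & Pa).
    + lia.
    + apply cov_sub with (2 := cov_sing l tt). intros [] _. auto.
    + intros _ q r Hr (x & Lx & H). exists x. split; auto. lift Hr. auto.
    + intros _ q Hq. assert (Hqp : q ≼ p0) by le. destruct Hc as (C1 & C2 & _).
      assert (H := C2 (kl al) q Hqp (mem_gset_intro kl al q)).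
      destruct (H q (ple_refl q)) as (r & Hr & x & Hx & Hal).
      assert (Hrp : r ≼ p0) by le.
      assert (Hk := C1 x r Hrp Hx). apply mem_oset in Hk.
      destruct (Hk r (ple_refl r)) as (s & Hs & x' & E). lift Hs.
      exists s. split. le. exists x'. split.
      * assert (M : fmem (kl al) (kl x') s) by (eapply fmem_cong_r; eauto). apply mem_onm_iff in M. exact M.
      * eapply fmem_cong_l; eauto.
    + assert (Ch : forall t, exists x, forall c', a tt t c' -> klt al x /\ fmem (kl x) c (comb l c' p2)).
      { intro t. destruct (classic (exists c', a tt t c')) as [[c' H]|N].
        - destruct (Da tt t c' H) as [x Hx]. exists x. intros c'' H'. rewrite <- (Fa _ _ _ _ H H'). exact Hx.
        - exists al. intros c' H. exfalso. eauto. }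
      apply choice in Ch as [X HX].
      destruct (support_bounded p2 xi) as [be Hbe].
      destruct (@Kl_bounded l (fun y => (y = al \/ y = be) \/ exists t, True /\ X t = y)) as [al' Hal'].
      { apply cov_union. apply cov_union; apply cov_sing. apply cov_rel. congruence. apply cov_self. }
      exists p2, al'. split.
      * le.
      * eapply lole_trans; eauto.
      * auto.
      * intros y Ly u Hu. assert (Hu1 : u ≼ p1) by le.
        assert (D := decided_mono (R := R) (x := y) (fun b => proj1 (R_stable y b)) Hp2 (D1 (exist _ y Ly))).
        exact (D u Hu).
      * intros u Hu. destruct (Pa tt u Hu) as (t & c' & v & Hat & Hv & Hvc).
        destruct (HX t c' Hat) as [L1 L2]. exists v, (X t). split; auto. split; auto. split.
        -- apply Hal'. right. eauto.
        -- lift Hvc. auto.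
      * intros x t E. apply (wo_trans (kwo (S l))) with be; eauto.
Qed.

Definition ub (k : Kl l) (f : forall k', klt k' k -> cond * K) (s : cond * K) : Prop :=
  fst s ≼ p0 /\ lole l p0 (fst s) /\
  forall k' (L : klt k' k), fst s ≼ fst (f k' L) /\ klt (snd (f k' L)) (snd s).

(** First a bound [s] of the earlier stages, then a step from it. The choice by [epsilon] lets the
    sequence be defined before the existence of [s] is known; [fseq_good] shows by induction that it
    always succeeds. *)
Definition fstep (k : Kl l) (f : forall k', klt k' k -> cond * K) : cond * K :=
  epsilon (inhabits (p0, epsilon (Kl_inhabited (S l)) (fun _ => True)))
    (fun s' => exists s, ub k f s /\ stp (fst s) (snd s) (fst s') (snd s')).

Definition fseq : Kl l -> cond * K := Fix (wo_wf (kwo l)) (fun _ => (cond * K)%type) fstep.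

Lemma fseq_eq k : fseq k = fstep k (fun k' _ => fseq k').
Proof.
  unfold fseq. rewrite Fix_eq. reflexivity. intros x f g H. replace g with f; auto.
  apply functional_extensionality_dep. intro y. apply functional_extensionality_dep. auto.
Qed.

Definition fgood (k : Kl l) := exists s, ub k (fun k' _ => fseq k') s /\
  stp (fst s) (snd s) (fst (fseq k)) (snd (fseq k)).

Lemma fgood_dec k k' : fgood k -> klt k' k ->
  fst (fseq k) ≼ fst (fseq k') /\ klt (snd (fseq k')) (snd (fseq k)).
Proof.
  intros (s & (U1 & U2 & U3) & St) L. destruct (U3 k' L) as [V1 V2]. destruct St as [S1 S2 S3 _ _ _].
  split. eapply ple_trans; eauto. apply (wo_trans (kwo (S l))) with (snd s); auto.
Qed.

Lemma fgood_p0 k : fgood k -> fst (fseq k) ≼ p0 /\ lole l p0 (fst (fseq k)).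
Proof.
  intros (s & (U1 & U2 & _) & St). destruct St as [S1 S2 _ _ _ _].
  split. eapply ple_trans; eauto. eapply lole_trans; eauto.
Qed.

Arguments fgood_dec {k k'} _ _.
Arguments fgood_p0 {k} _.

(** The stages are indexed within [Kl l], which [Tl l] covers, so their upper levels have a union;
    their lower parts are all equivalent to that of [p0]. The last clause keeps track of the domain
    at [xi], to keep the limit point free. *)
Lemma chain_bound (I : Kl l -> Prop) : (forall k, I k -> fgood k) ->
  exists q, q ≼ p0 /\ lole l p0 q /\ (forall k, I k -> q ≼ fst (fseq k)) /\
    forall x t, cp q l xi x = Some t -> cp p0 l xi x = Some t \/ exists k, I k /\ cp (fst (fseq k)) l xi x = Some t.
Proof.
  intro G.
  assert (A : forall k k' z, I k -> I k' -> agree z (fst (fseq k)) (fst (fseq k'))).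
  { intros k k' z Ik Ik' e x t t' E E'.
    destruct (wo_total (kwo l) k k') as [L|[<-|L]].
    - destruct (fgood_dec (G k' Ik') L) as [[_ H] _]. apply H in E. congruence.
    - congruence.
    - destruct (fgood_dec (G k Ik) L) as [[_ H] _]. apply H in E'. congruence. }
  destruct (@hi_union _ l p0 (fun s => s = p0 \/ exists k, I k /\ fst (fseq k) = s)) as (q & Q1 & Q2 & Q3).
  - lia.
  - apply cov_union. apply cov_sing. apply cov_rel. congruence. eapply cov_sub; [|apply Kl_cov]. intros ? _. exact Logic.I.
  - intros s s' z Lz [->|(k & Ik & <-)] [->|(k' & Ik' & <-)] e x t t' E E'.
    + congruence.
    + destruct (fgood_p0 (G k' Ik')) as [[_ H] _]. apply H in E. congruence.
    + destruct (fgood_p0 (G k Ik)) as [[_ H] _]. apply H in E'. congruence.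
    + exact (A k k' z Ik Ik' e x t t' E E').
  - assert (Lo : lole l q p0 /\ lole l p0 q).
    { unfold lole. rewrite Q1. split; (split; [apply hleq_refl|]); intros z Lz e x t E; apply Q2; auto. }
    exists q. split; [|split; [|split]].
    + apply (cle_iff l). split. apply Lo. intros z Lz e x t E. apply Q3; eauto.
    + apply Lo.
    + intros k Ik. apply (cle_iff l). split.
      * eapply lole_trans. apply Lo. apply fgood_p0, G, Ik.
      * intros z Lz e x t E. apply Q3; auto. exists (fst (fseq k)). split; auto. right. eauto.
    + intros x t E. apply Q3 in E as (s & [->|(k & Ik & <-)] & E); eauto.
Qed.

Lemma fseq_good k : fgood k.
Proof.
  induction k as [k IH] using (well_founded_ind (wo_wf (kwo l))).
  destruct (@chain_bound (fun k' => klt k' k) IH) as (q & Q1 & Q2 & Q3 & _).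
  destruct (@Kl_bounded l (fun y => exists k', True /\ snd (fseq k') = y)) as [al Hal].
  { apply cov_rel. congruence. apply Kl_cov. }
  destruct (stp_exists al Q1) as (p' & al' & St).
  unfold fgood. rewrite fseq_eq. unfold fstep.
  apply epsilon_spec. exists (p', al'). exists (q, al). split; [|exact St].
  split; [exact Q1|split; [exact Q2|]]. intros k' L. split; simpl; [apply Q3, L|apply Hal; eauto].
Qed.

Definition alpha k := snd (fseq k).

Lemma alpha_lt k k' : klt k k' -> klt (alpha k) (alpha k').
Proof. intro L. apply (fgood_dec (fseq_good k') L). Qed.

(** [de] is the least upper bound of the ordinals [alpha k]. At [xi] the limit condition has only
    values inherited from [p0] or a stage, and those lie below some [alpha k], hence below [de]. *)
Lemma fusion_limit : exists q de, q ≼ p0 /\ (forall k, q ≼ fst (fseq k)) /\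
  (forall k, klt (alpha k) de) /\ (forall y, klt y de -> exists k, klt y (alpha k)) /\
  cp q l xi de = None.
Proof.
  destruct (@chain_bound (fun _ => True)) as (q & Q1 & _ & Q3 & Q4); [intros; apply fseq_good|].
  destruct (@Kl_bounded l (fun y => exists k, True /\ alpha k = y)) as [be Hbe].
  { apply cov_rel. congruence. apply Kl_cov. }
  destruct (wo_least (kwo (S l)) (fun x => forall k, klt (alpha k) x)) as (de & H1 & H2).
  { exists be. eauto. }
  exists q, de. split; auto. split; auto. split; auto. split.
  - intros y Ly. apply NNPP. intro N. apply (H2 y Ly). intro k.
    destruct (Kl_unbounded l k) as [k' Lk]. destruct (wo_total (kwo (S l)) (alpha k) y) as [L|[E|L]]; auto; exfalso; apply N.
    + exists k'. rewrite <- E. apply alpha_lt; exact Lk.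
    + eauto.
  - destruct (cp q l xi de) as [t|] eqn:E; auto. exfalso.
    assert (Hx : exists k, klt de (alpha k)).
    { apply Q4 in E as [E|(k & _ & E)].
      - destruct (Kl_inhabited l) as [k]. exists k. destruct (fseq_good k) as (s & _ & St).
        apply (stp_supp St de (t := t)). apply (fgood_p0 (fseq_good k)). exact E.
      - exists k. destruct (fseq_good k) as (s & _ & St). apply (stp_supp St de E). }
    destruct Hx as [k Lk]. apply (wo_irrefl (kwo (S l)) de). eapply wo_trans; [apply kwo|exact Lk|apply H1].
Qed.

Section Limit.
Variables (q : cond) (de : K).
Hypothesis Q0 : q ≼ p0.
Hypothesis Qk : forall k, q ≼ fst (fseq k).
Hypothesis D1 : forall k, klt (alpha k) de.
Hypothesis D2 : forall y, klt y de -> exists k, klt y (alpha k).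

Lemma limit_decided y : klt y de -> decided l q R y.
Proof.
  intro Ly. destruct (D2 _ Ly) as [k Lk]. destruct (Kl_unbounded l k) as [k' Lk'].
  destruct (fseq_good k') as (s & (_ & _ & U) & St).
  apply decided_mono with (fst (fseq k')); auto. intros; apply R_stable.
  apply (stp_dec St). apply (wo_trans (kwo (S l))) with (alpha k); auto. apply (U k Lk').
Qed.

Lemma limit_club : fmem (kl de) c q.
Proof.
  destruct Hc as (_ & _ & C3). apply (C3 (kl de) q Q0). split; [|split].
  - apply mem_gset_intro.
  - destruct (Kl_inhabited l) as [k]. apply onm_is_limit. exists (alpha k). auto.
    intros y Ly. destruct (D2 _ Ly) as [k' Lk]. eauto.
  - intros a u Hu Ha. apply mem_onm in Ha. below Ha u1 Hu1 Ha. destruct Ha as (y & Ly & E).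
    destruct (D2 _ Ly) as [k Lk]. destruct (Kl_unbounded l k) as [k' Lk'].
    destruct (fseq_good k') as (s & (_ & _ & U) & St).
    intros u2 Hu2. assert (Hu2' : u2 ≼ fst (fseq k')). { assert (Hk := Qk k'). le. }
    destruct (stp_club St Hu2') as (v & x & Hv & L1 & L2 & M).
    exists v. split; auto. exists (kl x). split; auto. split.
    + apply mem_onm_intro. eapply wo_trans; [apply kwo|exact L2|apply D1].
    + assert (Hvu : v ≼ u1) by le. lift Hvu. eapply fmem_cong_l. apply feq_sym, E.
      apply mem_onm_intro. apply (wo_trans (kwo (S l))) with (alpha k); auto.
      eapply wo_trans; [apply kwo|apply (U k Lk')|exact L1].
Qed.

(** The map [alpha] is cofinal in [de]. Conversely, [cover] one level down confines a map from [y]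
    in [Kl l] to ground values covered by [Tl i]; by regularity of [Kl (S i)] they stay below one
    [alpha ks]. *)
Lemma limit_cof r : o_is_cof (kset l) (kl de) r.
Proof.
  split; [apply oset_is_ord|split].
  - apply oex_intro with (rel (kn l) (@sg de) (fun k y _ => proj1_sig y = alpha k)).
    { unfold o_ord_le. stab. }
    split.
    + rewrite kl_eq. apply is_fun_rel; try apply onm_distinct; try apply seg_distinct.
      * intros k y u v _ E. exact E.
      * intros k u Hu. exists u. split; auto. exists (exist _ (alpha k) (D1 k)). reflexivity.
      * intros k [y Ly] [y' Ly'] u _ E E'. simpl in *. subst. f_equal. apply proof_irrelevance.
    + intros z u Hu Hz. apply mem_onm in Hz. below Hz v Hv Hz. destruct Hz as (y & Ly & E).
      destruct (D2 _ Ly) as [k Lk].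
      apply oex_intro with (kn l k); [unfold o_ord_le; stab|].
      apply oex_intro with (kl (alpha k)); [unfold o_ord_le; stab|]. split.
      * apply o_app_iff.
        apply (val_rel (na := kn l) (nb := @sg de)) with (b := exist _ (alpha k) (D1 k)) (a := k).
        apply onm_distinct. apply seg_distinct. intros k1 y1 w1 w2 _ E1. exact E1.
        intros w Hw. exists w. split; auto.
      * apply oor_l. stab. eapply fmem_cong_l. apply feq_sym, E. apply mem_onm_intro. auto.
  - intros z u Hu Hz v Hv H. apply mem_oset in Hz. destruct (Hz v Hv) as (w & Hw & y & E).
    assert (H' : o_cofinal_map_from (kn l y) (kl de) w).
    { eapply o_cofinal_map_from_cong. exact E. apply feq_refl.
      eapply (proj1 (oex_stable _)); [exact Hw|exact H]. }
    destruct (H' w (ple_refl w)) as (w1 & Hw1 & f & Hf & Cf).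
    unfold kn in Hf. rewrite (onm_eq (kwo l) y) in Hf. change (onm (kwo (S l)) de) with (kl de) in Hf. rewrite kl_eq in Hf.
    apply is_fun_gset in Hf as (Pf & Tf & Ff); try apply seg_distinct.
    destruct (@cover _ i {y' : Kl l | klt y' y} {x : K | klt x de} (val (@seg _ _ _ (kwo l) y) (@sg de) f) w1)
      as (w2 & Hw2 & _ & Y & CY & HY).
    + lia.
    + eapply cov_comap with (f := @proj1_sig _ _) (B := fun y' => klt y' y).
      * intros [x Lx] [x' Lx'] _ _ Ex. simpl in Ex. subst. f_equal. apply proof_irrelevance.
      * intros [x Lx] _. exact Lx.
      * apply (@seg_cov i y).
    + intros; apply val_stable.
    + exact Ff.
    + assert (Ix : exists ix : {x : K | klt x de} -> Kl l, forall x, klt (proj1_sig x) (alpha (ix x))).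
      { apply (choice (fun (x : {x : K | klt x de}) k => klt (proj1_sig x) (alpha k))). intros [x Lx]. apply D2; exact Lx. }
      destruct Ix as [ix Hix].
      destruct (@Kl_bounded i (fun k => exists x, (exists y', True /\ Y y' x) /\ ix x = k)) as [ks Hks].
      { apply cov_rel. congruence. apply cov_bigcup; auto. apply emb_TlTl.
        eapply cov_comap with (f := @proj1_sig _ _) (B := fun y' => klt y' y).
        * intros [x Lx] [x' Lx'] _ _ Ex. simpl in Ex. subst. f_equal. apply proof_irrelevance.
        * intros [x Lx] _. exact Lx.
        * apply (@seg_cov i y). }
      assert (Hm : fmem (kl (alpha ks)) (kl de) w2) by (apply mem_onm_intro, D1).
      destruct (Cf _ w2 Hw2 Hm w2 (ple_refl w2)) as (w3 & Hw3 & x & Hx).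
      destruct (Hx w3 (ple_refl w3)) as (w4 & Hw4 & z' & A & Lz).
      apply o_app_iff in A. assert (Hw41 : w4 ≼ w1) by le.
      destruct (Pf _ w4 Hw41 A w4 (ple_refl w4)) as (w5 & Hw5 & y' & x' & E').
      assert (A' : val (@seg _ _ _ (kwo l) y) (@sg de) f y' x' w5).
      { eapply fmem_cong_l. exact E'. lift Hw5. exact A. }
      apply npair_inj in E' as [_ E'].
      assert (Hw52 : w5 ≼ w2) by le.
      assert (Yx := HY y' x' w5 Hw52 A').
      assert (Lk : klt (ix x') ks) by (apply Hks; exists x'; eauto).
      assert (L1 := wo_trans (kwo (S l)) _ _ _ (Hix x') (alpha_lt _ _ Lk)).
      assert (Lz' : o_ord_le (kl (alpha ks)) (kl (proj1_sig x')) w5).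
      { eapply o_ord_le_cong. apply feq_refl. exact E'. eapply (proj1 (oor_stable _ _)); [exact Hw5|exact Lz]. }
      apply ord_le_iff in Lz'. destruct Lz' as [L2|L2].
      * apply (wo_irrefl (kwo (S l)) (alpha ks)). eapply wo_trans; [apply kwo|exact L2|exact L1].
      * rewrite L2 in L1. exact (wo_irrefl (kwo (S l)) _ L1).
Qed.

Definition code : K -> bool -> RT l -> Prop := low l q R.
(** The sequence of length [de] described by the code [D]. It depends on [de] and [D] only, so two
    indices with the same code name the same sequence. *)
Definition bst (de : K) (D : K -> bool -> RT l -> Prop) : name cond :=
  rel (@sg de) bnm (low_rel l (fun y => D (proj1_sig y))).

Lemma code_iff y v u : klt y de -> u ≼ q -> R y v u <-> dn (low_rel l code y v) u.
Proof.
  intros Ly Hu. apply low_iff; auto. intros; apply R_stable. apply limit_decided; exact Ly.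
  intros v1 v2 w Hw. apply R_functional. le.
Qed.

Lemma bst_fun : o_is_fun (bst de code) (kl de) two q.
Proof.
  rewrite kl_eq. apply is_fun_rel.
  - apply seg_distinct.
  - apply bnm_distinct.
  - intros; apply dcl_mono.
  - intros [y Ly] u Hu. assert (Hup : u ≼ p0) by le. destruct (R_total y Hup) as (w & Hw & v & H).
    assert (Hwq : w ≼ q) by le. apply (code_iff y v Ly Hwq) in H. destruct (H w (ple_refl w)) as (s & Hs & H').
    exists s. split. le. exists v. exact H'.
  - intros [y Ly] v v' u Hu H H'. assert (Hup : u ≼ p0) by le.
    apply (R_functional y v v' Hup); apply code_iff; auto;
      (apply dn_intro; [apply dcl_mono|]); assumption.
Qed.

Lemma bst_restr : o_is_restr (bst de code) b (kl de) q.
Proof.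
  assert (Pb := Hb). apply is_fun_gset in Pb as (Pb & _); try apply onm_distinct; try apply bnm_distinct.
  intro z. split; intros u Hu H.
  - apply mem_rel in H; [|intros; apply dcl_mono].
    refine (dn_elim _ H _); [stab|]. clear H. intros w Hw ([y Ly] & v & H & E).
    assert (Hwq : w ≼ q) by le.
    assert (Hr : R y v w). { apply code_iff; auto. apply dn_intro. apply dcl_mono. exact H. }
    split.
    + eapply fmem_cong_l. apply feq_sym, E. exact Hr.
    + apply oex_intro with (kl y); [stab|]. apply oex_intro with (bnm v); [stab|].
      split. apply mem_onm_intro, Ly. apply o_is_opair_iff, E.
  - destruct H as [Hz H]. below H w Hw H. destruct H as (x & H). below H w1 Hw1 H. destruct H as (y & Hx & E).
    apply mem_onm in Hx. below Hx w2 Hw2 Hx. destruct Hx as (y0 & Ly & Ex).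
    apply o_is_opair_iff in E. assert (Hwp : w2 ≼ p0) by le.
    assert (Pz := Pb z w2 Hwp Hz). below Pz w3 Hw3 Pz. destruct Pz as (y1 & v & Ez).
    assert (Eq : feq (npair x y) (npair (kl y1) (bnm v)) w3) by (eapply feq_trans; [apply feq_sym, E|exact Ez]).
    apply npair_inj in Eq as [Eq _].
    assert (y1 = y0). { apply (@onm_distinct _ _ _ _ (kwo (S l)) y1 y0 w3). eapply feq_trans. apply feq_sym, Eq. exact Ex. }
    subst y1. assert (Hr : R y0 v w3) by (eapply fmem_cong_l; [exact Ez|exact Hz]).
    assert (Hwq : w3 ≼ q) by le. apply (code_iff y0 v Ly Hwq) in Hr.
    apply mem_rel; [intros; apply dcl_mono|]. eapply dn_map. exact Hr. intros w4 Hw4 Hr'.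
    exists (exist _ y0 Ly), v. split. exact Hr'. lift Hw4. exact Ez.
Qed.
End Limit.

Lemma fusion : exists q de D, q ≼ p0 /\ cp q l xi de = None /\ fmem (kl de) c q /\
  o_is_cof (kset l) (kl de) q /\ o_is_restr (bst de D) b (kl de) q /\ o_is_fun (bst de D) (kl de) two q.
Proof.
  destruct fusion_limit as (q & de & H1 & H2 & H3 & H4 & H5).
  exists q, de, (code q). split; auto. split; auto. split; [|split; [|split]].
  - apply limit_club; auto.
  - apply limit_cof; auto.
  - apply bst_restr; auto.
  - apply bst_fun; auto.
Qed.
End Fusion.

(** * Two generic functions against one value of [F] *)

Section WeakDiamond.
Context {pp : params}.
Variables (i : nat).
Hypothesis Hi : S i < pn.
Let l := S i.
Implicit Types (p q r u : cond).
Local Open Scope oprop_scope.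

Notation kl := (kn (S l)).
Notation sg := (@seg cond (Kl (S l)) (@klt (S l)) (kwo (S l))).

Definition mark (de : Kl (S l)) (xi : Lam l) : point := inr (existT _ l (xi, de)).

Lemma trace_mark m de xi q : l < m -> trace m q (mark de xi) = None <-> cp q l xi de = None.
Proof.
  intro L. simpl. destruct (lt_dec l m) as [L'|]; [|lia]. destruct (cp q l xi de); simpl; split; congruence.
Qed.

(* A marker at [(xi, de)] is added to the condition of index [xi], so that
   compatibility of the marked conditions makes the marked points free. *)
Lemma free_pair (de : Kl (S l)) (q : Lam l -> cond) (A : Lam l -> Prop) :
  (forall xi, A xi -> cp (q xi) l xi de = None) -> ~ cov (Tl pn) A ->
  exists xi eta, A xi /\ A eta /\ xi <> eta /\ cp (q xi) l eta de = None /\ cp (q eta) l xi de = None /\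
    forall z s t, trace pn (q xi) z = Some s -> trace pn (q eta) z = Some t -> s = t.
Proof.
  intros HA N. apply NNPP. intro K. apply N.
  assert (Ll : l < pn) by exact Hi.
  pose (f := fun (xi : Lam l) (z : point) => if excluded_middle_informative (z = mark de xi) then Some None
    else option_map Some (trace pn (q xi) z)).
  assert (f1 : forall xi, f xi (mark de xi) = Some None).
  { intro xi. unfold f. destruct excluded_middle_informative; congruence. }
  assert (f2 : forall xi z s, A xi -> trace pn (q xi) z = Some s -> f xi z = Some (Some s)).
  { intros xi z s Ax E. unfold f. destruct excluded_middle_informative as [->|].
    - assert (K' := proj2 (trace_mark de xi (q xi) Ll) (HA xi Ax)). congruence.
    - rewrite E. reflexivity. }
  apply (antichain_cov (xl0 pn)) with (f := f).
  - assert (E : emb (stems + Tl pn) (Tl pn)) by apply trace_values.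
    destruct E as [g Hg].
    exists (fun o => match o with None => none | Some v => some (g v) end).
    intros [v|] [w|] E; auto.
    + apply (some_inj (xl0 pn)) in E. f_equal. auto.
    + apply (some_none (xl0 pn)) in E. destruct E.
    + symmetry in E. apply (some_none (xl0 pn)) in E. destruct E.
  - intros xi _. apply cov_sub with (fun z => exists b : bool, True /\ if b then z = mark de xi else trace pn (q xi) z <> None).
    + intros z H. unfold f in H. destruct excluded_middle_informative as [E|E].
      * exists true. auto.
      * exists false. split; auto. destruct (trace pn (q xi) z); simpl in H; congruence.
    + apply cov_bigcup.
      * exists (fun ab => node (fst ab) (snd ab)). intros [x y] [x' y'] H. simpl in H. injection H as -> ->. auto.
      * apply cov_of_emb. eapply emb_trans; [|apply (emb_nat_tree (xl0 pn))].
        exists (fun b : bool => if b then 0 else 1). intros [] []; congruence.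
      * intros [] _; [|apply trace_cov]. exists (fun _ y => y = mark de xi). split; [congruence|].
        intros y Hy. exists (leaf (xl0 pn)). auto.
  - intros xi eta Ax Ae Ne. apply NNPP. intro C. apply K.
    assert (free : forall xi eta, A xi -> A eta -> xi <> eta ->
      ~ (exists z v w, f xi z = Some v /\ f eta z = Some w /\ v <> w) -> cp (q eta) l xi de = None).
    { clear -f1 f2 Ll Hi. intros xi eta Ax Ae Ne C. apply (proj1 (trace_mark de xi (q eta) Ll)).
      destruct (trace pn (q eta) (mark de xi)) as [s|] eqn:E; auto. exfalso. apply C.
      exists (mark de xi), None, (Some s). split; auto. split; auto. discriminate. }
    exists xi, eta. split; auto. split; auto. split; auto. split; [|split].
    + apply free with (xi := eta); auto. intros (z & v & w & H1 & H2 & H3). apply C. exists z, w, v. auto.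
    + apply free with (xi := xi); auto.
    + intros z s t Es Et. apply NNPP. intro Nst. apply C. exists z, (Some s), (Some t).
      split; auto. split; auto. congruence.
Qed.

(** [free_pair] leaves both [(xi, de)] and [(eta, de)] undefined in both conditions, so opposite
    bits can be written there without losing compatibility. *)
Lemma split_pair (de : Kl (S l)) (q : Lam l -> cond) (A : Lam l -> Prop) :
  (forall xi, A xi -> cp (q xi) l xi de = None) -> ~ cov (Tl pn) A ->
  exists xi eta u, A xi /\ A eta /\ u ≼ q xi /\ u ≼ q eta /\ gbit xi de true u /\ gbit eta de false u.
Proof.
  intros HA N. destruct (free_pair de q HA N) as (xi & eta & Ax & Ae & Ne & F1 & F2 & T).
  assert (Ll : l < pn) by exact Hi.
  destruct (set_gbit xi de true (q xi) Ll (HA xi Ax)) as (a & La & Ca & Ba & Oa & Da).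
  destruct (set_gbit eta de false (q eta) Ll (HA eta Ae)) as (b & Lb & Cb & Bb & Ob & Db).
  assert (C : locompat pn a b).
  { apply agree_locompat.
    - intros z s t Hs Ht. rewrite Ca in Hs. rewrite Cb in Ht.
      assert (E := T (inl z)). simpl in E. rewrite Hs, Ht in E. simpl in E.
      specialize (E _ _ eq_refl eq_refl). congruence.
    - assert (G : forall l', l' < pn -> agree l' (q xi) (q eta)).
      { intros l' L' e x t t' E E'. assert (H := T (inr (existT _ l' (e, x)))). simpl in H.
        destruct (lt_dec l' pn) as [L''|]; [|lia]. rewrite E, E' in H. simpl in H.
        specialize (H _ _ eq_refl eq_refl). injection H as H. eapply tr_val_inj; eauto. }
      intros l' L' e x t t' E E'. destruct (Nat.eq_dec l' l) as [->|Nl].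
      + destruct (Da _ _ _ E) as [E1|[-> ->]]; destruct (Db _ _ _ E') as [E2|[E2 E3]].
        * exact (G l L' e x t t' E1 E2).
        * subst. congruence.
        * congruence.
        * congruence.
      + apply (G l' L' e x t t'). apply (Oa l' Nl), E. apply (Ob l' Nl), E'. }
  destruct C as (u & U1 & U2).
  assert (HI : forall p, hile pn u p).
  { intros p z L e x t E. rewrite cp_bound in E; [discriminate|auto]. }
  assert (Ua : u ≼ a) by (apply (cle_iff pn); auto).
  assert (Ub : u ≼ b) by (apply (cle_iff pn); auto).
  exists xi, eta, u. split; auto. split; auto. split. le. split. le.
  split; [exact (gbit_mono Ua Ba)|exact (gbit_mono Ub Bb)].
Qed.

Definition binseq : name cond :=
  sup (fun aR : {a : Kl (S l) & {y | klt y a} -> bool -> cond -> Prop} =>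
         rel (@sg (projT1 aR)) bnm (projT2 aR))
      (fun aR => o_is_fun (rel (@sg (projT1 aR)) bnm (projT2 aR)) (kl (projT1 aR)) two).

Lemma mem_binseq s p : fmem s binseq p <-> (∃ a : name cond, a ∈ kset (S l) ∧ o_is_fun s a two) p.
Proof.
  split; intro H.
  - below H q Hq H. destruct H as ([a R] & HR & E). apply dcl_of_mono in HR; [|stab]. simpl in *.
    apply oex_intro with (kl a); [stab|]. split. apply mem_gset_intro.
    eapply o_is_fun_cong; [apply feq_sym, E|apply feq_refl|apply feq_refl|exact HR].
  - below H q Hq H. destruct H as (z & Hz & Hs). apply mem_oset in Hz.
    below Hz r Hr Hz. destruct Hz as [a E].
    assert (Hs' : o_is_fun s (kl a) two r).
    { eapply o_is_fun_cong; [apply feq_refl|exact E|apply feq_refl|exact Hs]. }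
    assert (Es : feq s (rel (@sg a) bnm (val (@sg a) bnm s)) r).
    { apply (@fun_eq_rel cond _ _ bool (@sg a) bnm). apply seg_distinct. apply bnm_distinct.
      rewrite (kl_eq i a) in Hs'. exact Hs'. }
    eapply fmem_cong_l. apply feq_sym, Es.
    refine (@fmem_el_intro cond _ binseq (existT (fun a : Kl (S l) => {y | klt y a} -> bool -> cond -> Prop) a (val (@sg a) bnm s)) r _).
    apply dcl_intro. simpl. eapply o_is_fun_cong; [exact Es|apply feq_refl|apply feq_refl|exact Hs'].
Qed.

Definition cofset : name cond := comp kl (fun z => z ∈ kset (S l) ∧ o_is_cof (kset l) z).

Lemma mem_cofset z p : fmem z cofset p <-> (z ∈ kset (S l) ∧ o_is_cof (kset l) z) p.
Proof.
  apply (@fmem_comp cond _ (Kl (S l)) kl (fun z => z ∈ kset (S l) ∧ o_is_cof (kset l) z)).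
  - intro. stab.
  - intros x y q E [H1 H2]. split. eapply fmem_cong_l; eauto. eapply o_is_cof_cong; [apply feq_refl|exact E|exact H2].
  - intros x q [H _]. apply mem_oset in H. exact H.
Qed.

Definition guesses (F g b z : name cond) : cond -> Prop :=
  z ∈ cofset ∧ ∃ r v : name cond, o_is_restr r b z ∧ o_app F r v ∧ o_app g z v.
Definition guessed (F g b : name cond) : name cond := comp kl (guesses F g b).

Lemma guesses_stable F g b z : stable (guesses F g b z).
Proof. unfold guesses. stab. Qed.

Lemma mem_guessed F g b z p : fmem z (guessed F g b) p <-> guesses F g b z p.
Proof.
  apply (@fmem_comp cond _ (Kl (S l)) kl (guesses F g b)).
  - apply guesses_stable.
  - intros x y q E [H1 H2]. split. eapply fmem_cong_l; eauto.
    below H2 r Hr H2. destruct H2 as (s & H2). below H2 r1 Hr1 H2. destruct H2 as (v & A & B & C).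
    apply oex_intro with s; [stab|]. apply oex_intro with v; [stab|]. split; [|split]; auto.
    + eapply o_is_restr_cong; [apply feq_refl|apply feq_refl|exact E|exact A].
    + apply o_app_iff. apply o_app_iff in C. eapply fmem_cong_l; [|exact C].
      apply npair_cong; auto using feq_refl.
  - intros x q [H _]. apply mem_cofset in H. destruct H as [H _]. apply mem_oset in H. exact H.
Qed.

(** Take a counterexample [b] and a club [c] that avoids the set of correct guesses. Fusion gives a
    point [de] of [c] with the right cofinality and a lower code of [b] restricted to [de]; a common
    value of [F] and [gen xi] there would be a correct guess in [c]. *)
Lemma failure F p xi :
  (forall q, q ≼ p -> ~ (∀ b : name cond, o_is_fun b (kset (S l)) two ⇒
     ∃ t : name cond, o_is_stationary t (kset (S l)) ∧
       ∀ z : name cond, z ∈ t ⇔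
         (z ∈ cofset ∧ ∃ r v : name cond, o_is_restr r b z ∧ o_app F r v ∧ o_app (gen xi) z v)) q) ->
  exists q de D, q ≼ p /\ cp q l xi de = None /\ o_is_fun (bst de D) (kl de) two q /\
    forall r v, r ≼ q -> o_app F (bst de D) (bnm v) r -> gbit xi de v r -> False.
Proof.
  intro H. specialize (H p (ple_refl p)).
  apply not_all_ex_not in H as [b H].
  assert (H' : exists q, q ≼ p /\ o_is_fun b (kset (S l)) two q /\ ~ (∃ t : name cond, o_is_stationary t (kset (S l)) ∧
       ∀ z : name cond, z ∈ t ⇔
         (z ∈ cofset ∧ ∃ r v : name cond, o_is_restr r b z ∧ o_app F r v ∧ o_app (gen xi) z v)) q).
  { apply NNPP. intro N. apply H. intros q Hq K. apply NNPP. intro N'. apply N. eauto. }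
  clear H. destruct H' as (q & Hq & Hb & Hn).
  apply not_stable_ext in Hn as (q1 & Hq1 & Hn); [|apply oex_stable].
  assert (Ns : ~ o_is_stationary (guessed F (gen xi) b) (kset (S l)) q1).
  { intro K. apply (Hn q1 (ple_refl q1)). intros r Hr. exists r. split; auto.
    exists (guessed F (gen xi) b). split.
    - refine (proj1 (rf_stable2 is_stationary o_is_stationary _ _ _) _ _ Hr K). apply rf_is_stationary.
    - intro z. split; intros s Hs; apply mem_guessed. }
  assert (Nc : exists q2 c, q2 ≼ q1 /\ o_is_club c (kset (S l)) q2 /\
     ~ (∃ x : name cond, x ∈ c ∧ x ∈ guessed F (gen xi) b) q2).
  { apply NNPP. intro N. apply Ns. split.
    - intros z r Hr Hz. apply mem_guessed in Hz as [Hz _]. apply mem_cofset in Hz. apply Hz.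
    - intros c r Hr Hc. apply NNPP. intro N'. apply N. exists r, c. auto. }
  destruct Nc as (q2 & c & Hq2 & Hc & Nx).
  apply not_stable_ext in Nx as (q3 & Hq3 & Nx); [|apply oex_stable].
  assert (Hq31 : q3 ≼ q) by le. lift Hq31. lift Hq3.
  destruct (fusion Hi xi Hb Hc) as (q4 & de & D & F1 & F2 & F3 & F4 & F5 & F6).
  exists q4, de, D. split. le. split; auto. split; auto.
  intros r v Hr HF Hg. lift Hr.
  assert (Hr3 : r ≼ q3) by le. apply (Nx r Hr3). apply oex_intro with (kl de); [stab|].
  split; auto. apply mem_guessed. split.
  - apply mem_cofset. split; auto. apply mem_gset_intro.
  - apply oex_intro with (bst de D); [stab|]. apply oex_intro with (bnm v); [stab|].
    split; auto. split; auto. apply o_app_iff. apply val_gen, Hg.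
Qed.

Lemma weak_diamond_forced p : o_weak_diamond cofset (kset (S l)) p.
Proof.
  intros p1 Hp1. exists p1. split; auto. exists two.
  intros p2 Hp2. exists p2. split; auto. exists binseq.
  split. apply two_is_two. split.
  { intro s. split; intros r Hr; apply mem_binseq. }
  intros F q0 Hq0 HF q Hq. lift Hq. apply NNPP. intro N.
  assert (W : forall xi : Lam l, exists w : cond * (Kl (S l) * (Kl (S l) -> bool -> RT l -> Prop)),
    fst w ≼ q /\ cp (fst w) l xi (fst (snd w)) = None /\
    o_is_fun (bst (fst (snd w)) (snd (snd w))) (kl (fst (snd w))) two (fst w) /\
    forall r v, r ≼ fst w -> o_app F (bst (fst (snd w)) (snd (snd w))) (bnm v) r ->
      gbit xi (fst (snd w)) v r -> False).
  { intro xi. destruct (@failure F q xi) as (r & de & D & H).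
    - intros r Hr K. apply N. exists r. split; auto. exists (gen xi). split; [|exact K].
      apply gen_fun. exact Hi.
    - exists (r, (de, D)). exact H. }
  apply choice in W as [w Hw].
  (* The left summand of [names] counts the pairs of a point and a code, so a large set of indices
     shares both. *)
  destruct (@pigeonhole _ l (fun xi => inl (snd (w xi)))) as [[[de D]|f] Hv].
  2: { apply Hv. exists (fun _ _ => False). split; [intros ? ? ? []|]. intros xi E. discriminate. }
  assert (E : forall xi, inl (snd (w xi)) = inl (de, D) :> names (RT l) l -> snd (w xi) = (de, D)) by (intros; congruence).
  destruct (@split_pair de (fun xi => fst (w xi)) (fun xi => snd (w xi) = (de, D))) as (xi & eta & u & Ex & Ee & U1 & U2 & B1 & B2).
  - intros xi Exi. destruct (Hw xi) as (_ & H & _). rewrite Exi in H. exact H.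
  - intro C. apply Hv. eapply cov_sub; [|exact C]. intros xi. apply E.
  - cbv beta in U1, U2. destruct (Hw xi) as (X1 & _ & X2 & X3). destruct (Hw eta) as (_ & _ & _ & Y3).
    rewrite Ex in X2, X3. rewrite Ee in Y3. simpl in X2, X3, Y3.
    assert (Huq : u ≼ q) by le. lift Huq.
    assert (X2' := proj1 (o_is_fun_stable _ _ _) _ _ U1 X2).
    assert (HB : fmem (bst de D) binseq u).
    { apply mem_binseq. apply oex_intro with (kl de); [stab|]. split; auto. apply mem_gset_intro. }
    destruct HF as [HF1 HF2].
    destruct (HF2 _ u (ple_refl u) HB u (ple_refl u)) as (u1 & Hu1 & y & Hy & _).
    assert (Hy' := Hy). apply o_app_iff in Hy'.
    destruct (HF1 _ u1 Hu1 Hy' u1 (ple_refl u1)) as (u2 & Hu2 & x' & K).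
    destruct (K u2 (ple_refl u2)) as (u3 & Hu3 & y' & _ & Ky & Ep).
    apply o_is_opair_iff, npair_inj in Ep as [_ Ep].
    assert (Ky' : fmem y two u3) by (eapply fmem_cong_l; [apply feq_sym, Ep|exact Ky]).
    apply mem_gset in Ky'. destruct (Ky' u3 (ple_refl u3)) as (u4 & Hu4 & v & Ev).
    assert (H4 : u4 ≼ u1) by le.
    assert (HA : o_app F (bst de D) (bnm v) u4).
    { apply o_app_iff. lift H4. eapply fmem_cong_l; [|exact Hy']. apply npair_cong; auto using feq_refl. }
    (* Whatever value [F] gives to the shared sequence, one of the two functions takes it at [de]:
       [xi] if it is true, [eta] if it is false. *)
    assert (H5 : u4 ≼ u) by le. destruct v.
    + apply (X3 u4 true); auto. le. eapply gbit_mono; eauto.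
    + apply (Y3 u4 false); auto. apply (ple_trans _ u); auto. eapply gbit_mono; eauto.
Qed.

(** The index is a successor because the computation of the cofinality applies [cover] one level
    lower. *)
Lemma weak_diamond_cof_forced p : o_weak_diamond_cof (S i) p.
Proof.
  intros p1 Hp1. exists p1. split; auto. exists (kset l).
  intros p2 Hp2. exists p2. split; auto. exists (kset (S l)).
  intros p3 Hp3. exists p3. split; auto. exists cofset.
  split. apply alephs. unfold l; lia.
  split. rewrite Nat.add_1_r. apply alephs. exact Hi.
  split; [|apply weak_diamond_forced].
  intro z. split; intros r Hr; apply mem_cofset.
Qed.
End WeakDiamond.

Lemma trivial_condition {pp : params} : cond.
Proof.
  refine {| ch := Raw (fun _ => None); cp := fun l xi x => None |}; auto.
  - exists []. intros a H. destruct (H eq_refl).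
  - intro l. exists (fun _ _ => False). split; [intros ? ? ? []|]. intros x H. destruct (H eq_refl).
Qed.

Lemma weak_diamonds_forced {pp : params} (e : nat -> name cond) d p :
  forces (weak_diamonds_below pn d) e p.
Proof.
  unfold weak_diamonds_below.
  assert (H : forall i, In i (seq 1 (pn - 1)) -> 1 <= i < pn) by (intros i H; apply in_seq in H; lia).
  induction (seq 1 (pn - 1)) as [|i js IH]; cbn [fold_right].
  - intros q Hq K. exact K.
  - match goal with |- forces (fAnd ?A ?B d) e p =>
      assert (E : forces (fAnd A B d) e = oand (o_weak_diamond_cof i) (forces (B d) e))
        by (apply rf_and; [apply rf_weak_diamond_cof|reflexivity]) end.
    rewrite E.
    destruct (H i (or_introl eq_refl)) as [H1 H2].
    split; [|apply IH; intros j Hj; apply H; right; auto].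
    destruct i as [|i]; [lia|]. apply weak_diamond_cof_forced. auto.
Qed.

Theorem theorem5p4 (k n : nat) (hk : 1 <= k) (hkn : k <= n) :
  relatively_consistent ZFC
    (sentence
       (fAnd (cofinal_iso k n) (fAnd continuum_lt (weak_diamonds_below n)))).
Proof.
  pose (pp := {| pk := k; pn := n; pk_pos := hk; pk_le := hkn |}).
  apply (@relatively_consistent_of_forced cond cond_poset _ (@trivial_condition pp)).
  intros e p. unfold sentence.
  assert (E : forces (fAnd (cofinal_iso k n) (fAnd continuum_lt (weak_diamonds_below n)) 0) e =
    oand (o_cofinal_iso k n) (oand o_continuum_lt (forces (weak_diamonds_below n 0) e))).
  { apply rf_and. apply rf_cofinal_iso. apply rf_and. apply rf_continuum_lt. reflexivity. }
  rewrite E. split. exact (@cofinal_iso_forced pp p). split. apply continuum_lt_forced.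
  exact (@weak_diamonds_forced pp e 0 p).
Qed.
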